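(* Let $\mu_1,\mu_2\in\mathbb{C}$ and consider the $(3,0)$ modular linear differential equation (MLDE) $$\Big(\mathcal{D}^3+\mu_1 E_4(\tau)\,\mathcal{D}+\mu_2E_6(\tau)\Big)\chi=0,$$ which in the coordinate $z=J(\tau)/1728$ reads $$\Big[\partial_z^3+\Big(\tfrac{2}{z}+\tfrac{3}{2(z-1)}\Big)\partial_z^2+\Big(\tfrac{2}{9z^2}+\tfrac{4}{3z(z-1)}+\tfrac{\mu_1}{z(z-1)}\Big)\partial_z-\tfrac{\mu_2}{z^2(z-1)}\Big]\chi=0 .$$ Let $w=1/z=1728/J(\tau)$, and let $\alpha_0,\alpha_1,\alpha_2$ be the local exponents of this equation at $w=0$ (so $\alpha_0+\alpha_1+\alpha_2=\tfrac12$, $\mu_1=\alpha_0\alpha_1+\alpha_1\alpha_2+\alpha_0\alpha_2-\tfrac1{18}$ and $\mu_2=-\alpha_0\alpha_1\alpha_2$). Assume that no two of $\alpha_0,\alpha_1,\alpha_2$ differ by an integer (in particular they are pairwise distinct). Then the solutions of the $(3,0)$ MLDE are given by the solutions of the ${}_3F_2$ hypergeometric ordinary differential equation $$w\,D\,(D+\tfrac13)(D+\tfrac23)\,F=(D-\alpha_0)(D-\alpha_1)(D-\alpha_2)\,F,\qquad D=w\frac{d}{dw},$$ and the three solutions (a basis of the solution space near $w=0$) are $$G(\alpha_0,\alpha_1-1,\alpha_2-1;w),\qquad G(\alpha_1,\alpha_0-1,\alpha_2-1;w),\qquad G(\alpha_2,\alpha_0-1,\alpha_1-1;w),$$ wh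ere $$G(a,b,c;w):=\Big(\frac{w}{1728}\Big)^{a}\,{}_3F_2\big(a,\,a+\tfrac13,\,a+\tfrac23;\;a-b,\,a-c;\;w\big).$$
   Context: Notation: $\tau$ lies in the upper half plane, $q=e^{2\pi i\tau}$. The Eisenstein series are $E_2=1-24\sum_{n\ge1}\frac{nq^n}{1-q^n}$, $E_4=1+240\sum_{n\ge1}\frac{n^3q^n}{1-q^n}$, $E_6=1-504\sum_{n\ge1}\frac{n^5q^n}{1-q^n}$; $\Delta=(E_4^3-E_6^2)/1728$ and $J=E_4^3/\Delta=q^{-1}+744+196884q+\cdots$. The Serre–Ramanujan derivative on weight $k$ is $\mathcal{D}_k=q\frac{d}{dq}-\frac{k}{12}E_2$, mapping weight $k$ to weight $k+2$; on weight-zero objects $\mathcal{D}=\mathcal{D}_0$ and $\mathcal{D}^3=\mathcal{D}_4\mathcal{D}_2\mathcal{D}_0$. A ''$(3,0)$ MLDE'' is the monic third-order modular-invariant linear differential equation on weight-zero functions with holomorphic modular form coefficients (three solutions, Wronskian index $\ell=0$); its general form is the one displayed in the claim. The cusp $\tau\to i\infty$ corresponds to $w=0$ (i.e. $z=\infty$), and the elliptic points $\tau=e^{2\pi i/3}$ and $\tau=i$ correspond to $w=\infty$ and $w=1$ respectively. The local exponents at $w=0$ are the numbers $\alpha$ for which there are Frobenius series solutions with leading behaviour $w^{\alpha}$, i.e. the roots (with multiplicity) of the indicial equation at $w=0$. ${}_3F_2(a_1,a_2,a_3;b_1,b_2;w)=\sum_{n\ge0}\frac{(a_1)_n(a_2)_n(a_3)_n}{(b_1)_n(b_2)_n}\frac{w^n}{n!}$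 is the generalized hypergeometric series, with $(x)_n=x(x+1)\cdots(x+n-1)$. *)

(* Defs.v *)
From Stdlib Require Export Reals Factorial.
From Coquelicot Require Export Coquelicot.

Open Scope C_scope.

Definition Cexp (x : C) : C :=
  (exp (Re x) * cos (Im x), exp (Re x) * sin (Im x))%R.

Definition CSeries (u : nat -> C) : C :=
  (Series (fun n => Re (u n)), Series (fun n => Im (u n))).

Definition Cderivable_on (V : C -> Prop) (f : C -> C) : Prop :=
  forall x, V x -> @ex_derive C_AbsRing C_NormedModule f x.

Definition thrice_derivable_on (V : C -> Prop) (f : C -> C) : Prop :=
  Cderivable_on V f /\
  Cderivable_on V (C_derive f) /\
  Cderivable_on V (C_derive (C_derive f)).

(* Classical solutions of the third-order equation L f = 0 on the open set V.
   Asking for three complex derivatives is the same as asking for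
   holomorphy. *)
Definition solves (L : (C -> C) -> C -> C) (V : C -> Prop) (f : C -> C)
  : Prop :=
  thrice_derivable_on V f /\ forall x, V x -> L f x = 0.

Definition Copen (V : C -> Prop) : Prop := @open C_UniformSpace V.

Definition Cconnected (V : C -> Prop) : Prop :=
  forall A B : C -> Prop, Copen A -> Copen B ->
    (forall x, V x -> A x \/ B x) ->
    (exists x, V x /\ A x) -> (exists x, V x /\ B x) ->
    exists x, V x /\ A x /\ B x.

Definition domain (V : C -> Prop) : Prop :=
  Copen V /\ Cconnected V /\ exists x, V x.

Definition upper_half_plane (tau : C) : Prop := (0 < Im tau)%R.

Definition nome (tau : C) : C := Cexp (2 * PI * Ci * tau).

Definition lambert (k : nat) (q : C) : C :=
  CSeries (fun n => INR (S n) ^ k * q ^ S n / (1 - q ^ S n)).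

Definition E2 (tau : C) : C := 1 - 24 * lambert 1 (nome tau).
Definition E4 (tau : C) : C := 1 + 240 * lambert 3 (nome tau).
Definition E6 (tau : C) : C := 1 - 504 * lambert 5 (nome tau).
Definition Delta (tau : C) : C := (E4 tau ^ 3 - E6 tau ^ 2) / 1728.
Definition J (tau : C) : C := E4 tau ^ 3 / Delta tau.

(* q d/dq = (2 pi i)^-1 d/dtau *)
Definition serre (k : R) (f : C -> C) (tau : C) : C :=
  C_derive f tau / (2 * PI * Ci) - k / 12 * E2 tau * f tau.

Definition mlde (mu1 mu2 : C) (chi : C -> C) (tau : C) : C :=
  serre 4 (serre 2 (serre 0 chi)) tau
  + mu1 * E4 tau * serre 0 chi tau + mu2 * E6 tau * chi tau.

Definition zcoord (tau : C) : C := J tau / 1728.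
Definition wcoord (tau : C) : C := 1728 / J tau.

Definition ode3 (p2 p1 p0 : C -> C) (f : C -> C) (z : C) : C :=
  C_derive (C_derive (C_derive f)) z + p2 z * C_derive (C_derive f) z
  + p1 z * C_derive f z + p0 z * f z.

Definition zp2 (z : C) : C := 2 / z + 3 / (2 * (z - 1)).
Definition zp1 (mu1 z : C) : C :=
  2 / (9 * z ^ 2) + 4 / (3 * (z * (z - 1))) + mu1 / (z * (z - 1)).
Definition zp0 (mu2 z : C) : C := - (mu2 / (z ^ 2 * (z - 1))).

Definition mlde_z (mu1 mu2 : C) : (C -> C) -> C -> C :=
  ode3 zp2 (zp1 mu1) (zp0 mu2).

(* With w = 1/z and D = w d/dw one has d/dz = - w D,
   (d/dz)^2 = w^2 D (D + 1) and (d/dz)^3 = - w^3 D (D + 1) (D + 2), so the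
   operator of ode3 is - w^3 times
     D (D+1) (D+2) - w^-1 p2 D (D+1) + w^-2 p1 D - w^-3 p0.
   If w^-1 p2, w^-2 p1 and w^-3 p0 tend to c2, c1 and c0 at w = 0, the indicial
   polynomial at w = 0 is the left-hand side below.  The exponents are its
   roots, counted with multiplicity. *)
Definition exponents_at_w0 (p2 p1 p0 : C -> C) (a0 a1 a2 : C) : Prop :=
  exists c2 c1 c0 : C,
    filterlim (fun w : C => p2 (/ w) / w) (locally' (0 : C)) (locally c2) /\
    filterlim (fun w : C => p1 (/ w) / w ^ 2) (locally' (0 : C)) (locally c1) /\
    filterlim (fun w : C => p0 (/ w) / w ^ 3) (locally' (0 : C)) (locally c0) /\
    forall r : C,
      r * (r + 1) * (r + 2) - c2 * (r * (r + 1)) + c1 * r - c0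
      = (r - a0) * (r - a1) * (r - a2).

Definition non_integer (a : C) : Prop := forall k : Z, a <> IZR k.

(* theta c is D + c, with D = w d/dw. *)
Definition theta (c : C) (F : C -> C) (w : C) : C :=
  w * C_derive F w + c * F w.

Definition hyper_ode (a0 a1 a2 : C) (F : C -> C) (w : C) : C :=
  w * theta 0 (theta (1 / 3) (theta (2 / 3) F)) w
  - theta (- a0) (theta (- a1) (theta (- a2) F)) w.

Fixpoint pochhammer (x : C) (n : nat) : C :=
  match n with
  | O => 1
  | S m => pochhammer x m * (x + INR m)
  end.

Definition F32 (a1 a2 a3 b1 b2 w : C) : C :=
  CSeries (fun n =>
    pochhammer a1 n * pochhammer a2 n * pochhammer a3 n
    / (pochhammer b1 n * pochhammer b2 n) * (w ^ n / INR (fact n))).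

(* The power (w/1728)^a is multivalued: l stands for the chosen value of
   log (w/1728). *)
Definition G (l a b c w : C) : C :=
  Cexp (a * l) * F32 a (a + 1 / 3) (a + 2 / 3) (a - b) (a - c) w.

Definition log_branch (V : C -> Prop) (h l : C -> C) : Prop :=
  forall x, V x ->
    @continuous C_UniformSpace C_UniformSpace l x /\ Cexp (l x) = h x.

Definition solution_basis (L : (C -> C) -> C -> C) (V : C -> Prop)
  (f0 f1 f2 : C -> C) : Prop :=
  solves L V f0 /\ solves L V f1 /\ solves L V f2 /\
  forall f, solves L V f ->
    exists! c : C * C * C, forall x, V x ->
      f x = fst (fst c) * f0 x + snd (fst c) * f1 x + snd c * f2 x.

Definition maps_onto (phi : C -> C) (V U : C -> Prop) : Prop :=
  (forall x, V x -> U (phi x)) /\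
  (forall y, U y -> exists x, V x /\ phi x = y).

Definition injective_on (phi : C -> C) (V : C -> Prop) : Prop :=
  forall x y, V x -> V y -> phi x = phi y -> x = y.

(* On S the map phi is a local coordinate, and in this coordinate the equation
   L chi = 0 becomes M f = 0: solutions of M on the image of an open V are
   exactly the functions whose pullback along phi solves L on V, and locally
   every solution of L is such a pullback. *)
Definition reads_in_coordinate (S : C -> Prop) (phi : C -> C)
  (L M : (C -> C) -> C -> C) : Prop :=
  (forall V U : C -> Prop, Copen V -> Copen U ->
     (forall x, V x -> S x) -> maps_onto phi V U ->
     forall f, solves M U f <-> solves L V (fun x => f (phi x))) /\
  (forall (W : C -> Prop) (x0 : C), Copen W -> W x0 ->
     (forall x, W x -> S x) ->
     exists V U : C -> Prop,
       Copen V /\ Copen U /\ V x0 /\ (forall x, V x -> W x) /\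
       maps_onto phi V U /\ injective_on phi V /\
       forall chi, solves L V chi ->
         exists f, solves M U f /\ forall x, V x -> chi x = f (phi x)).

(* J = 0 and J = 1728 at the elliptic points, where z is not a local
   coordinate and the equation in z is singular. *)
Definition non_elliptic (tau : C) : Prop :=
  upper_half_plane tau /\ J tau <> 0 /\ J tau <> 1728.

(* Main.v *)
(** The only modular input is Ramanujan's pair of identities
      [D_4 E4 = - E6 / 3]  and  [D_6 E6 = - E4^2 / 2];
    modularity itself is not needed.  They are convolution identities for divisor
    sums, and follow from the bijection [(a,b,x,y) -> (a-b,b,x,x+y)] between the
    positive solutions of [a x + b y = n] with [a > b] and those with [x < y],
    applied to binary forms invariant under [(a,b) -> (b,a)] and
    [(a,b) -> (a,a-b)].  They give [D w = w E6 / E4] and [D z = - z E6 / E4], and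
    then the chain rule for Serre derivatives turns the MLDE into [- E6] times the
    hypergeometric equation in [w], and into [(D z)^3] times the equation in [z].
    Solutions are transported through local inverses of [w] and [z].

    In the punctured disc the recurrence for the coefficients shows that the three
    series solve the hypergeometric equation.  Up to the factor [w^(1/2)] their
    Wronskian is a holomorphic function [d] on the whole disc with
    [(1 - w) d' = 3/2 d]; as [d 0] is the Vandermonde determinant of the exponents,
    Gronwall's inequality along rays shows that [d] never vanishes.  So the series
    form a basis near every point, and uniqueness of the coefficients propagates it
    over a connected open set. *)

Require Import Defs.
From Stdlib Require Import Lra Lia Psatz Classical FunctionalExtensionality.

(** * Complex differentiation *)

(** Holomorphy enters only through complex derivatives and estimates along real segments: two
    solutions are compared by Gronwall's inequality for the triple of the function and its first two
    derivatives, and a local inverse is a limit of Newton iterates. The convolution identities come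
    from comparing [F a b] with [F a (- b)] for an invariant form [F]. The bijection makes all
    off-diagonal parts of the two sums equal, so their difference reduces to the diagonals [a = b]
    and [x = y], which are divisor sums. The difference sees only the part of [F] odd in [b], and
    the forms are chosen so that this part yields the wanted products of divisor sums. Each solution
    is split as [w^a] times a power series on the unit disc. The power is multivalued and singular
    at [w = 0], but the determinant of the series factors can be evaluated there. The power of [w]
    that is split off is [w^(1/2)] because the exponents add up to 1/2. *)

Definition Cder (f : C -> C) (x l : C) : Prop :=
  @is_derive C_AbsRing C_NormedModule f x l.

(** Neighbourhoods are explicit [Cmod] balls, so that estimates stay linear arithmetic. The two
    lemmas below translate to the product structure on [C] that the statement uses and to the
    structure given by the modulus, in which derivatives are defined. *)
Definition near (x : C) (P : C -> Prop) : Prop :=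
  exists d : R, (0 < d)%R /\ forall y, (Cmod (y - x) < d)%R -> P y.

Lemma near_locally (x : C) (P : C -> Prop) :
  near x P <-> @locally C_UniformSpace x P.
Proof.
  rewrite locally_C. split.
  - intros [d [Hd H]]. exists (mkposreal d Hd). intros y Hy. apply H.
    exact Hy.
  - intros [d H]. exists d. split; [apply cond_pos|].
    intros y Hy. apply H. exact Hy.
Qed.

Lemma near_locally' (x : C) (P : C -> Prop) :
  near x P <-> @locally (AbsRing_UniformSpace C_AbsRing) x P.
Proof. rewrite near_locally. apply locally_C. Qed.

Lemma Copen_near (V : C -> Prop) : Copen V <-> forall x, V x -> near x V.
Proof.
  unfold Copen, open. split; intros H x Hx; apply near_locally; apply H; exact Hx.
Qed.

Lemma near_and x P Q : near x P -> near x Q -> near x (fun y => P y /\ Q y).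
Proof. rewrite !near_locally. apply filter_and. Qed.

Lemma near_imp x (P Q : C -> Prop) : (forall y, P y -> Q y) -> near x P -> near x Q.
Proof. rewrite !near_locally. apply filter_imp. Qed.

Lemma near_self x (P : C -> Prop) : near x P -> P x.
Proof. rewrite near_locally. apply locally_singleton. Qed.

Lemma Cder_eps f x l : Cder f x l <->
  forall eps : R, (0 < eps)%R ->
    near x (fun y => (Cmod (f y - f x - l * (y - x)) <= eps * Cmod (y - x))%R).
Proof.
  split.
  - intros [_ H] eps He.
    specialize (H x (fun P HP => HP)). specialize (H (mkposreal eps He)).
    apply near_locally'. revert H. apply filter_imp. intros y Hy. simpl in Hy.
    replace (l * (y - x)) with ((y - x) * l) by ring. exact Hy.
  - intros H. split.
    + apply (is_linear_scal_l (K := C_AbsRing) (V := C_NormedModule)).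
    + intros x0 Hx0 eps.
      assert (E : x = x0).
      { apply (is_filter_lim_locally_unique (V := AbsRing_NormedModule C_AbsRing)).
        exact Hx0. }
      subst x0.
      specialize (H eps (cond_pos eps)). apply near_locally' in H.
      revert H. apply filter_imp. intros y Hy. 
      replace (l * (y - x)) with ((y - x) * l) in Hy by ring. exact Hy.
Qed.

Lemma Cder_unique f x l : Cder f x l -> C_derive f x = l.
Proof. apply is_C_derive_unique. Qed.

Lemma Cder_correct f x : @ex_derive C_AbsRing C_NormedModule f x -> Cder f x (C_derive f x).
Proof. intros H. apply C_derive_correct; [exact x | exact H]. Qed.

Lemma Cder_ex f x l : Cder f x l -> @ex_derive C_AbsRing C_NormedModule f x.
Proof. intros H; exists l; exact H. Qed.

Lemma Cder_ext_near f g x l : near x (fun y => f y = g y) -> Cder f x l -> Cder g x l.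
Proof.
  intros H. apply is_derive_ext_loc. apply near_locally'. exact H.
Qed.

Lemma Cder_eq f x l l' : Cder f x l -> l = l' -> Cder f x l'.
Proof. intros H <-. exact H. Qed.

(* Coquelicot states the product and chain rules for [C] as a normed module over
   itself, whose uniform structure is not definitionally that of
   [C_NormedModule]. *)
Lemma Cder_absring f x l :
  @is_derive C_AbsRing (AbsRing_NormedModule C_AbsRing) f x l -> Cder f x l.
Proof.
  intros [_ H]. apply Cder_eps. intros eps He.
  specialize (H x (fun P HP => HP) (mkposreal eps He)).
  apply near_locally'. revert H. apply filter_imp. intros y Hy.
  replace (l * (y - x)) with ((y - x) * l) by ring. exact Hy.
Qed.

Lemma Cder_absring_inv f x l :
  Cder f x l -> @is_derive C_AbsRing (AbsRing_NormedModule C_AbsRing) f x l.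
Proof.
  intros [_ H]. split.
  - apply (is_linear_scal_l (K := C_AbsRing) (V := AbsRing_NormedModule C_AbsRing)).
  - exact H.
Qed.

Lemma Cder_const (c x : C) : Cder (fun _ => c) x 0.
Proof. apply (is_derive_const (K := C_AbsRing) (V := C_NormedModule)). Qed.

Lemma Cder_id (x : C) : Cder (fun y => y) x 1.
Proof. apply Cder_absring. exact (is_derive_id (K := C_AbsRing) x). Qed.

Lemma Cder_plus f g x a b : Cder f x a -> Cder g x b -> Cder (fun y => f y + g y) x (a + b).
Proof. apply (is_derive_plus (K := C_AbsRing) (V := C_NormedModule)). Qed.

Lemma Cder_opp f x a : Cder f x a -> Cder (fun y => - f y) x (- a).
Proof. apply (is_derive_opp (K := C_AbsRing) (V := C_NormedModule)). Qed.

Lemma Cder_minus f g x a b : Cder f x a -> Cder g x b -> Cder (fun y => f y - g y) x (a - b).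
Proof. apply (is_derive_minus (K := C_AbsRing) (V := C_NormedModule)). Qed.

Lemma Cder_mult f g x a b : Cder f x a -> Cder g x b ->
  Cder (fun y => f y * g y) x (a * g x + f x * b).
Proof.
  intros H1 H2. apply Cder_absring_inv in H1, H2. apply Cder_absring.
  refine (is_derive_mult (K := C_AbsRing) f g x a b H1 H2 _).
  intros n m. apply Cmult_comm.
Qed.

Lemma Cder_comp f g x a b : Cder f (g x) a -> Cder g x b -> Cder (fun y => f (g y)) x (a * b).
Proof.
  intros H1 H2. apply Cder_eq with (b * a); [|apply Cmult_comm].
  apply Cder_absring_inv in H2.
  exact (is_derive_comp (K := C_AbsRing) (V := C_NormedModule) f g x a b H1 H2).
Qed.

Lemma Cder_scal c f x a : Cder f x a -> Cder (fun y => c * f y) x (c * a).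
Proof.
  intros H. apply Cder_eq with (0 * f x + c * a); [|ring]. apply Cder_mult; [apply Cder_const|exact H].
Qed.

Lemma Cder_pow f x a n : Cder f x a ->
  Cder (fun y => f y ^ n) x (INR n * f x ^ pred n * a).
Proof.
  intros H. induction n as [|n IH].
  - apply Cder_eq with (RtoC 0); [exact (Cder_const 1 x)|simpl; ring].
  - apply Cder_eq with (a * f x ^ n + f x * (INR n * f x ^ pred n * a)).
    + apply (Cder_mult f (fun y => f y ^ n)); assumption.
    + rewrite S_INR, RtoC_plus. destruct n; simpl; ring.
Qed.

Lemma Cmod_sub_sym x y : Cmod (x - y) = Cmod (y - x).
Proof. rewrite <- Cmod_opp. f_equal. ring. Qed.

Lemma Cmod_triangle_rev x y : (Cmod x - Cmod y <= Cmod (x - y))%R.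
Proof.
  generalize (Cmod_triangle (x - y) y). replace (x - y + y) with x by ring. lra.
Qed.

Definition Ccont (f : C -> C) (x : C) : Prop :=
  forall eps : R, (0 < eps)%R -> near x (fun y => (Cmod (f y - f x) < eps)%R).

Lemma Cder_cont f x l : Cder f x l -> Ccont f x.
Proof.
  intros H eps He. apply Cder_eps with (eps := 1%R) in H; [|lra].
  destruct H as [d [Hd H]].
  pose proof (Cmod_ge_0 l).
  exists (Rmin d (eps / (2 + Cmod l))). split.
  { apply Rmin_pos; [lra|]. apply Rdiv_lt_0_compat; lra. }
  intros y Hy.
  assert (Hy1 : (Cmod (y - x) < d)%R) by (eapply Rlt_le_trans; [exact Hy|apply Rmin_l]).
  assert (Hy2 : (Cmod (y - x) < eps / (2 + Cmod l))%R) by (eapply Rlt_le_trans; [exact Hy|apply Rmin_r]).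
  specialize (H y Hy1).
  generalize (Cmod_triangle (f y - f x - l * (y - x)) (l * (y - x))).
  replace (f y - f x - l * (y - x) + l * (y - x)) with (f y - f x) by ring.
  rewrite Cmod_mult. intros H1.
  apply Rlt_div_r in Hy2; [|lra]. pose proof (Cmod_ge_0 (y - x)). nra.
Qed.

Lemma Cder_inv_id (x : C) : x <> 0 -> Cder Cinv x (- / (x * x)).
Proof.
  intros Hx. assert (Hm : (0 < Cmod x)%R) by (apply Cmod_gt_0; exact Hx).
  apply Cder_eps. intros eps He.
  (* The remainder is [(y - x)^2 / (x^2 y)]. The first radius keeps [Cmod y] above [Cmod x / 2], and
     the second then makes the quotient at most [eps]. *)
  exists (Rmin (Cmod x / 2) (eps * (Cmod x ^ 3) / 2)). split.
  { assert (0 < Cmod x ^ 3)%R by (apply pow_lt; lra). apply Rmin_pos; nra. }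
  intros y Hy.
  assert (Hy1 : (Cmod (y - x) < Cmod x / 2)%R) by (eapply Rlt_le_trans; [exact Hy|apply Rmin_l]).
  assert (Hy2 : (Cmod (y - x) < eps * (Cmod x ^ 3) / 2)%R) by (eapply Rlt_le_trans; [exact Hy|apply Rmin_r]).
  assert (Hy3 : (Cmod x / 2 < Cmod y)%R).
  { generalize (Cmod_triangle_rev x y). rewrite Cmod_sub_sym. lra. }
  assert (Hy0 : y <> 0) by (apply Cmod_gt_0; lra).
  replace (/ y - / x - - / (x * x) * (y - x)) with ((y - x) * ((y - x) * (/ (x * x) * / y)))
    by (field; split; assumption).
  rewrite 2!Cmod_mult, (Rmult_comm (Cmod _)).
  apply Rmult_le_compat_r; [apply Cmod_ge_0|].
  rewrite Cmod_mult, (Cmod_inv y Hy0), (Cmod_inv (x * x)), Cmod_mult by (apply Cmult_neq_0; exact Hx).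
  apply Rmult_le_reg_r with (Cmod x * Cmod x * Cmod y)%R;
    [repeat apply Rmult_lt_0_compat; lra|].
  replace (Cmod (y - x) * (/ (Cmod x * Cmod x) * / Cmod y) * (Cmod x * Cmod x * Cmod y))%R
    with (Cmod (y - x)) by (field; lra).
  assert (0 < eps * (Cmod x * Cmod x))%R by (apply Rmult_lt_0_compat; nra).
  simpl in Hy2. nra.
Qed.

Lemma Cder_inv (f : C -> C) (x a : C) : f x <> 0 -> Cder f x a -> Cder (fun y => / f y) x (- a / (f x * f x)).
Proof.
  intros H0 H. eapply Cder_eq; [apply Cder_comp; [apply Cder_inv_id; exact H0|exact H]|].
  field; exact H0.
Qed.

Lemma Cder_div (f g : C -> C) (x a b : C) : g x <> 0 -> Cder f x a -> Cder g x b ->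
  Cder (fun y => f y / g y) x ((a * g x - f x * b) / (g x * g x)).
Proof.
  intros H0 Hf Hg. eapply Cder_eq; [apply Cder_mult; [exact Hf|apply Cder_inv; eassumption]|].
  cbv beta; field; exact H0.
Qed.

Lemma near_ball (x0 x : C) (r : R) : (Cmod (x - x0) < r)%R ->
  near x (fun y => (Cmod (y - x0) < r)%R).
Proof.
  intros H. exists (r - Cmod (x - x0))%R. split; [lra|]. intros y Hy.
  generalize (Cmod_triangle (y - x) (x - x0)). 
  replace (y - x + (x - x0)) with (y - x0) by ring. lra.
Qed.

Lemma Copen_ball x0 r : Copen (fun y => (Cmod (y - x0) < r)%R).
Proof. apply Copen_near. intros x. apply near_ball. Qed.

Lemma Ccont_near f x (P : C -> Prop) : Ccont f x -> near (f x) P -> near x (fun y => P (f y)).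
Proof.
  intros H [d [Hd HP]]. destruct (H d Hd) as [e [He H']]. exists e; split; [exact He|].
  intros y Hy. apply HP, H', Hy.
Qed.

(** * Restriction to segments and the mean value inequality *)

Lemma ball_segment (x0 a b : C) (r t : R) : (0 <= t <= 1)%R ->
  (Cmod (a - x0) < r)%R -> (Cmod (b - x0) < r)%R ->
  (Cmod (a + t * (b - a) - x0) < r)%R.
Proof.
  intros Ht Ha Hb.
  replace (a + t * (b - a) - x0) with (RtoC (1 - t) * (a - x0) + RtoC t * (b - x0))
    by (rewrite RtoC_minus; ring).
  eapply Rle_lt_trans; [apply Cmod_triangle|].
  rewrite !Cmod_mult, !Cmod_R, !Rabs_pos_eq by lra.
  destruct (Req_dec t 0) as [->|]; [lra|]. nra.
Qed.

Lemma Re_minus (a b : C) : Re (a - b) = (Re a - Re b)%R.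
Proof. reflexivity. Qed.
Lemma Im_minus (a b : C) : Im (a - b) = (Im a - Im b)%R.
Proof. reflexivity. Qed.
Lemma Re_plus (a b : C) : Re (a + b) = (Re a + Re b)%R.
Proof. reflexivity. Qed.
Lemma Im_plus (a b : C) : Im (a + b) = (Im a + Im b)%R.
Proof. reflexivity. Qed.

Lemma im_le_Cmod (c : C) : (Rabs (Im c) <= Cmod c)%R.
Proof. eapply Rle_trans; [apply Rmax_r|apply (Rmax_Cmod c)]. Qed.

(** One proof for [Re] and [Im], both of which are real-linear and bounded by the modulus. *)
Lemma is_derive_line (p : C -> R) f (a v l : C) (t : R) :
  (forall x y, p (x - y) = (p x - p y)%R) -> (forall x, (Rabs (p x) <= Cmod x)%R) ->
  (forall (s : R) x, p (s * x) = (s * p x)%R) ->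
  Cder f (a + t * v) l ->
  is_derive (fun s : R => p (f (a + s * v))) t (p (l * v)).
Proof.
  intros Hm Hb Hs H. apply is_derive_Reals. intros eps He.
  pose proof (Cmod_ge_0 v).
  apply Cder_eps with (eps := (eps / (2 + Cmod v))%R) in H; [|apply Rdiv_lt_0_compat; lra].
  destruct H as [d [Hd H]].
  assert (Hd' : (0 < d / (1 + Cmod v))%R) by (apply Rdiv_lt_0_compat; lra).
  exists (mkposreal _ Hd'). intros h Hh0 Hh. simpl in Hh.
  apply Rlt_div_r in Hh; [|lra].
  specialize (H (a + (t + h)%R * v)).
  replace (a + (t + h)%R * v - (a + t * v)) with (h * v) in H by (rewrite RtoC_plus; ring).
  rewrite Cmod_mult, Cmod_R in H.
  pose proof (Rabs_pos_lt h Hh0).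
  assert (H' : (Rabs h * Cmod v < d)%R) by nra. specialize (H H').
  set (A := f (a + (t + h)%R * v)) in *. set (B := f (a + t * v)) in *.
  replace ((p A - p B) / h - p (l * v)%C)%R with (p (A - B - l * (h * v))%C / h)%R.
  2:{ rewrite !Hm. replace (l * (h * v)) with (h * (l * v)) by ring. rewrite Hs. field. exact Hh0. }
  unfold Rdiv. rewrite Rabs_mult, Rabs_inv.
  apply Rmult_lt_reg_r with (Rabs h); [lra|].
  rewrite Rmult_assoc, Rinv_l, Rmult_1_r by lra.
  eapply Rle_lt_trans; [apply Hb|]. eapply Rle_lt_trans; [exact H|].
  replace (eps / (2 + Cmod v) * (Rabs h * Cmod v))%R with (eps * Rabs h * (Cmod v / (2 + Cmod v)))%R by (field; lra).
  rewrite <- (Rmult_1_r (eps * Rabs h)) at 2.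
  apply Rmult_lt_compat_l; [nra|]. apply Rlt_div_l; lra.
Qed.

Lemma is_derive_Re_line f (a v l : C) (t : R) :
  Cder f (a + t * v) l -> is_derive (fun s : R => Re (f (a + s * v))) t (Re (l * v)).
Proof. apply is_derive_line. apply Re_minus. apply re_le_Cmod. apply re_scal_l. Qed.

Lemma is_derive_Im_line f (a v l : C) (t : R) :
  Cder f (a + t * v) l -> is_derive (fun s : R => Im (f (a + s * v))) t (Im (l * v)).
Proof. apply is_derive_line. apply Im_minus. apply im_le_Cmod. apply im_scal_l. Qed.

(** The mean value theorem fails for complex values, so the real one is applied to [Re (u * f)] with
    [u] the conjugate of the total increment. The increment of this real function is the square of
    [Cmod (f b - f a)]. *)
Lemma mean_value_ineq f f' (a b : C) (K : R) :
  (forall t : R, (0 <= t <= 1)%R -> Cder f (a + t * (b - a)) (f' (a + t * (b - a)))) ->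
  (forall t : R, (0 <= t <= 1)%R -> (Cmod (f' (a + t * (b - a))%C) <= K)%R) ->
  (Cmod (f b - f a) <= K * Cmod (b - a))%R.
Proof.
  intros HD HK. set (u := Cconj (f b - f a)).
  destruct (Req_dec (Cmod (f b - f a)) 0) as [E|E].
  { rewrite E. apply Rmult_le_pos; [|apply Cmod_ge_0].
    eapply Rle_trans; [apply Cmod_ge_0|apply (HK 0%R); lra]. }
  pose proof (Cmod_ge_0 (f b - f a)) as Hp.
  assert (HD' : forall t : R, (0 <= t <= 1)%R ->
     is_derive (fun s : R => Re (u * f (a + s * (b - a)))) t (Re (u * f' (a + t * (b - a)) * (b - a)))).
  { intros t Ht. apply (is_derive_Re_line (fun z => u * f z)). apply Cder_scal, HD, Ht. }
  destruct (MVT_gen (fun s : R => Re (u * f (a + s * (b - a)))) 0 1 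
    (fun t => Re (u * f' (a + t * (b - a)) * (b - a)))) as [c [Hc Heq]].
  { intros t Ht. apply HD'. rewrite Rmin_left, Rmax_right in Ht by lra. lra. }
  { intros t Ht. rewrite Rmin_left, Rmax_right in Ht by lra.
    apply derivable_continuous_pt. eexists. apply is_derive_Reals. apply HD'. lra. }
  rewrite Rmin_left, Rmax_right in Hc by lra.
  replace (a + 1%R * (b - a)) with b in Heq by ring.
  replace (a + 0%R * (b - a)) with a in Heq by ring.
  rewrite <- Re_minus in Heq. 
  replace (u * f b - u * f a) with ((f b - f a) * Cconj (f b - f a)) in Heq by (unfold u; ring).
  rewrite <- Cmod2_conj, re_RtoC in Heq.
  assert (H : (Cmod (f b - f a) ^ 2 <= Cmod (f b - f a) * (K * Cmod (b - a)))%R).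
  { rewrite Heq. rewrite Rminus_0_r, Rmult_1_r. eapply Rle_trans; [apply Rle_abs|].
    eapply Rle_trans; [apply re_le_Cmod|]. rewrite !Cmod_mult. unfold u. rewrite Cmod_conj.
    rewrite Rmult_assoc. apply Rmult_le_compat_l; [exact Hp|].
    apply Rmult_le_compat_r; [apply Cmod_ge_0|]. apply HK. exact Hc. }
  apply Rmult_le_reg_l with (Cmod (f b - f a)); [lra|]. simpl in H. lra.
Qed.

(** * Gronwall's inequality and series *)

Lemma gronwall_real (phi dphi : R -> R) (K : R) :
  (forall t, (0 < t < 1)%R -> is_derive phi t (dphi t)) ->
  (forall t, (0 < t < 1)%R -> (dphi t <= K * phi t)%R) ->
  (forall t, (0 <= t <= 1)%R -> continuity_pt phi t) ->
  phi 0%R = 0%R -> (phi 1 <= 0)%R.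
Proof.
  intros HD HK Hc H0.
  (* The derivative of [phi t * exp (- K t)] on the open interval. The mean value point may be an
     endpoint, where nothing is assumed about [dphi]; the default 0 keeps [df c <= 0] there. *)
  set (df := fun t => if Rlt_dec 0 t then if Rlt_dec t 1 then
     ((dphi t - K * phi t) * exp (- K * t))%R else 0%R else 0%R).
  destruct (MVT_gen (fun t => (phi t * exp (- K * t))%R) 0 1 df) as [c [Hcc Heq]].
  - intros t Ht. rewrite Rmin_left, Rmax_right in Ht by lra. unfold df.
    destruct (Rlt_dec 0 t); [|lra]. destruct (Rlt_dec t 1); [|lra].
    replace ((dphi t - K * phi t) * exp (- K * t))%R with
      (dphi t * exp (- K * t) + phi t * (- K * exp (- K * t)))%R by ring.
    apply (Derive.is_derive_mult phi (fun t => exp (- K * t))); [apply HD; lra|].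
    auto_derive; [exact I|]. ring.
  - intros t Ht. rewrite Rmin_left, Rmax_right in Ht by lra.
    apply continuity_pt_mult; [apply Hc; lra|]. apply derivable_continuous_pt. reg.
  - rewrite H0 in Heq.
    assert (Hd : (df c <= 0)%R).
    { unfold df. destruct (Rlt_dec 0 c); [|lra]. destruct (Rlt_dec c 1); [|lra].
      specialize (HK c ltac:(lra)). pose proof (exp_pos (- K * c)). nra. }
    pose proof (exp_pos (- K * 1)). nra.
Qed.

Lemma continuity_line (p : C -> R) f (a v : C) (t : R) :
  (forall x y, p (x - y) = (p x - p y)%R) -> (forall x, (Rabs (p x) <= Cmod x)%R) ->
  Ccont f (a + t * v) -> continuity_pt (fun s : R => p (f (a + s * v))) t.
Proof.
  intros Hm Hb H eps He. destruct (H eps He) as [d [Hd H']].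
  pose proof (Cmod_ge_0 v).
  exists (d / (1 + Cmod v))%R. split; [apply Rdiv_lt_0_compat; lra|].
  intros s [_ Hs]. simpl in *. unfold R_dist in *. rewrite <- Hm.
  eapply Rle_lt_trans; [apply Hb|]. apply H'.
  replace (a + s * v - (a + t * v)) with (RtoC (s - t) * v) by (rewrite RtoC_minus; ring).
  rewrite Cmod_mult, Cmod_R. apply Rlt_div_r in Hs; [|lra].
  pose proof (Rabs_pos (s - t)). nra.
Qed.

Lemma Cdot_le (x y : C) : (Re x * Re y + Im x * Im y <= Cmod x * Cmod y)%R.
Proof.
  replace (Re x * Re y + Im x * Im y)%R with (Re (x * Cconj y)).
  - eapply Rle_trans; [apply Rle_abs|]. eapply Rle_trans; [apply re_le_Cmod|].
    rewrite Cmod_mult, Cmod_conj. lra.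
  - destruct x, y. simpl. ring.
Qed.

(** Gronwall's inequality is applied to the sum of the squared moduli, which is differentiable even
    where a modulus is not. Derivatives are bounded on the open segment only, so an endpoint may be
    a singular point of the equation. *)
Lemma gronwall_segment (y0 y1 y2 d0 d1 d2 : C -> C) (a b : C) (K : R) :
  let s := fun t : R => a + t * (b - a) in
  let N := fun z => (Cmod (y0 z) + Cmod (y1 z) + Cmod (y2 z))%R in
  (forall t, (0 < t < 1)%R -> Cder y0 (s t) (d0 (s t)) /\ Cder y1 (s t) (d1 (s t)) /\ Cder y2 (s t) (d2 (s t))) ->
  (forall t, (0 < t < 1)%R -> (Cmod (d0 (s t)) <= K * N (s t) /\
     Cmod (d1 (s t)) <= K * N (s t) /\ Cmod (d2 (s t)) <= K * N (s t))%R) ->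
  (forall t, (0 <= t <= 1)%R -> Ccont y0 (s t) /\ Ccont y1 (s t) /\ Ccont y2 (s t)) ->
  y0 a = 0 -> y1 a = 0 -> y2 a = 0 ->
  y0 b = 0 /\ y1 b = 0 /\ y2 b = 0.
Proof.
  intros s N HD HK Hc E0 E1 E2.
  set (sq := fun (f : C -> C) (t : R) => (Re (f (s t)) * Re (f (s t)) + Im (f (s t)) * Im (f (s t)))%R).
  set (dsq := fun (f d : C -> C) (t : R) =>
    (Re (d (s t) * (b - a)) * Re (f (s t)) + Re (f (s t)) * Re (d (s t) * (b - a)) +
    (Im (d (s t) * (b - a)) * Im (f (s t)) + Im (f (s t)) * Im (d (s t) * (b - a))))%R).
  assert (Dsq : forall f d t, Cder f (s t) (d (s t)) -> is_derive (sq f) t (dsq f d t)).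
  { intros f d t H. unfold sq, dsq.
    apply (is_derive_plus (K := R_AbsRing) (V := R_NormedModule)).
    - apply Derive.is_derive_mult; apply (is_derive_Re_line f); exact H.
    - apply Derive.is_derive_mult; apply (is_derive_Im_line f); exact H. }
  assert (Csq : forall f t, Ccont f (s t) -> continuity_pt (sq f) t).
  { intros f t H. apply continuity_pt_plus; apply continuity_pt_mult;
      first [apply (continuity_line Re f) | apply (continuity_line Im f)];
      try exact H; try apply Re_minus; try apply Im_minus; try apply re_le_Cmod; try apply im_le_Cmod. }
  assert (Msq : forall f t, sq f t = (Cmod (f (s t)) ^ 2)%R).
  { intros f t. rewrite Cmod2_alt. unfold sq. ring. }
  assert (Bsq : forall f d t, (dsq f d t <= 2 * (Cmod (d (s t)) * Cmod (b - a) * Cmod (f (s t))))%R).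
  { intros f d t. rewrite <- Cmod_mult. pose proof (Cdot_le (d (s t) * (b - a)) (f (s t))).
    unfold dsq. lra. }
  assert (S0 : s 0%R = a) by (unfold s; ring).
  assert (S1 : s 1%R = b) by (unfold s; ring).
  pose proof (Cmod_ge_0 (b - a)) as Hba.
  assert (H : (sq y0 1 + sq y1 1 + sq y2 1 <= 0)%R).
  (* With moduli [u0, u1, u2], the derivative is at most [2 K |b - a| (u0 + u1 + u2)^2], and the
     square of the sum is at most three times the sum of squares; hence 6. [Rmax K 0] covers a
     negative [K]. *)
  { apply (gronwall_real (fun t => (sq y0 t + sq y1 t + sq y2 t)%R)
      (fun t => (dsq y0 d0 t + dsq y1 d1 t + dsq y2 d2 t)%R) (6 * Rmax K 0 * Cmod (b - a))).
    - intros t Ht. destruct (HD t Ht) as [h0 [h1 h2]].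
      apply (is_derive_plus (K := R_AbsRing) (V := R_NormedModule)); [|apply Dsq; exact h2].
      apply (is_derive_plus (K := R_AbsRing) (V := R_NormedModule)); apply Dsq; assumption.
    - intros t Ht. destruct (HK t Ht) as [h0 [h1 h2]].
      pose proof (Bsq y0 d0 t) as B0. pose proof (Bsq y1 d1 t) as B1. pose proof (Bsq y2 d2 t) as B2.
      rewrite !Msq. unfold N in *.
      pose proof (Cmod_ge_0 (y0 (s t))). pose proof (Cmod_ge_0 (y1 (s t))). pose proof (Cmod_ge_0 (y2 (s t))).
      pose proof (Cmod_ge_0 (d0 (s t))). pose proof (Cmod_ge_0 (d1 (s t))). pose proof (Cmod_ge_0 (d2 (s t))).
      pose proof (Rmax_l K 0). pose proof (Rmax_r K 0).
      set (u0 := Cmod (y0 (s t))) in *. set (u1 := Cmod (y1 (s t))) in *. set (u2 := Cmod (y2 (s t))) in *.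
      set (v0 := Cmod (d0 (s t))) in *. set (v1 := Cmod (d1 (s t))) in *. set (v2 := Cmod (d2 (s t))) in *.
      set (K' := Rmax K 0) in *. set (B := Cmod (b - a)) in *.
      assert (I : forall v u, (0 <= u -> v <= K * (u0 + u1 + u2) -> 2 * (v * B * u) <= 2 * (K' * B) * ((u0 + u1 + u2) * u))%R).
      { intros v u Hu Hv. assert (v <= K' * (u0 + u1 + u2))%R by nra.
        assert (0 <= B * u)%R by nra. nra. }
      pose proof (I v0 u0 ltac:(assumption) h0) as I0.
      pose proof (I v1 u1 ltac:(assumption) h1) as I1.
      pose proof (I v2 u2 ltac:(assumption) h2) as I2.
      assert ((u0 + u1 + u2) * u0 + (u0 + u1 + u2) * u1 + (u0 + u1 + u2) * u2 <= 3 * (u0 ^ 2 + u1 ^ 2 + u2 ^ 2))%R.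
      { pose proof (pow2_ge_0 (u0 - u1)). pose proof (pow2_ge_0 (u0 - u2)). pose proof (pow2_ge_0 (u1 - u2)). lra. }
      assert (0 <= K' * B)%R by nra. nra.
    - intros t Ht. destruct (Hc t Ht) as [h0 [h1 h2]].
      apply continuity_pt_plus; [apply continuity_pt_plus|]; apply Csq; assumption.
    - rewrite !Msq, S0, E0, E1, E2, Cmod_0. ring. }
  rewrite !Msq, S1 in H.
  pose proof (pow2_ge_0 (Cmod (y0 b))). pose proof (pow2_ge_0 (Cmod (y1 b))). pose proof (pow2_ge_0 (Cmod (y2 b))).
  assert (Z : forall z, (Cmod z ^ 2 <= 0)%R -> z = 0).
  { intros z Hz. apply Cmod_eq_0. pose proof (Cmod_ge_0 z). nra. }
  repeat split; apply Z; lra.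
Qed.

(** * Limits of complex sequences and absolutely convergent series *)

Definition Clim (u : nat -> C) (l : C) : Prop :=
  forall eps : R, (0 < eps)%R -> exists N : nat, forall n, (N <= n)%nat -> (Cmod (u n - l) < eps)%R.

(** The sum of the first [n] terms, whereas [sum_n u n] has [n + 1] of them; the empty sum makes the
    inductions and the manipulation of double sums start at 0. *)
Fixpoint Csum (u : nat -> C) (n : nat) : C :=
  match n with O => 0 | S m => Csum u m + u m end.

Fixpoint Rsum (u : nat -> R) (n : nat) : R :=
  match n with O => 0%R | S m => (Rsum u m + u m)%R end.

Definition summable (u : nat -> C) : Prop :=
  exists B : R, forall n, (Rsum (fun k => Cmod (u k)) n <= B)%R.

Lemma Rsum_le u v n : (forall k, (u k <= v k)%R) -> (Rsum u n <= Rsum v n)%R.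
Proof. intros H. induction n; simpl; [lra|]. specialize (H n). lra. Qed.

Lemma Rsum_scal c u n : Rsum (fun k => (c * u k)%R) n = (c * Rsum u n)%R.
Proof. induction n; simpl; [ring|]. rewrite IHn. ring. Qed.

Lemma Rsum_sum_n u n : Rsum u (S n) = sum_n u n.
Proof.
  induction n.
  - simpl. rewrite sum_O. ring.
  - rewrite sum_Sn. change (Rsum u (S (S n))) with (Rsum u (S n) + u (S n))%R. rewrite IHn. reflexivity.
Qed.

Lemma Cmod_Csum u n : (Cmod (Csum u n) <= Rsum (fun k => Cmod (u k)) n)%R.
Proof.
  induction n; simpl; [rewrite Cmod_0; lra|].
  eapply Rle_trans; [apply Cmod_triangle|]. lra.
Qed.

Lemma Csum_ext u v n : (forall k, (k < n)%nat -> u k = v k) -> Csum u n = Csum v n.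
Proof. intros H. induction n; simpl; [reflexivity|]. rewrite IHn, H; [reflexivity|lia|intros; apply H; lia]. Qed.

Lemma Csum_plus u v n : Csum (fun k => u k + v k) n = Csum u n + Csum v n.
Proof. induction n; simpl; [ring|]. rewrite IHn. ring. Qed.

Lemma Csum_scal c u n : Csum (fun k => c * u k) n = c * Csum u n.
Proof. induction n; simpl; [ring|]. rewrite IHn. ring. Qed.

Lemma Csum_shift u n : Csum u (S n) = u 0%nat + Csum (fun k => u (S k)) n.
Proof.
  induction n; [simpl; ring|].
  change (Csum u (S (S n))) with (Csum u (S n) + u (S n)). rewrite IHn. simpl. ring.
Qed.

Lemma Re_Csum u n : Re (Csum u n) = Rsum (fun k => Re (u k)) n.
Proof.
  induction n; [reflexivity|]. change (Csum u (S n)) with (Csum u n + u n).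
  rewrite Re_plus, IHn. reflexivity.
Qed.
Lemma Im_Csum u n : Im (Csum u n) = Rsum (fun k => Im (u k)) n.
Proof.
  induction n; [reflexivity|]. change (Csum u (S n)) with (Csum u n + u n).
  rewrite Im_plus, IHn. reflexivity.
Qed.

Lemma Clim_unique u l l' : Clim u l -> Clim u l' -> l = l'.
Proof.
  intros H H'. apply Ceq_minus. apply Cmod_eq_0.
  apply Rle_antisym; [|apply Cmod_ge_0]. apply le_epsilon. intros eps He.
  destruct (H (eps / 2)%R ltac:(lra)) as [N HN]. destruct (H' (eps / 2)%R ltac:(lra)) as [N' HN'].
  specialize (HN (max N N') ltac:(lia)). specialize (HN' (max N N') ltac:(lia)).
  replace (l - l') with ((u (max N N') - l') - (u (max N N') - l)) by ring.
  unfold Cminus at 1. eapply Rle_trans; [apply Cmod_triangle|]. rewrite Cmod_opp. lra.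
Qed.

Lemma Clim_const c : Clim (fun _ => c) c.
Proof. intros eps He. exists 0%nat. intros n _. replace (c - c) with (RtoC 0) by ring. rewrite Cmod_0. exact He. Qed.

Lemma Clim_plus u v a b : Clim u a -> Clim v b -> Clim (fun n => u n + v n) (a + b).
Proof.
  intros H H' eps He.
  destruct (H (eps / 2)%R ltac:(lra)) as [N HN]. destruct (H' (eps / 2)%R ltac:(lra)) as [N' HN'].
  exists (max N N'). intros n Hn. specialize (HN n ltac:(lia)). specialize (HN' n ltac:(lia)).
  replace (u n + v n - (a + b)) with ((u n - a) + (v n - b)) by ring.
  eapply Rle_lt_trans; [apply Cmod_triangle|]. lra.
Qed.

Lemma Clim_scal c u a : Clim u a -> Clim (fun n => c * u n) (c * a).
Proof.
  intros H eps He. pose proof (Cmod_ge_0 c).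
  destruct (H (eps / (1 + Cmod c))%R) as [N HN]; [apply Rdiv_lt_0_compat; lra|].
  exists N. intros n Hn. specialize (HN n Hn). apply Rlt_div_r in HN; [|lra].
  replace (c * u n - c * a) with (c * (u n - a)) by ring. rewrite Cmod_mult.
  pose proof (Cmod_ge_0 (u n - a)). nra.
Qed.

Lemma Clim_ext u v a : (forall n, u n = v n) -> Clim u a -> Clim v a.
Proof. intros E H eps He. destruct (H eps He) as [N HN]. exists N. intros n Hn. rewrite <- E. auto. Qed.

Lemma Clim_shift u a : Clim u a -> Clim (fun n => u (S n)) a.
Proof. intros H eps He. destruct (H eps He) as [N HN]. exists N. intros n Hn. apply HN. lia. Qed.

Lemma Clim_shift_inv u a : Clim (fun n => u (S n)) a -> Clim u a.
Proof.
  intros H eps He. destruct (H eps He) as [N HN]. exists (S N). intros n Hn.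
  destruct n; [lia|]. apply HN. lia.
Qed.

Lemma Clim_bound u a c B : (forall n, (Cmod (u n - c) <= B)%R) -> Clim u a -> (Cmod (a - c) <= B)%R.
Proof.
  intros HB H. apply le_epsilon. intros eps He. destruct (H eps He) as [N HN].
  specialize (HN N ltac:(lia)). specialize (HB N).
  replace (a - c) with ((u N - c) - (u N - a)) by ring. unfold Cminus at 1.
  eapply Rle_trans; [apply Cmod_triangle|]. rewrite Cmod_opp. lra.
Qed.

Lemma is_series_Rsum (u : nat -> R) (l : R) : is_series u l <-> is_lim_seq (Rsum u) l.
Proof.
  split; intros H.
  - apply is_lim_seq_incr_1. apply is_lim_seq_ext with (sum_n u); [|exact H].
    intros n. symmetry. apply Rsum_sum_n.
  - apply is_lim_seq_incr_1 in H. change (is_lim_seq (sum_n u) l).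
    apply is_lim_seq_ext with (u := fun n => Rsum u (S n)); [|exact H].
    intros n. apply Rsum_sum_n.
Qed.

Lemma summable_ex_series u : summable u -> ex_series (fun n => Cmod (u n)).
Proof.
  intros [B HB].
  destruct (ex_finite_lim_seq_incr (Rsum (fun k => Cmod (u k))) B) as [l Hl].
  - intros n. simpl. pose proof (Cmod_ge_0 (u n)). lra.
  - exact HB.
  - exists l. apply is_series_Rsum. exact Hl.
Qed.

Lemma CSeries_lim u : summable u -> Clim (Csum u) (CSeries u).
Proof.
  intros H. apply summable_ex_series in H.
  assert (H1 : ex_series (fun n => Re (u n))).
  { apply (ex_series_le (K := R_AbsRing) (V := R_CompleteNormedModule)) with (b := fun n => Cmod (u n)); [|exact H].
    intros n. apply re_le_Cmod. }
  assert (H2 : ex_series (fun n => Im (u n))).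
  { apply (ex_series_le (K := R_AbsRing) (V := R_CompleteNormedModule)) with (b := fun n => Cmod (u n)); [|exact H].
    intros n. apply im_le_Cmod. }
  apply Series_correct, is_series_Rsum, is_lim_seq_spec in H1.
  apply Series_correct, is_series_Rsum, is_lim_seq_spec in H2.
  intros eps He.
  assert (He' : (0 < eps / 2)%R) by lra.
  destruct (H1 (mkposreal _ He')) as [N1 HN1]. destruct (H2 (mkposreal _ He')) as [N2 HN2].
  simpl in HN1, HN2. exists (max N1 N2). intros n Hn.
  specialize (HN1 n ltac:(lia)). specialize (HN2 n ltac:(lia)).
  eapply Rle_lt_trans; [apply Cmod_2Rmax|].
  change (fst (Csum u n - CSeries u)) with (Re (Csum u n - CSeries u)).
  change (snd (Csum u n - CSeries u)) with (Im (Csum u n - CSeries u)).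
  rewrite Re_minus, Im_minus, Re_Csum, Im_Csum.
  assert (sqrt 2 < 2)%R.
  { rewrite <- (sqrt_Rsqr 2) at 2 by lra. apply sqrt_lt_1; unfold Rsqr; lra. }
  pose proof (sqrt_pos 2).
  match goal with |- (_ * ?m < _)%R => assert (m < eps / 2)%R end.
  { apply Rmax_lub_lt; assumption. }
  match goal with |- (_ * ?m < _)%R => assert (0 <= m)%R end.
  { eapply Rle_trans; [apply Rabs_pos|apply Rmax_l]. }
  nra.
Qed.

Lemma CSeries_unique u l : Clim (Csum u) l -> CSeries u = l.
Proof.
  intros H. unfold CSeries. destruct l as [a b]. f_equal.
  - apply is_series_unique, is_series_Rsum, is_lim_seq_spec. intros eps.
    destruct (H eps (cond_pos eps)) as [N HN]. exists N. intros n Hn.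
    eapply Rle_lt_trans; [|apply (HN n Hn)].
    rewrite <- Re_Csum. change a with (Re (a, b)). rewrite <- Re_minus. apply re_le_Cmod.
  - apply is_series_unique, is_series_Rsum, is_lim_seq_spec. intros eps.
    destruct (H eps (cond_pos eps)) as [N HN]. exists N. intros n Hn.
    eapply Rle_lt_trans; [|apply (HN n Hn)].
    rewrite <- Im_Csum. change b with (Im (a, b)). rewrite <- Im_minus. apply im_le_Cmod.
Qed.

Lemma CSeries_ext u v : (forall n, u n = v n) -> CSeries u = CSeries v.
Proof. intros E. unfold CSeries. f_equal; apply Series_ext; intros n; rewrite E; reflexivity. Qed.

(** * Power series on the unit disc *)

Definition PS (c : nat -> C) (w : C) : C := CSeries (fun n => c n * w ^ n).

(** Radius of convergence at least 1, in the form of Abel's lemma. Boundedness of the terms is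
    visibly stable under sums, index shifts and multiplication by [n]. *)
Definition unit_radius (c : nat -> C) : Prop :=
  forall r : R, (0 < r < 1)%R -> exists M : R, forall n, (Cmod (c n) * r ^ n <= M)%R.

Lemma Rsum_geom_le (x : R) n : (0 <= x < 1)%R -> (Rsum (fun k => x ^ k) n <= / (1 - x))%R.
Proof.
  intros Hx. assert (E : ((1 - x) * Rsum (fun k => x ^ k) n = 1 - x ^ n)%R).
  { induction n; simpl; [ring|]. rewrite Rmult_plus_distr_l, IHn. ring. }
  apply Rmult_le_reg_l with (1 - x)%R; [lra|]. rewrite E, Rinv_r by lra.
  pose proof (pow_le x n ltac:(lra)). lra.
Qed.

Lemma pow_le_antitone (x : R) (k n : nat) : (0 <= x <= 1)%R -> (k <= n)%nat -> (x ^ n <= x ^ k)%R.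
Proof.
  intros Hx H. induction H as [|n _ IH]; [lra|].
  simpl. pose proof (pow_le x n ltac:(lra)). nra.
Qed.

(** Each of the [n] terms [1, x, ..., x^(n-1)] of the geometric sum is at least [x^n]. *)
Lemma INR_pow_bounded (x : R) n : (0 <= x < 1)%R -> (INR n * x ^ n <= / (1 - x))%R.
Proof.
  intros Hx. eapply Rle_trans; [|apply (Rsum_geom_le x n Hx)].
  assert (H : forall m, (m <= n)%nat -> (INR m * x ^ n <= Rsum (fun k => x ^ k) m)%R).
  { induction m; intros Hm; [simpl; lra|]. rewrite S_INR. simpl.
    specialize (IHm ltac:(lia)). pose proof (pow_le_antitone x m n ltac:(lra) ltac:(lia)). lra. }
  apply H. lia.
Qed.

Lemma unit_radius_ext c c' : (forall n, c n = c' n) -> unit_radius c -> unit_radius c'.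
Proof. intros E H r Hr. destruct (H r Hr) as [M HM]. exists M. intros n. rewrite <- E. apply HM. Qed.

Lemma unit_radius_plus c c' : unit_radius c -> unit_radius c' -> unit_radius (fun n => c n + c' n).
Proof.
  intros H H' r Hr. destruct (H r Hr) as [M HM]. destruct (H' r Hr) as [M' HM'].
  exists (M + M')%R. intros n. specialize (HM n). specialize (HM' n).
  pose proof (Cmod_triangle (c n) (c' n)). pose proof (pow_lt r n ltac:(lra)). nra.
Qed.

Lemma unit_radius_scal a c : unit_radius c -> unit_radius (fun n => a * c n).
Proof.
  intros H r Hr. destruct (H r Hr) as [M HM]. exists (Cmod a * M)%R. intros n.
  rewrite Cmod_mult, Rmult_assoc. apply Rmult_le_compat_l; [apply Cmod_ge_0|apply HM].
Qed.

Lemma unit_radius_INR c : unit_radius c -> unit_radius (fun n => INR n * c n).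
Proof.
  (* The bound is taken at a larger radius [r']; the geometric factor [(r / r')^n] gained in this
     way absorbs the factor [n]. *)
  intros H r Hr. set (r' := ((1 + r) / 2)%R). assert (Hr' : (0 < r' < 1)%R) by (unfold r'; lra).
  destruct (H r' Hr') as [M HM]. exists (M * / (1 - r / r'))%R. intros n.
  assert (Hq : (0 <= r / r' < 1)%R).
  { split; [apply Rlt_le, Rdiv_lt_0_compat; lra|]. apply Rlt_div_l; unfold r'; lra. }
  rewrite Cmod_mult, Cmod_R, Rabs_pos_eq by apply pos_INR.
  replace r with (r' * (r / r'))%R at 1 by (field; lra).
  rewrite Rpow_mult_distr.
  replace (INR n * Cmod (c n) * (r' ^ n * (r / r') ^ n))%R
    with ((Cmod (c n) * r' ^ n) * (INR n * (r / r') ^ n))%R by ring.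
  pose proof (INR_pow_bounded (r / r') n Hq). specialize (HM n).
  pose proof (pow_le (r / r') n ltac:(lra)). pose proof (pos_INR n).
  pose proof (Cmod_ge_0 (c n)). pose proof (pow_le r' n ltac:(lra)).
  apply Rmult_le_compat; try assumption; nra.
Qed.

Lemma unit_radius_S c : unit_radius c -> unit_radius (fun n => c (S n)).
Proof.
  intros H r Hr. destruct (H r Hr) as [M HM]. exists (M / r)%R. intros n.
  specialize (HM (S n)). simpl in HM. apply Rmult_le_reg_r with r; [lra|].
  unfold Rdiv. rewrite !Rmult_assoc, Rinv_l, Rmult_1_r by lra. lra.
Qed.

Definition shift (c : nat -> C) (n : nat) : C := match n with O => 0 | S m => c m end.

Lemma unit_radius_ratio (c : nat -> C) :
  (forall r : R, (0 < r < 1)%R -> exists N : nat, forall n, (N <= n)%nat ->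
     (Cmod (c (S n)) * r <= Cmod (c n))%R) -> unit_radius c.
Proof.
  intros H r Hr. destruct (H r Hr) as [N HN].
  assert (HB : exists M, forall n, (n <= N)%nat -> (Cmod (c n) * r ^ n <= M)%R).
  { clear HN. induction N as [|N [M HM]].
    - exists (Cmod (c 0%nat) * r ^ 0)%R. intros n Hn. replace n with 0%nat by lia. lra.
    - exists (Rmax M (Cmod (c (S N)) * r ^ S N)). intros n Hn.
      destruct (Nat.eq_dec n (S N)) as [->|]; [apply Rmax_r|].
      eapply Rle_trans; [apply HM; lia|apply Rmax_l]. }
  destruct HB as [M HM]. exists M. intros n. destruct (Nat.le_ge_cases n N) as [Hn|Hn]; [auto|].
  induction Hn as [|n Hn IH]; [apply HM; lia|].
  eapply Rle_trans; [|exact IH]. specialize (HN n Hn). simpl.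
  pose proof (pow_lt r n ltac:(lra)). nra.
Qed.

Lemma summable_PS c w : unit_radius c -> (Cmod w < 1)%R -> summable (fun n => c n * w ^ n).
Proof.
  intros H Hw. pose proof (Cmod_ge_0 w).
  set (r := ((1 + Cmod w) / 2)%R). assert (Hr : (0 < r < 1)%R) by (unfold r; lra).
  destruct (H r Hr) as [M HM]. exists (M * / (1 - Cmod w / r))%R. intros n.
  assert (Hq : (0 <= Cmod w / r < 1)%R).
  { split; [apply Rdiv_le_0_compat; lra|]. apply Rlt_div_l; unfold r; lra. }
  eapply Rle_trans with (M * Rsum (fun k => (Cmod w / r) ^ k) n)%R.
  - rewrite <- Rsum_scal. apply Rsum_le. intros k. rewrite Cmod_mult, Cmod_pow.
    replace (Cmod w) with (r * (Cmod w / r))%R at 1 by (field; lra).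
    rewrite Rpow_mult_distr, <- Rmult_assoc.
    apply Rmult_le_compat_r; [apply pow_le; lra|apply HM].
  - apply Rmult_le_compat_l; [|apply Rsum_geom_le; exact Hq].
    eapply Rle_trans; [|apply (HM 0%nat)]. simpl. rewrite Rmult_1_r. apply Cmod_ge_0.
Qed.

Lemma PS_lim c w : unit_radius c -> (Cmod w < 1)%R -> Clim (Csum (fun n => c n * w ^ n)) (PS c w).
Proof. intros H Hw. apply CSeries_lim, summable_PS; assumption. Qed.

Lemma PS_ext c c' w : (forall n, c n = c' n) -> PS c w = PS c' w.
Proof. intros E. apply CSeries_ext. intros n. rewrite E. reflexivity. Qed.

Lemma PS_plus c c' w : unit_radius c -> unit_radius c' -> (Cmod w < 1)%R ->
  PS (fun n => c n + c' n) w = PS c w + PS c' w.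
Proof.
  intros H H' Hw. apply CSeries_unique.
  apply Clim_ext with (fun n => Csum (fun n => c n * w ^ n) n + Csum (fun n => c' n * w ^ n) n).
  - intros n. rewrite <- Csum_plus. apply Csum_ext. intros k _. ring.
  - apply Clim_plus; apply PS_lim; assumption.
Qed.

Lemma PS_scal a c w : unit_radius c -> (Cmod w < 1)%R ->
  PS (fun n => a * c n) w = a * PS c w.
Proof.
  intros H Hw. apply CSeries_unique.
  apply Clim_ext with (fun n => a * Csum (fun n => c n * w ^ n) n).
  - intros n. rewrite <- Csum_scal. apply Csum_ext. intros k _. ring.
  - apply Clim_scal; apply PS_lim; assumption.
Qed.

Lemma PS_shift c w : unit_radius c -> (Cmod w < 1)%R -> PS (shift c) w = w * PS c w.
Proof.
  intros H Hw. apply CSeries_unique. apply Clim_shift_inv.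
  apply Clim_ext with (fun n => w * Csum (fun n => c n * w ^ n) n).
  - intros n. rewrite Csum_shift, <- Csum_scal. simpl (shift c 0).
    rewrite Cmult_0_l, Cplus_0_l. apply Csum_ext. intros k _. simpl. ring.
  - apply Clim_scal; apply PS_lim; assumption.
Qed.

Lemma PS_at_0 c : PS c 0 = c 0%nat.
Proof.
  apply CSeries_unique. apply Clim_shift_inv. apply Clim_ext with (fun _ => c 0%nat); [|apply Clim_const].
  intros n. rewrite Csum_shift.
  assert (E : forall n, Csum (fun k => c (S k) * 0 ^ S k) n = 0).
  { intros m. induction m; [reflexivity|]. cbn [Csum]. rewrite IHm. simpl. ring. }
  rewrite E. simpl. ring.
Qed.

(** The natural bound has [r^(n-2)]; the factor [r * r] on the left avoids the subtraction. The
    induction rests on [e (n+1) = y * e n + n w^(n-1) (y - w)^2] for the remainders [e]. *)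
Lemma pow_taylor_bound (y w : C) (r : R) n : (0 < r)%R -> (Cmod y <= r)%R -> (Cmod w <= r)%R ->
  (Cmod (y ^ n - w ^ n - INR n * w ^ pred n * (y - w)) * (r * r)
     <= INR n * INR n * r ^ n * (Cmod (y - w) * Cmod (y - w)))%R.
Proof.
  intros Hr Hy Hw. set (h := (Cmod (y - w) * Cmod (y - w))%R).
  assert (Hh : (0 <= h)%R) by (pose proof (Cmod_ge_0 (y - w)); unfold h; nra).
  induction n as [|n IH].
  - simpl. replace (1 - 1 - 0 * 1 * (y - w)) with (RtoC 0) by ring. rewrite Cmod_0. lra.
  - set (e := y ^ n - w ^ n - INR n * w ^ pred n * (y - w)) in *.
    replace (y ^ S n - w ^ S n - INR (S n) * w ^ pred (S n) * (y - w))
      with (y * e + INR n * w ^ pred n * ((y - w) * (y - w))).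
    2:{ unfold e. rewrite S_INR, RtoC_plus. destruct n; simpl; ring. }
    assert (T : (Cmod (y * e + INR n * w ^ pred n * ((y - w) * (y - w))) <= r * Cmod e + INR n * r ^ pred n * h)%R).
    { eapply Rle_trans; [apply Cmod_triangle|]. rewrite !Cmod_mult, Cmod_R, Cmod_pow, (Rabs_pos_eq (INR n)) by apply pos_INR.
      fold h. apply Rplus_le_compat.
      - apply Rmult_le_compat_r; [apply Cmod_ge_0|exact Hy].
      - apply Rmult_le_compat_r; [exact Hh|]. apply Rmult_le_compat_l; [apply pos_INR|].
        apply pow_incr. split; [apply Cmod_ge_0|exact Hw]. }
    assert (E : (INR n * r ^ pred n * (r * r) = INR n * r ^ S n)%R).
    { destruct n; simpl; ring. }
    rewrite S_INR. simpl (r ^ S n)%R in *.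
    pose proof (pow_lt r n Hr). pose proof (pos_INR n).
    assert (0 < r * r)%R by nra.
    apply Rle_trans with ((r * Cmod e + INR n * r ^ pred n * h) * (r * r))%R; [nra|].
    replace ((r * Cmod e + INR n * r ^ pred n * h) * (r * r))%R with
      (r * (Cmod e * (r * r)) + h * (INR n * r ^ pred n * (r * r)))%R by ring.
    rewrite E.
    apply Rle_trans with (r * (INR n * INR n * r ^ n * h) + h * (INR n * (r * r ^ n)))%R; [nra|].
    assert (0 <= h * (r * r ^ n))%R by (apply Rmult_le_pos; nra).
    nra.
Qed.

Definition dcoef (c : nat -> C) (n : nat) : C := INR (S n) * c (S n).

Lemma unit_radius_dcoef c : unit_radius c -> unit_radius (dcoef c).
Proof. intros H. apply (unit_radius_S (fun n => INR n * c n)), unit_radius_INR, H. Qed.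

(** The Taylor remainders of the monomials add up to at most [Cmod (y - w)^2 / r^2] times the sum of
    [n^2 |c n| r^n], which is finite for [r] between [Cmod w] and 1. *)
Lemma Cder_PS c w : unit_radius c -> (Cmod w < 1)%R -> Cder (PS c) w (PS (dcoef c) w).
Proof.
  intros H Hw. pose proof (Cmod_ge_0 w).
  set (r := ((1 + Cmod w) / 2)%R). assert (Hr : (0 < r < 1)%R) by (unfold r; lra).
  assert (Hrw : (Cmod w < r)%R) by (unfold r; lra).
  assert (Hs : summable (fun n => INR n * (INR n * c n) * RtoC r ^ n)).
  { apply summable_PS; [apply unit_radius_INR, unit_radius_INR, H|]. rewrite Cmod_R, Rabs_pos_eq; lra. }
  destruct Hs as [B HB].
  assert (HB0 : (0 <= B)%R) by (apply (HB 0%nat)).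
  apply Cder_eps. intros eps He.
  exists (Rmin (r - Cmod w) (eps * (r * r) / (B + 1))). split.
  { apply Rmin_pos; [lra|]. apply Rdiv_lt_0_compat; [|lra]. apply Rmult_lt_0_compat; nra. }
  intros y Hy.
  assert (Hy1 : (Cmod (y - w) < r - Cmod w)%R) by (eapply Rlt_le_trans; [exact Hy|apply Rmin_l]).
  assert (Hy2 : (Cmod (y - w) < eps * (r * r) / (B + 1))%R) by (eapply Rlt_le_trans; [exact Hy|apply Rmin_r]).
  apply Rlt_div_r in Hy2; [|lra].
  assert (Hyr : (Cmod y < r)%R) by (pose proof (Cmod_triangle_rev y w); lra).
  set (h := Cmod (y - w)) in *. assert (Hh : (0 <= h)%R) by apply Cmod_ge_0.
  assert (L : Clim (Csum (fun n => c n * (y ^ n - w ^ n - INR n * w ^ pred n * (y - w))))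
                (PS c y + (-(1)) * PS c w + (-(1)) * (PS (dcoef c) w * (y - w)))).
  { apply Clim_ext with (fun n => Csum (fun n => c n * y ^ n) n + (-(1)) * Csum (fun n => c n * w ^ n) n
       + (- (y - w)) * Csum (fun n => INR n * c n * w ^ pred n) n).
    - intros n. rewrite <- !Csum_scal, <- !Csum_plus. apply Csum_ext. intros k _. ring.
    - replace (-(1) * (PS (dcoef c) w * (y - w))) with ((-(y - w)) * PS (dcoef c) w) by ring.
      apply Clim_plus; [apply Clim_plus; [|apply Clim_scal]; apply PS_lim; try assumption; lra|].
      apply Clim_scal. apply Clim_shift_inv.
      apply Clim_ext with (Csum (fun n => dcoef c n * w ^ n)); [|apply PS_lim; [apply unit_radius_dcoef; exact H|exact Hw]].
      intros n. rewrite Csum_shift. simpl (INR 0). rewrite !Cmult_0_l, Cplus_0_l. reflexivity. }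
  apply Clim_bound with (c := RtoC 0) (B := (B * (h * h) / (r * r))%R) in L.
  - replace (PS c y - PS c w - PS (dcoef c) w * (y - w)) with
      (PS c y + (-(1)) * PS c w + (-(1)) * (PS (dcoef c) w * (y - w)) - 0) by ring.
    eapply Rle_trans; [exact L|].
    apply Rmult_le_reg_r with (r * r)%R; [nra|].
    replace (B * (h * h) / (r * r) * (r * r))%R with (B * (h * h))%R by (field; lra).
    assert (B * h <= eps * (r * r))%R by nra. nra.
  - intros n. replace (Csum (fun n => c n * (y ^ n - w ^ n - INR n * w ^ pred n * (y - w))) n - 0)
      with (Csum (fun n => c n * (y ^ n - w ^ n - INR n * w ^ pred n * (y - w))) n) by ring.
    eapply Rle_trans; [apply Cmod_Csum|].
    apply Rle_trans with (h * h / (r * r) * B)%R; [|apply Req_le; field; lra].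
    eapply Rle_trans; [|apply Rmult_le_compat_l; [|apply (HB n)]].
    2:{ apply Rdiv_le_0_compat; nra. }
    rewrite <- Rsum_scal. apply Rsum_le. intros k.
    rewrite !Cmod_mult, Cmod_pow, !Cmod_R, (Rabs_pos_eq (INR k)), (Rabs_pos_eq r) by (lra || apply pos_INR).
    pose proof (pow_taylor_bound y w r k ltac:(lra) ltac:(lra) ltac:(lra)) as T. fold h in T.
    apply Rmult_le_reg_r with (r * r)%R; [nra|].
    replace (h * h / (r * r) * (INR k * (INR k * Cmod (c k)) * r ^ k) * (r * r))%R with
       (Cmod (c k) * (INR k * INR k * r ^ k * (h * h)))%R by (field; lra).
    rewrite Rmult_assoc. apply Rmult_le_compat_l; [apply Cmod_ge_0|exact T].
Qed.

Lemma unit_radius_INR_plus a c : unit_radius c -> unit_radius (fun n => (INR n + a) * c n).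
Proof.
  intros H. apply unit_radius_ext with (fun n => INR n * c n + a * c n); [intros; ring|].
  apply unit_radius_plus; [apply unit_radius_INR|apply unit_radius_scal]; exact H.
Qed.

Lemma PS_theta c w : unit_radius c -> (Cmod w < 1)%R ->
  w * PS (dcoef c) w = PS (fun n => INR n * c n) w.
Proof.
  intros H Hw. rewrite <- PS_shift; [|apply unit_radius_dcoef; exact H|exact Hw].
  apply PS_ext. intros [|n]; simpl shift; [simpl; ring|reflexivity].
Qed.

(** * The local inverse *)

(** Newton's iteration for [phi x = y] with the slope frozen at [m], the derivative of [phi] at
    [x0]. *)
Fixpoint newton (phi : C -> C) (m x0 y : C) (n : nat) : C :=
  match n with
  | O => x0
  | S k => newton phi m x0 y k - (phi (newton phi m x0 y k) - y) / m
  end.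

Definition newton_limit (phi : C -> C) (m x0 y : C) : C :=
  x0 + CSeries (fun n => newton phi m x0 y (S n) - newton phi m x0 y n).

Section NewtonLimit.

Context (phi : C -> C) (m x0 : C) (r : R) (Hr : (0 < r)%R) (Hm : m <> 0).
Context (contraction : forall x y, (Cmod (x - x0) < r)%R -> (Cmod (y - x0) < r)%R ->
  (Cmod (phi x - phi y - m * (x - y)) <= Cmod m / 2 * Cmod (x - y))%R).

Lemma Cmod_m_pos : (0 < Cmod m)%R.
Proof. apply Cmod_gt_0. exact Hm. Qed.

Lemma newton_step (x x' y : C) : (Cmod (x - x0) < r)%R -> (Cmod (x' - x0) < r)%R ->
  (Cmod (x - (phi x - y) / m - (x' - (phi x' - y) / m)) <= / 2 * Cmod (x - x'))%R.
Proof.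
  intros Hx Hx'. pose proof Cmod_m_pos.
  replace (x - (phi x - y) / m - (x' - (phi x' - y) / m))
    with (- (phi x - phi x' - m * (x - x')) / m) by (field; exact Hm).
  rewrite Cmod_div, Cmod_opp by exact Hm.
  apply Rmult_le_reg_r with (Cmod m); [lra|].
  unfold Rdiv. rewrite Rmult_assoc, Rinv_l, Rmult_1_r by lra.
  pose proof (contraction x x' Hx Hx'). lra.
Qed.

(** The two bounds need each other: steps halve only inside the ball, and the iterates stay inside
    because the steps form a geometric series with sum at most
    [2 * Cmod (y - phi x0) / Cmod m < r]. *)
Lemma newton_bound (y : C) n : (Cmod (y - phi x0) < Cmod m * r / 2)%R ->
  (Cmod (newton phi m x0 y (S n) - newton phi m x0 y n) <= (/ 2) ^ n * (Cmod (y - phi x0) / Cmod m) /\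
   Cmod (newton phi m x0 y n - x0) <= 2 * (1 - (/ 2) ^ n) * (Cmod (y - phi x0) / Cmod m))%R.
Proof.
  intros Hy. pose proof Cmod_m_pos.
  set (s := (Cmod (y - phi x0) / Cmod m)%R).
  assert (Hs0 : (0 <= s)%R) by (apply Rdiv_le_0_compat; [apply Cmod_ge_0|lra]).
  assert (Hs : (2 * s < r)%R).
  { unfold s. apply Rmult_lt_reg_r with (Cmod m); [lra|].
    replace (2 * (Cmod (y - phi x0) / Cmod m) * Cmod m)%R with (2 * Cmod (y - phi x0))%R by (field; lra). lra. }
  assert (Q : forall k, (0 < (/ 2) ^ k <= 1)%R).
  { intros k. split; [apply pow_lt; lra|]. change ((/ 2) ^ k <= (/ 2) ^ 0)%R. apply pow_le_antitone; [lra|lia]. }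
  induction n as [|n [IH1 IH2]].
  - split.
    + cbn [newton pow]. replace (x0 - (phi x0 - y) / m - x0) with ((y - phi x0) / m) by (field; exact Hm).
      rewrite Cmod_div by exact Hm. unfold s. lra.
    + cbn [newton pow]. replace (x0 - x0) with (RtoC 0) by ring. rewrite Cmod_0. lra.
  - assert (B : (Cmod (newton phi m x0 y (S n) - x0) <= 2 * (1 - (/ 2) ^ S n) * s)%R).
    { replace (newton phi m x0 y (S n) - x0) with
        ((newton phi m x0 y (S n) - newton phi m x0 y n) + (newton phi m x0 y n - x0)) by ring.
      eapply Rle_trans; [apply Cmod_triangle|]. cbn [pow]. lra. }
    split; [|exact B].
    pose proof (Q n). pose proof (Q (S n)).
    eapply Rle_trans; [apply (newton_step (newton phi m x0 y (S n)) (newton phi m x0 y n))|].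
    + eapply Rle_lt_trans; [exact B|]. nra.
    + eapply Rle_lt_trans; [exact IH2|]. nra.
    + cbn [pow]. lra.
Qed.

Lemma newton_limit_lim (y : C) : (Cmod (y - phi x0) < Cmod m * r / 2)%R ->
  Clim (newton phi m x0 y) (newton_limit phi m x0 y).
Proof.
  intros Hy. unfold newton_limit.
  apply Clim_ext with (fun n => x0 + Csum (fun n => newton phi m x0 y (S n) - newton phi m x0 y n) n).
  - intros n. induction n; [cbn [Csum newton]; ring|]. cbn [Csum]. rewrite Cplus_assoc, IHn. ring.
  - apply Clim_plus; [apply Clim_const|]. apply CSeries_lim.
    exists (2 * (Cmod (y - phi x0) / Cmod m))%R. intros n.
    pose proof Cmod_m_pos.
    assert (0 <= Cmod (y - phi x0) / Cmod m)%R by (apply Rdiv_le_0_compat; [apply Cmod_ge_0|lra]).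
    eapply Rle_trans.
    { apply Rsum_le. intros k. apply (newton_bound y k Hy). }
    apply Rle_trans with (Rsum (fun k => Cmod (y - phi x0) / Cmod m * (/ 2) ^ k)%R n).
    { apply Rsum_le. intros k. lra. }
    rewrite Rsum_scal, Rmult_comm. apply Rmult_le_compat_r; [lra|].
    eapply Rle_trans; [apply Rsum_geom_le; lra|]. lra.
Qed.

Lemma newton_limit_ball (y : C) : (Cmod (y - phi x0) < Cmod m * r / 2)%R ->
  (Cmod (newton_limit phi m x0 y - x0) < r)%R.
Proof.
  intros Hy. pose proof Cmod_m_pos.
  assert (0 <= Cmod (y - phi x0) / Cmod m)%R by (apply Rdiv_le_0_compat; [apply Cmod_ge_0|lra]).
  apply Rle_lt_trans with (2 * (Cmod (y - phi x0) / Cmod m))%R.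
  - apply Clim_bound with (newton phi m x0 y); [|apply newton_limit_lim; exact Hy].
    intros n. eapply Rle_trans; [apply (newton_bound y n Hy)|].
    pose proof (pow_lt (/ 2) n ltac:(lra)). nra.
  - apply Rmult_lt_reg_r with (Cmod m); [lra|].
    replace (2 * (Cmod (y - phi x0) / Cmod m) * Cmod m)%R with (2 * Cmod (y - phi x0))%R by (field; lra). lra.
Qed.

Lemma newton_limit_fix (y : C) : (Cmod (y - phi x0) < Cmod m * r / 2)%R ->
  phi (newton_limit phi m x0 y) = y.
Proof.
  intros Hy. set (x := newton_limit phi m x0 y).
  assert (Hx : (Cmod (x - x0) < r)%R) by (apply newton_limit_ball; exact Hy).
  (* The shifted iterates converge to [x] and, by the contraction [newton_step], also to the image
     of [x] under one step. The index [N2] puts the iterates inside the ball. *)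
  assert (E : x = x - (phi x - y) / m).
  { apply Clim_unique with (newton phi m x0 y); [apply newton_limit_lim; exact Hy|].
    apply Clim_shift_inv. intros eps He.
    destruct (newton_limit_lim y Hy eps He) as [N1 HN1].
    destruct (newton_limit_lim y Hy (r - Cmod (x - x0))%R ltac:(lra)) as [N2 HN2].
    exists (max N1 N2). intros n Hn. specialize (HN1 n ltac:(lia)). specialize (HN2 n ltac:(lia)).
    fold x in HN1, HN2. cbn [newton].
    eapply Rle_lt_trans; [apply newton_step|].
    - pose proof (Cmod_triangle (newton phi m x0 y n - x) (x - x0)) as T.
      replace (newton phi m x0 y n - x + (x - x0)) with (newton phi m x0 y n - x0) in T by ring. lra.
    - exact Hx.
    - pose proof (Cmod_ge_0 (newton phi m x0 y n - x)). lra. }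
  assert (E' : (phi x - y) / m = 0).
  { replace ((phi x - y) / m) with (x - (x - (phi x - y) / m)) by ring. rewrite <- E. ring. }
  apply Ceq_minus. replace (phi x - y) with ((phi x - y) / m * m) by (field; exact Hm).
  rewrite E'. ring.
Qed.

(** [phi] differs from multiplication by [m] by at most half of it. This yields injectivity on the
    ball and a Lipschitz bound for the inverse. *)
Lemma expanding (x y : C) : (Cmod (x - x0) < r)%R -> (Cmod (y - x0) < r)%R ->
  (Cmod m / 2 * Cmod (x - y) <= Cmod (phi x - phi y))%R.
Proof.
  intros Hx Hy. pose proof (contraction x y Hx Hy) as H.
  pose proof (Cmod_triangle (- (phi x - phi y - m * (x - y))) (phi x - phi y)) as T.
  replace (- (phi x - phi y - m * (x - y)) + (phi x - phi y)) with (m * (x - y)) in T by ring.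
  rewrite Cmod_opp, Cmod_mult in T. lra.
Qed.

Lemma newton_limit_left_inverse (x : C) : (Cmod (x - x0) < r)%R ->
  (Cmod (phi x - phi x0) < Cmod m * r / 2)%R -> newton_limit phi m x0 (phi x) = x.
Proof.
  intros Hx Hy. pose proof Cmod_m_pos.
  pose proof (expanding _ _ (newton_limit_ball _ Hy) Hx) as H'.
  rewrite newton_limit_fix in H' by exact Hy.
  replace (phi x - phi x) with (RtoC 0) in H' by ring. rewrite Cmod_0 in H'.
  apply Ceq_minus, Cmod_eq_0.
  pose proof (Cmod_ge_0 (newton_limit phi m x0 (phi x) - x)). nra.
Qed.

Lemma Cder_newton_limit (y l : C) : (Cmod (y - phi x0) < Cmod m * r / 2)%R ->
  l <> 0 -> Cder phi (newton_limit phi m x0 y) l -> Cder (newton_limit phi m x0) y (/ l).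
Proof.
  intros Hy Hl HD. pose proof Cmod_m_pos. apply Cder_eps. intros eps He.
  set (psi := newton_limit phi m x0) in *.
  assert (Hl' : (0 < Cmod l)%R) by (apply Cmod_gt_0; exact Hl).
  (* [Cmod l] pays for the division by [l], and [Cmod m / 2] for the Lipschitz constant [2 / Cmod m]
     of the inverse. *)
  apply Cder_eps with (eps := (eps * Cmod l * (Cmod m / 2))%R) in HD.
  2:{ repeat apply Rmult_lt_0_compat; lra. }
  destruct HD as [d [Hd H']].
  apply near_imp with (P := fun y' => (Cmod (y' - phi x0) < Cmod m * r / 2)%R /\ (Cmod (y' - y) < d * (Cmod m / 2))%R).
  2:{ apply near_and; [apply near_ball; exact Hy|]. apply near_ball.
      replace (y - y) with (RtoC 0) by ring. rewrite Cmod_0. apply Rmult_lt_0_compat; lra. }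
  intros y' [Hy' Hy'd].
  pose proof (expanding (psi y') (psi y) (newton_limit_ball _ Hy') (newton_limit_ball _ Hy)) as B.
  unfold psi in B at 3 4. rewrite !newton_limit_fix in B by assumption.
  specialize (H' (psi y') ltac:(nra)). unfold psi in H' at 1 2. rewrite !newton_limit_fix in H' by assumption.
  replace (psi y' - psi y - / l * (y' - y)) with (- (y' - y - l * (psi y' - psi y)) / l) by (field; exact Hl).
  rewrite Cmod_div, Cmod_opp by exact Hl.
  apply Rmult_le_reg_r with (Cmod l); [lra|]. unfold Rdiv at 1.
  rewrite Rmult_assoc, Rinv_l, Rmult_1_r by lra.
  eapply Rle_trans; [exact H'|].
  assert (0 < eps * Cmod l)%R by nra. nra.
Qed.

End NewtonLimit.

Lemma local_inverse (phi phi' : C -> C) (x0 : C) (r0 : R) : (0 < r0)%R ->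
  (forall x, (Cmod (x - x0) < r0)%R -> Cder phi x (phi' x)) ->
  Ccont phi' x0 -> phi' x0 <> 0 ->
  exists (r rho : R) (psi : C -> C), (0 < r <= r0)%R /\ (0 < rho)%R /\
    (forall y, (Cmod (y - phi x0) < rho)%R ->
       (Cmod (psi y - x0) < r)%R /\ phi (psi y) = y /\ Cder psi y (/ phi' (psi y))) /\
    (forall x, (Cmod (x - x0) < r)%R -> (Cmod (phi x - phi x0) < rho)%R -> psi (phi x) = x) /\
    (forall x, (Cmod (x - x0) < r)%R -> phi' x <> 0).
Proof.
  intros Hr0 HD Hc H0. set (m := phi' x0) in *.
  assert (Hm : (0 < Cmod m)%R) by (apply Cmod_gt_0; exact H0).
  destruct (Hc (Cmod m / 2)%R ltac:(lra)) as [d [Hd Hb]]. fold m in Hb.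
  set (r := Rmin r0 d).
  assert (Hr : (0 < r <= r0)%R) by (split; [apply Rmin_pos; lra|apply Rmin_l]).
  assert (Hrd : (r <= d)%R) by apply Rmin_r.
  assert (Hcon : forall x y, (Cmod (x - x0) < r)%R -> (Cmod (y - x0) < r)%R ->
    (Cmod (phi x - phi y - m * (x - y)) <= Cmod m / 2 * Cmod (x - y))%R).
  { intros x y Hx Hy.
    replace (phi x - phi y - m * (x - y)) with ((phi x - m * x) - (phi y - m * y)) by ring.
    (* On the ball [phi'] stays within [Cmod m / 2] of [m], so the mean value inequality for
       [phi z - m * z] is the contraction hypothesis. *)
    apply (mean_value_ineq (fun z => phi z - m * z) (fun z => phi' z - m)).
    - intros t Ht. apply Cder_eq with (phi' (y + t * (x - y)) - m * 1); [|ring].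
      apply (Cder_minus phi (fun z => m * z)); [|apply Cder_scal, Cder_id]. apply HD.
      eapply Rlt_le_trans; [apply ball_segment; eassumption|lra].
    - intros t Ht. apply Rlt_le, Hb. eapply Rlt_le_trans; [apply ball_segment; eassumption|lra]. }
  assert (Hnz : forall x, (Cmod (x - x0) < r)%R -> phi' x <> 0).
  { intros x Hx E. specialize (Hb x ltac:(lra)). rewrite E in Hb.
    replace (0 - m) with (- m) in Hb by ring. rewrite Cmod_opp in Hb. lra. }
  exists r, (Cmod m * r / 2)%R, (newton_limit phi m x0).
  split; [exact Hr|]. split; [assert (0 < Cmod m * r)%R by nra; lra|].
  split; [|split; [|exact Hnz]].
  - intros y Hy.
    assert (Hb' : (Cmod (newton_limit phi m x0 y - x0) < r)%R)
      by (apply newton_limit_ball; first [assumption|lra]).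
    split; [exact Hb'|]. split; [apply (newton_limit_fix phi m x0 r); first [assumption|lra]|].
    apply (Cder_newton_limit phi m x0 r); try first [assumption|lra]; [apply Hnz; exact Hb'|].
    apply HD. lra.
  - intros x Hx Hy. apply (newton_limit_left_inverse phi m x0 r); first [assumption|lra].
Qed.

(** * Convolutions of divisor sums *)

Definition natC (n : nat) : C := RtoC (INR n).

Definition indicator (b : bool) (c : C) : C := if b then c else 0.

Lemma natC_S n : natC (S n) = natC n + 1.
Proof. unfold natC. rewrite S_INR, RtoC_plus. reflexivity. Qed.

Lemma natC_plus a b : natC (a + b) = natC a + natC b.
Proof. unfold natC. rewrite plus_INR, RtoC_plus. reflexivity. Qed.

Lemma natC_mult a b : natC (a * b) = natC a * natC b.
Proof. unfold natC. rewrite mult_INR, RtoC_mult. reflexivity. Qed.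

Lemma Csum_zero (u : nat -> C) n : (forall k, (k < n)%nat -> u k = 0) -> Csum u n = 0.
Proof. intros H. induction n; simpl; [reflexivity|]. rewrite IHn, H; [ring|lia|intros; apply H; lia]. Qed.

Lemma Csum_comm (f : nat -> nat -> C) n m :
  Csum (fun i => Csum (fun j => f i j) m) n = Csum (fun j => Csum (fun i => f i j) n) m.
Proof.
  induction n; simpl; [symmetry; apply Csum_zero; reflexivity|].
  rewrite IHn, <- Csum_plus. reflexivity.
Qed.

Lemma Csum_indicator b u n : indicator b (Csum u n) = Csum (fun i => indicator b (u i)) n.
Proof. destruct b; simpl; [reflexivity|]. symmetry. apply Csum_zero. reflexivity. Qed.

Lemma indicator_comm b b' c : indicator b (indicator b' c) = indicator b' (indicator b c).
Proof. destruct b, b'; reflexivity. Qed.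

Lemma Csum_app f n m : Csum f (n + m) = Csum f n + Csum (fun i => f (n + i)%nat) m.
Proof.
  induction m; simpl; [rewrite Nat.add_0_r; ring|].
  rewrite Nat.add_succ_r. simpl. rewrite IHm. ring.
Qed.

Lemma Csum_extend (f : nat -> C) n m : (n <= m)%nat -> (forall i, (n <= i < m)%nat -> f i = 0) -> Csum f m = Csum f n.
Proof.
  intros Hnm H. replace m with (n + (m - n))%nat by lia. rewrite Csum_app.
  rewrite (Csum_zero (fun i => f (n + i)%nat)); [ring|]. intros k Hk. apply H. lia.
Qed.

Lemma Csum_tail (f : nat -> C) n c : (forall i, (n <= i)%nat -> f i = 0) ->
  Csum (fun i => indicator (c <? i) (f i)) n = Csum (fun i => f (c + 1 + i)%nat) n.
Proof.
  intros H. rewrite <- (Csum_extend (fun i => indicator (c <? i) (f i)) n (c + 1 + n)); [|lia|].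
  - rewrite Csum_app, Csum_zero, Cplus_0_l.
    + apply Csum_ext. intros k _. destruct (Nat.ltb_spec c (c + 1 + k)); [reflexivity|lia].
    + intros k Hk. destruct (Nat.ltb_spec c k); [lia|reflexivity].
  - intros i Hi. rewrite H by lia. destruct (c <? i); reflexivity.
Qed.

Lemma Csum_head f n e : (e <= n)%nat -> Csum (fun i => indicator (i <? e) (f i)) n = Csum f e.
Proof.
  intros He. rewrite (Csum_extend _ e n He).
  - apply Csum_ext. intros k Hk. destruct (Nat.ltb_spec k e); [reflexivity|lia].
  - intros i Hi. destruct (Nat.ltb_spec i e); [lia|reflexivity].
Qed.

Lemma Csum_single f n c : Csum (fun i => indicator (i =? c) (f i)) n = indicator (c <? n) (f c).
Proof.
  induction n; [reflexivity|]. cbn [Csum]. rewrite IHn.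
  destruct (Nat.eqb_spec n c) as [E|E]; destruct (Nat.ltb_spec c n); destruct (Nat.ltb_spec c (S n)); try lia;
    try subst c; simpl; ring.
Qed.

(** Regrouping by [e = x + 1 + y]. Here [g e] plays the part of an indicator depending on [e] alone;
    as it vanishes from [n] on, the corner of the square outside the triangle contributes
    nothing. *)
Lemma Csum_antidiagonal (f : nat -> nat -> C) (g : nat -> C -> C) n :
  (forall e c, (n <= e)%nat -> g e c = 0) ->
  (forall e u m, g e (Csum u m) = Csum (fun i => g e (u i)) m) ->
  Csum (fun x => Csum (fun y => g (x + 1 + y)%nat (f x y)) n) n
  = Csum (fun e => g e (Csum (fun x => f x (e - 1 - x)%nat) e)) n.
Proof.
  intros Hg Hs.
  transitivity (Csum (fun x => Csum (fun e => indicator (x <? e) (g e (f x (e - 1 - x)%nat))) n) n).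
  - apply Csum_ext. intros x _. rewrite (Csum_tail (fun e => g e (f x (e - 1 - x)%nat))).
    + apply Csum_ext. intros y _. do 2 f_equal. lia.
    + intros i Hi. apply Hg. exact Hi.
  - rewrite Csum_comm. apply Csum_ext. intros e He. rewrite (Csum_head (fun x => g e (f x (e - 1 - x)%nat))) by lia.
    symmetry. apply Hs.
Qed.

(* The summation variables are shifted by one: [S a], [S b], [S x], [S y] are the
   positive solutions of [a x + b y = n]. *)
Definition quad_sum (n : nat) (G : nat -> nat -> nat -> nat -> C) : C :=
  Csum (fun a => Csum (fun b => Csum (fun x => Csum (fun y =>
    indicator (S a * S x + S b * S y =? n) (G a b x y)) n) n) n) n.

Lemma quad_sum_ext n G G' : (forall a b x y, G a b x y = G' a b x y) -> quad_sum n G = quad_sum n G'.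
Proof.
  intros E. unfold quad_sum. do 4 (apply Csum_ext; intros ? _). rewrite E. reflexivity.
Qed.

Lemma quad_sum_plus n G G' : quad_sum n (fun a b x y => G a b x y + G' a b x y) = quad_sum n G + quad_sum n G'.
Proof.
  unfold quad_sum. do 4 (rewrite <- Csum_plus; apply Csum_ext; intros ? _).
  match goal with |- indicator ?b _ = _ => destruct b end; simpl; ring.
Qed.

Lemma quad_sum_scal n c G : quad_sum n (fun a b x y => c * G a b x y) = c * quad_sum n G.
Proof.
  unfold quad_sum. do 4 (rewrite <- Csum_scal; apply Csum_ext; intros ? _).
  match goal with |- indicator ?b _ = _ => destruct b end; simpl; ring.
Qed.

Lemma quad_sum_swap n G : quad_sum n G = quad_sum n (fun a b x y => G b a y x).
Proof.
  unfold quad_sum. rewrite Csum_comm. do 2 (apply Csum_ext; intros ? _).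
  rewrite Csum_comm. do 2 (apply Csum_ext; intros ? _). rewrite Nat.add_comm. reflexivity.
Qed.

(* The bijection (a, b, x, y) -> (a - b, b, x, x + y). *)
Lemma quad_sum_subtract n (F : nat -> nat -> C) :
  quad_sum n (fun a b x y => indicator (b <? a) (F a b))
  = quad_sum n (fun a b x y => indicator (x <? y) (F (b + 1 + a)%nat b)).
Proof.
  unfold quad_sum. rewrite Csum_comm. symmetry. rewrite Csum_comm. symmetry.
  apply Csum_ext. intros b _. rewrite Csum_comm. symmetry. rewrite Csum_comm. symmetry.
  apply Csum_ext. intros x _.
  transitivity (Csum (fun a => indicator (b <? a) (Csum (fun y => indicator (S a * S x + S b * S y =? n) (F a b)) n)) n).
  { apply Csum_ext. intros a _. rewrite Csum_indicator. apply Csum_ext. intros y _. apply indicator_comm. }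
  rewrite Csum_tail.
  2:{ intros a Ha. apply Csum_zero. intros y _. destruct (Nat.eqb_spec (S a * S x + S b * S y) n); [nia|reflexivity]. }
  apply Csum_ext. intros a _.
  transitivity (Csum (fun y => indicator (x <? y) (indicator (S a * S x + S b * S y =? n) (F (b + 1 + a)%nat b))) n).
  2:{ apply Csum_ext. intros y _. apply indicator_comm. }
  rewrite (Csum_tail (fun y => indicator (S a * S x + S b * S y =? n) (F (b + 1 + a)%nat b))).
  2:{ intros y Hy. destruct (Nat.eqb_spec (S a * S x + S b * S y) n); [nia|reflexivity]. }
  apply Csum_ext. intros y _.
  destruct (Nat.eqb_spec (S (b + 1 + a) * S x + S b * S y) n), (Nat.eqb_spec (S a * S x + S b * S (x + 1 + y)) n);
    try reflexivity; nia.
Qed.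

Lemma quad_sum_trichotomy n G (p q : nat -> nat -> nat -> nat -> nat) :
  quad_sum n G = quad_sum n (fun a b x y => indicator (p a b x y <? q a b x y) (G a b x y))
    + quad_sum n (fun a b x y => indicator (q a b x y <? p a b x y) (G a b x y))
    + quad_sum n (fun a b x y => indicator (p a b x y =? q a b x y) (G a b x y)).
Proof.
  rewrite <- !quad_sum_plus. apply quad_sum_ext. intros a b x y.
  destruct (Nat.ltb_spec (p a b x y) (q a b x y)), (Nat.ltb_spec (q a b x y) (p a b x y)),
    (Nat.eqb_spec (p a b x y) (q a b x y)); try lia; simpl; ring.
Qed.

(* The three hypotheses hold for the binary forms invariant under
   [(u, v) -> (v, u)] and [(u, v) -> (u, u - v)], that is for the polynomials in
   [u^2 - u v + v^2] and [(u v (u - v))^2]. *)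
Lemma quad_sum_invariant n (F : C -> C -> C) :
  (forall u v, F u v = F v u) -> (forall u v, F (u + v) v = F u (- v)) -> (forall u v, F u (- v) = F v (- u)) ->
  quad_sum n (fun a b _ _ => F (natC (S a)) (natC (S b)))
  = quad_sum n (fun a b _ _ => F (natC (S a)) (- natC (S b)))
  + quad_sum n (fun a b _ _ => indicator (a =? b) (F (natC (S a)) (natC (S b))))
  - quad_sum n (fun a b x y => indicator (x =? y) (F (natC (S a)) (- natC (S b)))).
Proof.
  intros Hs Hh Hhs.
  (* The left sum is cut according to the order of [a, b], the right one according to the order of
     [x, y]. All four strict parts equal [h], by the bijection and by the swap, so that the
     diagonals remain. *)
  set (h := quad_sum n (fun a b x y => indicator (x <? y) (F (natC (S a)) (- natC (S b))))).
  assert (E1 : quad_sum n (fun a b _ _ => indicator (b <? a) (F (natC (S a)) (natC (S b)))) = h).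
  { rewrite (quad_sum_subtract n (fun a b => F (natC (S a)) (natC (S b)))). apply quad_sum_ext.
    intros a b x y. f_equal. rewrite <- Hh. f_equal. rewrite <- natC_plus. f_equal. lia. }
  assert (E2 : quad_sum n (fun a b _ _ => indicator (a <? b) (F (natC (S a)) (natC (S b)))) = h).
  { rewrite quad_sum_swap, <- E1. apply quad_sum_ext. intros. rewrite Hs. reflexivity. }
  assert (E3 : quad_sum n (fun a b x y => indicator (y <? x) (F (natC (S a)) (- natC (S b)))) = h).
  { rewrite quad_sum_swap. apply quad_sum_ext. intros. rewrite Hhs. reflexivity. }
  rewrite (quad_sum_trichotomy n (fun a b _ _ => F (natC (S a)) (natC (S b))) (fun a b _ _ => a) (fun a b _ _ => b)).
  rewrite (quad_sum_trichotomy n (fun a b _ _ => F (natC (S a)) (- natC (S b))) (fun _ _ x _ => x) (fun _ _ _ y => y)).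
  rewrite E1, E2, E3. fold h. ring.
Qed.

(** * Divisor sums and the two diagonals *)

Definition divisor_sum (n : nat) (G : nat -> nat -> C) : C :=
  Csum (fun d => Csum (fun e => indicator (S d * S e =? n) (G d e)) n) n.

Lemma divisor_sum_ext n G G' : (forall d e, (S d * S e = n)%nat -> G d e = G' d e) ->
  divisor_sum n G = divisor_sum n G'.
Proof.
  intros E. unfold divisor_sum. do 2 (apply Csum_ext; intros ? _).
  match goal with |- indicator (?a =? ?b) _ = _ => destruct (Nat.eqb_spec a b) end; [|reflexivity].
  rewrite E by assumption. reflexivity.
Qed.

Lemma divisor_sum_swap n G : divisor_sum n G = divisor_sum n (fun d e => G e d).
Proof.
  unfold divisor_sum. rewrite Csum_comm. do 2 (apply Csum_ext; intros ? _). rewrite Nat.mul_comm. reflexivity.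
Qed.

Lemma divisor_sum_plus n G G' : divisor_sum n (fun d e => G d e + G' d e) = divisor_sum n G + divisor_sum n G'.
Proof.
  unfold divisor_sum. do 2 (rewrite <- Csum_plus; apply Csum_ext; intros ? _).
  match goal with |- indicator ?b _ = _ => destruct b end; simpl; ring.
Qed.

Lemma divisor_sum_scal n c G : divisor_sum n (fun d e => c * G d e) = c * divisor_sum n G.
Proof.
  unfold divisor_sum. do 2 (rewrite <- Csum_scal; apply Csum_ext; intros ? _).
  match goal with |- indicator ?b _ = _ => destruct b end; simpl; ring.
Qed.

(** For [a = b] the equation is [a (x + y) = n], and the cofactor [S e] of the divisor splits into
    two positive parts in [e] ways. *)
Lemma quad_sum_diagonal_divisors n (F : nat -> C) :
  quad_sum n (fun a b _ _ => indicator (a =? b) (F a)) = divisor_sum n (fun d e => natC e * F d).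
Proof.
  unfold quad_sum, divisor_sum. apply Csum_ext. intros a Ha.
  transitivity (Csum (fun b => indicator (b =? a) (Csum (fun x => Csum (fun y => indicator (S a * S (x + 1 + y) =? n) (F a)) n) n)) n).
  { apply Csum_ext. intros b _. rewrite Nat.eqb_sym.
    destruct (Nat.eqb_spec b a) as [->|]; cbn [indicator].
    - do 2 (apply Csum_ext; intros ? _). f_equal. f_equal. nia.
    - apply Csum_zero. intros x _. apply Csum_zero. intros y _. destruct (_ =? n); reflexivity. }
  rewrite Csum_single. destruct (Nat.ltb_spec a n); [|lia]. cbn [indicator].
  rewrite (Csum_antidiagonal (fun _ _ => F a) (fun e c => indicator (S a * S e =? n) c)).
  - apply Csum_ext. intros e _. f_equal. clear. induction e; cbn [Csum]; [unfold natC; simpl; ring|].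
    rewrite IHe, natC_S. ring.
  - intros e c He. destruct (Nat.eqb_spec (S a * S e) n); [nia|reflexivity].
  - intros. apply Csum_indicator.
Qed.

(** For [x = y] the equation is [x (a + b) = n], so the sum runs over the divisors [S d] and their
    splittings [S a + S (d - 1 - a)]. *)
Lemma quad_sum_diagonal_codivisors n (F : nat -> nat -> C) :
  quad_sum n (fun a b x y => indicator (x =? y) (F a b))
  = divisor_sum n (fun d _ => Csum (fun a => F a (d - 1 - a)%nat) d).
Proof.
  rewrite divisor_sum_swap. unfold quad_sum, divisor_sum.
  transitivity (Csum (fun x => Csum (fun a => Csum (fun b => indicator (S x * S (a + 1 + b) =? n) (F a b)) n) n) n).
  - transitivity (Csum (fun a => Csum (fun b => Csum (fun x => indicator (S x * S (a + 1 + b) =? n) (F a b)) n) n) n).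
    + apply Csum_ext. intros a _. apply Csum_ext. intros b _. apply Csum_ext. intros x Hx.
      transitivity (Csum (fun y => indicator (y =? x) (indicator (S x * S (a + 1 + b) =? n) (F a b))) n).
      * apply Csum_ext. intros y _. rewrite (Nat.eqb_sym x y), indicator_comm.
        destruct (Nat.eqb_spec y x) as [->|]; [|reflexivity]. cbn [indicator]. f_equal. f_equal. nia.
      * rewrite (Csum_single (fun _ => indicator (S x * S (a + 1 + b) =? n) (F a b))). destruct (Nat.ltb_spec x n); [reflexivity|lia].
    + symmetry. rewrite Csum_comm. symmetry. apply Csum_ext. intros a _. apply Csum_comm.
  - apply Csum_ext. intros x _.
    apply (Csum_antidiagonal F (fun e c => indicator (S x * S e =? n) c)).
    + intros e c He. destruct (Nat.eqb_spec (S x * S e) n); [nia|reflexivity].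
    + intros. apply Csum_indicator.
Qed.

(** At [n = 0] the sum is empty and [sigma k 0 = 0]. Hence the end terms of a convolution vanish,
    and [sigma k] is the coefficient sequence of a Lambert series without constant term. *)
Definition sigma (k n : nat) : C := divisor_sum n (fun d _ => natC (S d) ^ k).

Definition convolution (u v : nat -> C) (n : nat) : C := Csum (fun i => u i * v (n - i)%nat) (S n).

Lemma sigma_range k n m : (n <= m)%nat ->
  sigma k n = Csum (fun d => Csum (fun e => indicator (S d * S e =? n) (natC (S d) ^ k)) m) m.
Proof.
  intros H. unfold sigma, divisor_sum. symmetry. rewrite (Csum_extend _ n m H).
  - apply Csum_ext. intros d _. apply Csum_extend; [exact H|].
    intros i Hi. destruct (Nat.eqb_spec (S d * S i) n); [nia|reflexivity].
  - intros d Hd. apply Csum_zero. intros e _. destruct (Nat.eqb_spec (S d * S e) n); [nia|reflexivity].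
Qed.

Lemma quad_sum_convolution n p q :
  quad_sum n (fun a b _ _ => natC (S a) ^ p * natC (S b) ^ q) = convolution (sigma p) (sigma q) n.
Proof.
  unfold convolution.
  (* The new variable [i] is the value of [a x]. Since [i <= n], the truncated difference [n - i] is
     the true value of [b y]. *)
  transitivity (Csum (fun i => Csum (fun a => Csum (fun b => Csum (fun x => Csum (fun y =>
     indicator (S a * S x =? i) (indicator (S b * S y =? n - i) (natC (S a) ^ p * natC (S b) ^ q))) n) n) n) n) (S n)).
  - unfold quad_sum. symmetry.
    do 4 (rewrite Csum_comm; apply Csum_ext; intros ? _). rename k into a, k0 into b, k1 into x, k2 into y. symmetry.
    transitivity (Csum (fun i => indicator (i =? S a * S x) (indicator (S b * S y =? n - i) (natC (S a) ^ p * natC (S b) ^ q))) (S n)).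
    + rewrite Csum_single. destruct (Nat.ltb_spec (S a * S x) (S n)).
      * cbn [indicator]. f_equal.
        destruct (Nat.eqb_spec (S a * S x + S b * S y) n), (Nat.eqb_spec (S b * S y) (n - S a * S x)); try reflexivity; nia.
      * destruct (Nat.eqb_spec (S a * S x + S b * S y) n); [nia|reflexivity].
    + apply Csum_ext. intros i _. rewrite Nat.eqb_sym. reflexivity.
  - apply Csum_ext. intros i Hi. rewrite (sigma_range p i n), (sigma_range q (n - i) n) by lia.
    rewrite Cmult_comm, <- Csum_scal. apply Csum_ext. intros a _.
    rewrite <- Csum_scal.
    transitivity (Csum (fun x => Csum (fun b => Csum (fun y => indicator (S a * S x =? i)
        (indicator (S b * S y =? n - i) (natC (S a) ^ p * natC (S b) ^ q))) n) n) n); [apply Csum_comm|].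
    apply Csum_ext. intros x _. rewrite Cmult_comm, <- Csum_scal. apply Csum_ext. intros b _.
    rewrite <- Csum_scal. apply Csum_ext. intros y _.
    destruct (S a * S x =? i), (S b * S y =? n - i); cbn [indicator]; ring.
Qed.

(** From [S d * S e = n], the factor [e = S e - 1] turns [(S d)^(k+1)] into
    [n (S d)^k - (S d)^(k+1)]. The term [natC n * sigma k n] is what becomes [q d/dq] of an
    Eisenstein series. *)
Lemma divisor_sum_cofactor n k c :
  divisor_sum n (fun d e => natC e * (c * natC (S d) ^ S k)) = c * (natC n * sigma k n - sigma (S k) n).
Proof.
  unfold sigma.
  transitivity (divisor_sum n (fun d e => (c * natC n) * natC (S d) ^ k + (- c) * natC (S d) ^ S k)).
  - apply divisor_sum_ext. intros d e E. rewrite <- E, natC_mult, (natC_S e). simpl. ring.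
  - rewrite divisor_sum_plus, !divisor_sum_scal. ring.
Qed.

(** The right side consists of the two diagonals: [c] is the value [F 1 1], and [P d] is the sum of
    [F a (- b)] over the positive [a, b] with [a + b = d + 1]. *)
Lemma quad_sum_boundary n k c (F : C -> C -> C) (P : nat -> C) :
  (forall u v, F u v = F v u) -> (forall u v, F (u + v) v = F u (- v)) -> (forall u v, F u (- v) = F v (- u)) ->
  (forall u, F u u = c * u ^ S k) ->
  (forall d, Csum (fun a => F (natC (S a)) (natC (S a) - natC (S d))) d = P d) ->
  quad_sum n (fun a b _ _ => F (natC (S a)) (natC (S b)) - F (natC (S a)) (- natC (S b)))
  = c * (natC n * sigma k n - sigma (S k) n) - divisor_sum n (fun d _ => P d).
Proof.
  intros H1 H2 H3 H4 H5.
  transitivity (quad_sum n (fun a b _ _ => F (natC (S a)) (natC (S b)))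
                + (-(1)) * quad_sum n (fun a b _ _ => F (natC (S a)) (- natC (S b)))).
  { rewrite <- quad_sum_scal, <- quad_sum_plus. apply quad_sum_ext. intros. ring. }
  rewrite (quad_sum_invariant n F H1 H2 H3).
  assert (E1 : quad_sum n (fun a b _ _ => indicator (a =? b) (F (natC (S a)) (natC (S b))))
     = c * (natC n * sigma k n - sigma (S k) n)).
  { rewrite <- divisor_sum_cofactor, <- quad_sum_diagonal_divisors. apply quad_sum_ext. intros a b _ _.
    destruct (Nat.eqb_spec a b) as [->|]; [|reflexivity]. cbn [indicator]. apply H4. }
  assert (E2 : quad_sum n (fun a b x y => indicator (x =? y) (F (natC (S a)) (- natC (S b))))
     = divisor_sum n (fun d _ => P d)).
  { rewrite (quad_sum_diagonal_codivisors n (fun a b => F (natC (S a)) (- natC (S b)))).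
    apply divisor_sum_ext. intros d _ _. rewrite <- H5. apply Csum_ext. intros a Ha. f_equal.
    replace (S d) with (S a + S (d - 1 - a))%nat by lia. rewrite natC_plus. ring. }
  rewrite E1, E2. ring.
Qed.

(** * Power sums and the three convolution identities *)

Lemma convolution_sigma_comm p q n : convolution (sigma p) (sigma q) n = convolution (sigma q) (sigma p) n.
Proof.
  rewrite <- !quad_sum_convolution, quad_sum_swap. apply quad_sum_ext. intros. ring.
Qed.

(** In this and the next two closed forms [D] is independent of the upper limit, which lets the
    induction go through; they are used at [D = e + 1], where the summand is the form at
    [(a, a - D)]. *)
Lemma Csum_Q2 (D : C) e :
  Csum (fun a => (D ^ 2 - D * natC (S a) + natC (S a) ^ 2) ^ 2) e =
  let m := natC e in
  (30 * D ^ 4 * m - 30 * D ^ 3 * m ^ 2 - 30 * D ^ 3 * m + 30 * D ^ 2 * m ^ 3 + 45 * D ^ 2 * m ^ 2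
   + 15 * D ^ 2 * m - 15 * D * m ^ 4 - 30 * D * m ^ 3 - 15 * D * m ^ 2
   + 6 * m ^ 5 + 15 * m ^ 4 + 10 * m ^ 3 - m) / 30.
Proof.
  cbv zeta. induction e; cbn [Csum]; [unfold natC; simpl INR; field|].
  rewrite IHe, natC_S. field.
Qed.

Lemma Csum_Q3 (D : C) e :
  Csum (fun a => (D ^ 2 - D * natC (S a) + natC (S a) ^ 2) ^ 3) e =
  let m := natC e in
  (420 * D ^ 6 * m - 630 * D ^ 5 * m ^ 2 - 630 * D ^ 5 * m + 840 * D ^ 4 * m ^ 3 + 1260 * D ^ 4 * m ^ 2
   + 420 * D ^ 4 * m - 735 * D ^ 3 * m ^ 4 - 1470 * D ^ 3 * m ^ 3 - 735 * D ^ 3 * m ^ 2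
   + 504 * D ^ 2 * m ^ 5 + 1260 * D ^ 2 * m ^ 4 + 840 * D ^ 2 * m ^ 3 - 84 * D ^ 2 * m
   - 210 * D * m ^ 6 - 630 * D * m ^ 5 - 525 * D * m ^ 4 + 105 * D * m ^ 2
   + 60 * m ^ 7 + 210 * m ^ 6 + 210 * m ^ 5 - 70 * m ^ 3 + 10 * m) / 420.
Proof.
  cbv zeta. induction e; cbn [Csum]; [unfold natC; simpl INR; field|].
  rewrite IHe, natC_S. field.
Qed.

Lemma Csum_disc (D : C) e :
  Csum (fun a => (D * natC (S a) * (D - natC (S a))) ^ 2) e =
  let m := natC e in
  (10 * D ^ 4 * m ^ 3 + 15 * D ^ 4 * m ^ 2 + 5 * D ^ 4 * m - 15 * D ^ 3 * m ^ 4 - 30 * D ^ 3 * m ^ 3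
   - 15 * D ^ 3 * m ^ 2 + 6 * D ^ 2 * m ^ 5 + 15 * D ^ 2 * m ^ 4 + 10 * D ^ 2 * m ^ 3 - D ^ 2 * m) / 30.
Proof.
  cbv zeta. induction e; cbn [Csum]; [unfold natC; simpl INR; field|].
  rewrite IHe, natC_S. field.
Qed.

(** For [F = (u v (u - v))^2] one has [F u v - F u (- v) = - 4 u^3 v^3], and [F] vanishes for
    [u = v], whence [c = 0]. The polynomial [P] is [(D^7 - D^3) / 30] at [D = d + 1]. The identity
    is the coefficient form of [E4^2 = E8]. *)
Lemma convolution_sigma_3_3 n :
  120 * convolution (sigma 3) (sigma 3) n = sigma 7 n - sigma 3 n.
Proof.
  pose proof (quad_sum_boundary n 5 0 (fun u v => (u * v * (u - v)) ^ 2)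
    (fun d => 1 / 30 * natC (S d) ^ 7 + - (1) / 30 * natC (S d) ^ 3)) as H.
  cbv beta in H. rewrite divisor_sum_plus, !divisor_sum_scal in H.
  rewrite (quad_sum_ext n _ (fun a b _ _ => (- (4)) * (natC (S a) ^ 3 * natC (S b) ^ 3))) in H by (intros; ring).
  rewrite quad_sum_scal, quad_sum_convolution in H.
  fold (sigma 7 n) in H. fold (sigma 3 n) in H.
  replace (convolution (sigma 3) (sigma 3) n) with (- (4) * convolution (sigma 3) (sigma 3) n / - (4)) by field.
  rewrite H; [field|intros; ring..|].
  intros d.
  rewrite (Csum_ext _ (fun a => (natC (S d) * natC (S a) * (natC (S d) - natC (S a))) ^ 2)) by (intros; ring).
  rewrite Csum_disc. cbv zeta. replace (natC d) with (natC (S d) - 1) by (rewrite natC_S; ring). field.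
Qed.

(** For the square of [u^2 - u v + v^2] the difference [F u v - F u (- v)] is [- 4 (u v^3 + u^3 v)].
    The two diagonals each contribute [sigma 4], and these cancel. *)
Lemma convolution_sigma_1_3 n :
  240 * convolution (sigma 1) (sigma 3) n = 21 * sigma 5 n + 10 * sigma 3 n - 30 * natC n * sigma 3 n - sigma 1 n.
Proof.
  pose proof (quad_sum_boundary n 3 1 (fun u v => (u ^ 2 - u * v + v ^ 2) ^ 2)
    (fun d => 7 / 10 * natC (S d) ^ 5 + (- (1) * natC (S d) ^ 4 + (1 / 3 * natC (S d) ^ 3 + - (1) / 30 * natC (S d) ^ 1)))) as H.
  cbv beta in H. rewrite !divisor_sum_plus, !divisor_sum_scal in H.
  rewrite (quad_sum_ext n _ (fun a b _ _ => (- (4)) * (natC (S a) ^ 1 * natC (S b) ^ 3 + natC (S a) ^ 3 * natC (S b) ^ 1))) in H by (intros; ring).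
  rewrite quad_sum_scal, quad_sum_plus, !quad_sum_convolution in H.
  fold (sigma 5 n) in H. fold (sigma 4 n) in H. fold (sigma 3 n) in H. fold (sigma 1 n) in H.
  rewrite (convolution_sigma_comm 3 1) in H.
  replace (convolution (sigma 1) (sigma 3) n)
    with (- (4) * (convolution (sigma 1) (sigma 3) n + convolution (sigma 1) (sigma 3) n) / - (8)) by field.
  rewrite H; [field|intros; ring..|].
  intros d.
  rewrite (Csum_ext _ (fun a => (natC (S d) ^ 2 - natC (S d) * natC (S a) + natC (S a) ^ 2) ^ 2)) by (intros; ring).
  rewrite Csum_Q2. cbv zeta. replace (natC d) with (natC (S d) - 1) by (rewrite natC_S; ring). field.
Qed.

(** For the cube of [u^2 - u v + v^2] the difference is [- 6 (u v^5 + u^5 v) - 14 u^3 v^3]; the last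
    term is removed by [convolution_sigma_3_3]. As before the even divisor sum, here [sigma 6],
    cancels between the diagonals. *)
Lemma convolution_sigma_1_5 n :
  504 * convolution (sigma 1) (sigma 5) n = 20 * sigma 7 n + 21 * sigma 5 n - 42 * natC n * sigma 5 n + sigma 1 n.
Proof.
  pose proof (quad_sum_boundary n 5 1 (fun u v => (u ^ 2 - u * v + v ^ 2) ^ 3)
    (fun d => 83 / 140 * natC (S d) ^ 7 + (- (1) * natC (S d) ^ 6 + (1 / 2 * natC (S d) ^ 5 +
       (- (7) / 60 * natC (S d) ^ 3 + 1 / 42 * natC (S d) ^ 1))))) as H.
  cbv beta in H. rewrite !divisor_sum_plus, !divisor_sum_scal in H.
  rewrite (quad_sum_ext n _ (fun a b _ _ => (- (6)) * (natC (S a) ^ 1 * natC (S b) ^ 5 + natC (S a) ^ 5 * natC (S b) ^ 1)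
    + (- (14)) * (natC (S a) ^ 3 * natC (S b) ^ 3))) in H by (intros; ring).
  rewrite quad_sum_plus, !quad_sum_scal, quad_sum_plus, !quad_sum_convolution in H.
  fold (sigma 7 n) in H. fold (sigma 6 n) in H.
  fold (sigma 5 n) in H. fold (sigma 3 n) in H. fold (sigma 1 n) in H.
  rewrite (convolution_sigma_comm 5 1) in H.
  replace (convolution (sigma 1) (sigma 5) n)
    with ((- (6) * (convolution (sigma 1) (sigma 5) n + convolution (sigma 1) (sigma 5) n)
           + - (14) * convolution (sigma 3) (sigma 3) n + 14 / 120 * (120 * convolution (sigma 3) (sigma 3) n)) / - (12)) by field.
  rewrite H, convolution_sigma_3_3; [field|intros; ring..|].
  intros d.
  rewrite (Csum_ext _ (fun a => (natC (S d) ^ 2 - natC (S d) * natC (S a) + natC (S a) ^ 2) ^ 3)) by (intros; ring).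
  rewrite Csum_Q3. cbv zeta. replace (natC d) with (natC (S d) - 1) by (rewrite natC_S; ring). field.
Qed.

(** * Lambert series *)

Lemma unit_radius_le c c' : (forall n, (Cmod (c n) <= Cmod (c' n))%R) -> unit_radius c' -> unit_radius c.
Proof.
  intros H H' r Hr. destruct (H' r Hr) as [M HM]. exists M. intros n. eapply Rle_trans; [|apply HM].
  apply Rmult_le_compat_r; [apply pow_le; lra|apply H].
Qed.

Lemma unit_radius_one : unit_radius (fun _ => 1).
Proof.
  intros r Hr. exists 1%R. intros n. rewrite Cmod_1, Rmult_1_l.
  change (r ^ n <= r ^ 0)%R. apply pow_le_antitone; [lra|lia].
Qed.

Lemma unit_radius_pow k : unit_radius (fun n => natC n ^ k).
Proof. induction k; [apply unit_radius_one|]. apply (unit_radius_INR (fun n => natC n ^ k)), IHk. Qed.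

Lemma Cmod_natC n : Cmod (natC n) = INR n.
Proof. unfold natC. rewrite Cmod_R, Rabs_pos_eq by apply pos_INR. reflexivity. Qed.

Lemma Cmod_Csum_le u n B : (forall k, (k < n)%nat -> (Cmod (u k) <= B)%R) -> (Cmod (Csum u n) <= INR n * B)%R.
Proof.
  intros H. induction n; cbn [Csum]; [rewrite Cmod_0; simpl; lra|].
  eapply Rle_trans; [apply Cmod_triangle|]. rewrite S_INR.
  specialize (IHn ltac:(intros; apply H; lia)). specialize (H n ltac:(lia)). lra.
Qed.

Lemma Cmod_indicator_le b c B : (0 <= B)%R -> (Cmod c <= B)%R -> (Cmod (indicator b c) <= B)%R.
Proof. destruct b; simpl; [tauto|rewrite Cmod_0; tauto]. Qed.

Lemma unit_radius_sigma k : unit_radius (sigma k).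
Proof.
  apply unit_radius_le with (fun n => natC n ^ (2 + k)); [|apply unit_radius_pow].
  intros n. rewrite Cmod_pow, Cmod_natC. unfold sigma, divisor_sum. rewrite pow_add.
  replace (INR n ^ 2 * INR n ^ k)%R with (INR n * (INR n * INR n ^ k))%R by ring.
  apply Cmod_Csum_le. intros d Hd. apply Cmod_Csum_le. intros e _.
  apply Cmod_indicator_le; [apply pow_le, pos_INR|]. rewrite Cmod_pow, Cmod_natC.
  apply pow_incr. split; [apply pos_INR|]. apply le_INR. lia.
Qed.

Lemma pow_geom_tends_to_0 (k : nat) (q : C) : (Cmod q < 1)%R ->
  Clim (fun n => natC n ^ k * q ^ n) 0.
Proof.
  intros Hq eps He. pose proof (Cmod_ge_0 q).
  (* One extra power of [n] is bounded along with the others, so that the terms are at most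
     [M / n]. *)
  destruct (unit_radius_pow (S k) ((1 + Cmod q) / 2)%R ltac:(lra)) as [M HM].
  assert (HM0 : (0 <= M)%R).
  { eapply Rle_trans; [|apply (HM 0%nat)]. simpl. apply Rmult_le_pos; [apply Cmod_ge_0|lra]. }
  destruct (INR_unbounded (M / eps)) as [N HN].
  exists (S N). intros n Hn.
  assert (Hn' : (INR N < INR n)%R) by (apply lt_INR; lia).
  assert (Hp : (0 < INR n)%R) by (apply lt_0_INR; lia).
  replace (natC n ^ k * q ^ n - 0) with (natC n ^ k * q ^ n) by ring.
  rewrite Cmod_mult, !Cmod_pow, Cmod_natC. specialize (HM n). rewrite Cmod_pow, Cmod_natC in HM.
  apply Rmult_lt_reg_l with (INR n); [exact Hp|].
  apply Rle_lt_trans with (INR n ^ S k * ((1 + Cmod q) / 2) ^ n)%R.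
  - simpl. rewrite <- Rmult_assoc. apply Rmult_le_compat_l; [apply Rmult_le_pos; [lra|apply pow_le; lra]|].
    apply pow_incr. lra.
  - apply Rle_lt_trans with M; [exact HM|].
    assert (M / eps < INR n)%R by lra. apply Rlt_div_l in H0; lra.
Qed.

Lemma Csum_geom (p : C) K : (1 - p) * Csum (fun e => p ^ S e) K = p - p ^ S K.
Proof. induction K; cbn [Csum]; [simpl; ring|]. rewrite Cmult_plus_distr_l, IHK. simpl. ring. Qed.

Lemma Csum_multiples (f : nat -> C) d M : (0 < d)%nat ->
  Csum (fun e => indicator (d * S e <=? M) (f e)) M = Csum f (M / d).
Proof.
  intros Hd. pose proof (Nat.Div0.mul_div_le M d). pose proof (Nat.mul_succ_div_gt M d ltac:(lia)).
  rewrite <- (Csum_head f M (M / d)).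
  - apply Csum_ext. intros e _.
    destruct (Nat.leb_spec (d * S e) M), (Nat.ltb_spec e (M / d)); try reflexivity; nia.
  - apply Nat.Div0.div_le_upper_bound; nia.
Qed.

(** Cutting the double series at total degree [M] leaves the first [M / S d] terms of the geometric
    series that belongs to the divisor [S d]. *)
Lemma sigma_partial_sum k (q : C) M :
  Csum (fun N => sigma k N * q ^ N) (S M)
  = Csum (fun d => natC (S d) ^ k * Csum (fun e => (q ^ S d) ^ S e) (M / S d)) M.
Proof.
  transitivity (Csum (fun N => Csum (fun d => Csum (fun e => indicator (N =? S d * S e) (natC (S d) ^ k * q ^ N)) M) M) (S M)).
  - apply Csum_ext. intros N HN. rewrite (sigma_range k N M) by lia.
    rewrite Cmult_comm, <- Csum_scal. apply Csum_ext. intros d _. rewrite <- Csum_scal.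
    apply Csum_ext. intros e _. rewrite Nat.eqb_sym. destruct (N =? S d * S e); cbn [indicator]; ring.
  - rewrite Csum_comm. apply Csum_ext. intros d _. rewrite Csum_comm.
    rewrite <- (Csum_multiples (fun e => (q ^ S d) ^ S e) (S d) M) by lia.
    rewrite <- Csum_scal. apply Csum_ext. intros e _.
    rewrite Csum_single.
    destruct (Nat.ltb_spec (S d * S e) (S M)), (Nat.leb_spec (S d * S e) M); try lia; cbn [indicator]; [|ring].
    f_equal. rewrite Cpow_mult_r. reflexivity.
Qed.

(** The rearrangement is made on partial sums. For each [d] the two sides differ by a geometric tail
    starting beyond degree [M], so the total difference is at most [M^(k+1) |q|^M / (1 - |q|)],
    which tends to 0. *)
Lemma lambert_PS k (q : C) : (Cmod q < 1)%R -> lambert k q = PS (sigma k) q.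
Proof.
  intros Hq. pose proof (Cmod_ge_0 q). apply CSeries_unique. intros eps He.
  assert (L : Clim (fun M => Csum (fun N => sigma k N * q ^ N) (S M)) (PS (sigma k) q)).
  { apply Clim_shift. apply PS_lim; [apply unit_radius_sigma|exact Hq]. }
  destruct (L (eps / 2)%R ltac:(lra)) as [N1 HN1].
  destruct (pow_geom_tends_to_0 (S k) q Hq (eps / 2 * (1 - Cmod q))%R) as [N2 HN2]; [nra|].
  exists (max N1 N2). intros M HM. specialize (HN1 M ltac:(lia)). specialize (HN2 M ltac:(lia)).
  rewrite sigma_partial_sum in HN1.
  match goal with |- (Cmod (?A - ?l) < _)%R => match type of HN1 with (Cmod (?B - _) < _)%R =>
    replace (A - l) with ((A - B) + (B - l)) by ring; set (A' := A); set (B' := B) in * end end.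
  assert (E : (Cmod (A' - B') <= INR M * (INR M ^ k * (Cmod q ^ M / (1 - Cmod q))))%R).
  { replace (A' - B') with (A' + (- (1)) * B') by ring. unfold A', B'.
    rewrite <- Csum_scal, <- Csum_plus. apply Cmod_Csum_le. intros d Hd.
    assert (Hp : (Cmod (q ^ S d) <= Cmod q)%R).
    { rewrite Cmod_pow. change (Cmod q ^ S d <= Cmod q)%R. rewrite <- (pow_1 (Cmod q)) at 2.
      apply pow_le_antitone; [lra|lia]. }
    set (p := q ^ S d) in *. set (K := (M / S d)%nat).
    assert (Hp1 : (1 - Cmod q <= Cmod (1 - p))%R).
    { pose proof (Cmod_triangle_rev 1 p). rewrite Cmod_1 in H0. lra. }
    assert (Hp0 : 1 - p <> 0) by (apply Cmod_gt_0; lra).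
    change (RtoC (INR (S d))) with (natC (S d)).
    replace (natC (S d) ^ k * p / (1 - p) + - (1) * (natC (S d) ^ k * Csum (fun e => p ^ S e) K))
      with (natC (S d) ^ k * (p ^ S K / (1 - p))).
    2:{ replace (p ^ S K) with (p - (1 - p) * Csum (fun e => p ^ S e) K) by (rewrite Csum_geom; ring).
        field. exact Hp0. }
    rewrite Cmod_mult, Cmod_pow, Cmod_natC, Cmod_div by exact Hp0.
    apply Rmult_le_compat.
    - apply pow_le, pos_INR.
    - apply Rdiv_le_0_compat; [apply Cmod_ge_0|lra].
    - apply pow_incr. split; [apply pos_INR|]. apply le_INR. lia.
    - apply Rmult_le_compat; [apply Cmod_ge_0| |  |].
      + apply Rlt_le, Rinv_0_lt_compat. lra.
      + unfold p. rewrite <- Cpow_mult_r, Cmod_pow. apply pow_le_antitone; [lra|].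
        pose proof (Nat.mul_succ_div_gt M (S d) ltac:(lia)). unfold K. lia.
      + apply Rinv_le_contravar; lra. }
  eapply Rle_lt_trans; [apply Cmod_triangle|].
  replace (natC M ^ S k * q ^ M - 0) with (natC M ^ S k * q ^ M) in HN2 by ring.
  rewrite Cmod_mult, !Cmod_pow, Cmod_natC in HN2.
  assert (E2 : (INR M * (INR M ^ k * (Cmod q ^ M / (1 - Cmod q))) < eps / 2)%R).
  { apply Rmult_lt_reg_r with (1 - Cmod q)%R; [lra|].
    replace (INR M * (INR M ^ k * (Cmod q ^ M / (1 - Cmod q))) * (1 - Cmod q))%R
      with (INR M ^ S k * Cmod q ^ M)%R by (simpl; field; lra). exact HN2. }
  lra.
Qed.

(** * Cauchy products *)

Lemma Rsum_sum_f_R0 u n : sum_f_R0 u n = Rsum u (S n).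
Proof. induction n; [simpl; ring|]. cbn [sum_f_R0]. rewrite IHn. reflexivity. Qed.

Lemma Rsum_minus u v n : Rsum (fun k => (u k - v k)%R) n = (Rsum u n - Rsum v n)%R.
Proof. induction n; simpl; [ring|]. rewrite IHn. ring. Qed.

Lemma Rsum_plus u v n : Rsum (fun k => (u k + v k)%R) n = (Rsum u n + Rsum v n)%R.
Proof. induction n; simpl; [ring|]. rewrite IHn. ring. Qed.

Lemma CSeries_mult u v : summable u -> summable v ->
  CSeries (convolution u v) = CSeries u * CSeries v.
Proof.
  intros Hu Hv. apply summable_ex_series in Hu, Hv.
  assert (A : forall (p : C -> R) w, (forall x, (Rabs (p x) <= Cmod x)%R) -> ex_series (fun n => Cmod (w n)) ->
     ex_series (fun n => Rabs (p (w n)))).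
  { intros p w Hp Hw. apply (ex_series_le (K := R_AbsRing) (V := R_CompleteNormedModule)) with (b := fun n => Cmod (w n)); [|exact Hw].
    intros n. change (Rabs (Rabs (p (w n))) <= Cmod (w n))%R. rewrite Rabs_Rabsolu. apply Hp. }
  pose proof (A Re u re_le_Cmod Hu) as ur. pose proof (A Im u im_le_Cmod Hu) as ui.
  pose proof (A Re v re_le_Cmod Hv) as vr. pose proof (A Im v im_le_Cmod Hv) as vi.
  assert (M : forall a b, ex_series (fun n => Rabs (a n)) -> ex_series (fun n => Rabs (b n)) ->
     is_series (fun n => sum_f_R0 (fun k => (a k * b (n - k)%nat)%R) n) (Series a * Series b)%R).
  { intros a b Ha Hb. apply is_series_mult; try assumption; apply Series_correct, ex_series_Rabs; assumption. }
  change (CSeries u * CSeries v) with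
    ((Series (fun n => Re (u n)) * Series (fun n => Re (v n)) - Series (fun n => Im (u n)) * Series (fun n => Im (v n)))%R,
     (Series (fun n => Re (u n)) * Series (fun n => Im (v n)) + Series (fun n => Im (u n)) * Series (fun n => Re (v n)))%R).
  unfold CSeries, convolution. f_equal; apply is_series_unique.
  - eapply is_series_ext; [|exact (is_series_minus _ _ _ _ (M _ _ ur vr) (M _ _ ui vi))].
    intros n. change (fun n : nat => plus ?a ?b) with (a + b)%R.
    rewrite Re_Csum, !Rsum_sum_f_R0. symmetry. etransitivity; [|apply Rsum_minus]. reflexivity.
  - eapply is_series_ext; [|exact (is_series_plus _ _ _ _ (M _ _ ur vi) (M _ _ ui vr))].
    intros n. rewrite Im_Csum, !Rsum_sum_f_R0. symmetry. etransitivity; [|apply Rsum_plus]. reflexivity.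
Qed.

Lemma PS_mult c c' w : unit_radius c -> unit_radius c' -> (Cmod w < 1)%R ->
  PS (convolution c c') w = PS c w * PS c' w.
Proof.
  intros H H' Hw. unfold PS. rewrite <- CSeries_mult by (apply summable_PS; assumption).
  apply CSeries_ext. intros n. unfold convolution. rewrite Cmult_comm, <- Csum_scal.
  apply Csum_ext. intros i Hi. replace (w ^ n) with (w ^ i * w ^ (n - i)); [ring|].
  rewrite <- Cpow_add_r. f_equal. lia.
Qed.

(** * Ramanujan's identities *)

Lemma Cexp_plus x y : Cexp (x + y) = Cexp x * Cexp y.
Proof.
  destruct x as [a b], y as [c d]. unfold Cexp, Cmult, Re, Im. simpl.
  rewrite exp_plus, cos_plus, sin_plus. f_equal; ring.
Qed.

Lemma Cexp_0 : Cexp 0 = 1.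
Proof. unfold Cexp, Re, Im. simpl. rewrite exp_0, cos_0, sin_0. unfold RtoC. f_equal; ring. Qed.

Lemma Cmod_Cexp x : Cmod (Cexp x) = exp (Re x).
Proof.
  unfold Cmod, Cexp. simpl fst. simpl snd.
  replace ((exp (Re x) * cos (Im x)) ^ 2 + (exp (Re x) * sin (Im x)) ^ 2)%R
    with (Rsqr (exp (Re x))).
  - apply sqrt_Rsqr. apply Rlt_le, exp_pos.
  - pose proof (sin2_cos2 (Im x)) as H. unfold Rsqr in *.
    replace ((exp (Re x) * cos (Im x)) ^ 2 + (exp (Re x) * sin (Im x)) ^ 2)%R
      with (exp (Re x) * exp (Re x) * (sin (Im x) * sin (Im x) + cos (Im x) * cos (Im x)))%R by ring.
    rewrite H. ring.
Qed.

Lemma Cexp_neq_0 x : Cexp x <> 0.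
Proof. apply Cmod_gt_0. rewrite Cmod_Cexp. apply exp_pos. Qed.

Lemma Cmod_le_abs x : (Cmod x <= Rabs (Re x) + Rabs (Im x))%R.
Proof.
  destruct x as [a b]. replace (a, b) with (RtoC a + RtoC b * Ci).
  - eapply Rle_trans; [apply Cmod_triangle|]. rewrite Cmod_mult, Cmod_Ci, !Cmod_R, Rmult_1_r.
    replace (Re (a + b * Ci)) with a by (simpl; ring). replace (Im (a + b * Ci)) with b by (simpl; ring). lra.
  - unfold Ci, RtoC, Cplus, Cmult. simpl. f_equal; ring.
Qed.

Lemma real_taylor1 (f : R -> R) (l : R) (eps : R) : (0 < eps)%R -> derivable_pt_lim f 0 l ->
  exists d, (0 < d)%R /\ forall h, (Rabs h < d)%R -> (Rabs (f h - f 0 - l * h) <= eps * Rabs h)%R.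
Proof.
  intros He H. destruct (H eps He) as [d Hd]. exists d. split; [apply cond_pos|].
  intros h Hh. destruct (Req_dec h 0) as [->|Hh0].
  - replace (f 0 - f 0 - l * 0)%R with 0%R by ring. rewrite Rabs_R0. lra.
  - specialize (Hd h Hh0 Hh). rewrite Rplus_0_l in Hd.
    replace (f h - f 0 - l * h)%R with (((f h - f 0) / h - l) * h)%R by (field; exact Hh0).
    rewrite Rabs_mult. apply Rmult_le_compat_r; [apply Rabs_pos|lra].
Qed.

Lemma Cder_Cexp_0 : Cder Cexp 0 1.
Proof.
  apply Cder_eps. intros eps He.
  (* The real and imaginary errors come to [3 e m] and [4 e m], with [m = Cmod y], together below
     [8 e m]. The bound [e <= 1] gives [Rabs (1 + a) <= 2]. *)
  set (e := Rmin (eps / 8) 1). assert (He1 : (0 < e)%R) by (apply Rmin_pos; lra).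
  assert (He2 : (e <= eps / 8)%R) by apply Rmin_l. assert (He3 : (e <= 1)%R) by apply Rmin_r. clearbody e.
  destruct (real_taylor1 exp 1 e He1) as [d1 [Hd1 T1]].
  { rewrite <- exp_0. apply derivable_pt_lim_exp. }
  destruct (real_taylor1 cos 0 e He1) as [d2 [Hd2 T2]].
  { pose proof (derivable_pt_lim_cos 0) as H. rewrite sin_0, Ropp_0 in H. exact H. }
  destruct (real_taylor1 sin 1 e He1) as [d3 [Hd3 T3]].
  { rewrite <- cos_0. apply derivable_pt_lim_sin. }
  exists (Rmin e (Rmin d1 (Rmin d2 d3))). split; [repeat apply Rmin_pos; assumption|].
  intros y Hy. replace (y - 0) with y in * by ring.
  assert (Hy0 : (Cmod y < e)%R) by (eapply Rlt_le_trans; [exact Hy|apply Rmin_l]).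
  assert (Hy1 : (Cmod y < Rmin d1 (Rmin d2 d3))%R) by (eapply Rlt_le_trans; [exact Hy|apply Rmin_r]).
  assert (Hy2 : (Cmod y < d1)%R) by (eapply Rlt_le_trans; [exact Hy1|apply Rmin_l]).
  assert (Hy3 : (Cmod y < Rmin d2 d3)%R) by (eapply Rlt_le_trans; [exact Hy1|apply Rmin_r]).
  assert (Hy4 : (Cmod y < d2)%R) by (eapply Rlt_le_trans; [exact Hy3|apply Rmin_l]).
  assert (Hy5 : (Cmod y < d3)%R) by (eapply Rlt_le_trans; [exact Hy3|apply Rmin_r]).
  rewrite Cexp_0. pose proof (re_le_Cmod y) as Ha. pose proof (im_le_Cmod y) as Hb.
  set (a := Re y) in *. set (b := Im y) in *. set (m := Cmod y) in *.
  specialize (T1 a ltac:(lra)). specialize (T2 b ltac:(lra)). specialize (T3 b ltac:(lra)).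
  rewrite exp_0 in T1. rewrite cos_0 in T2. rewrite sin_0 in T3.
  set (u := (exp a - 1 - 1 * a)%R) in *. set (v := (cos b - 1 - 0 * b)%R) in *. set (s := (sin b - 0 - 1 * b)%R) in *.
  assert (Ea : exp a = (u + 1 + a)%R) by (unfold u; ring).
  eapply Rle_trans; [apply Cmod_le_abs|].
  assert (R1 : (Rabs (Re (Cexp y - 1 - 1 * y)) <= 3 * e * m)%R).
  { replace (Re (Cexp y - 1 - 1 * y)) with (u * cos b + (1 + a) * v)%R.
    2:{ unfold Cexp, Cminus, Cplus, Copp, Cmult, Re, Im. simpl. fold a. fold b. fold (Re y) (Im y). fold a b. rewrite Ea. unfold v. ring. }
    eapply Rle_trans; [apply Rabs_triang|]. rewrite !Rabs_mult.
    assert (Rabs (cos b) <= 1)%R by (apply Rabs_le, COS_bound).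
    assert (Rabs (1 + a) <= 2)%R by (eapply Rle_trans; [apply Rabs_triang|]; rewrite Rabs_R1; lra).
    pose proof (Rabs_pos u). pose proof (Rabs_pos v). pose proof (Rabs_pos (cos b)). pose proof (Rabs_pos (1 + a)).
    assert (Rabs u <= e * m)%R by nra. assert (Rabs v <= e * m)%R by nra. nra. }
  assert (R2 : (Rabs (Im (Cexp y - 1 - 1 * y)) <= 4 * e * m)%R).
  { replace (Im (Cexp y - 1 - 1 * y)) with (u * sin b + (1 + a) * s + a * b)%R.
    2:{ unfold Cexp, Cminus, Cplus, Copp, Cmult, Re, Im. simpl. fold (Re y) (Im y). fold a b. rewrite Ea. unfold s. ring. }
    eapply Rle_trans; [apply Rabs_triang|].
    apply Rle_trans with (Rabs (u * sin b) + Rabs ((1 + a) * s) + Rabs (a * b))%R;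
      [apply Rplus_le_compat_r, Rabs_triang|]. rewrite !Rabs_mult.
    assert (Rabs (sin b) <= 1)%R by (apply Rabs_le, SIN_bound).
    assert (Rabs (1 + a) <= 2)%R by (eapply Rle_trans; [apply Rabs_triang|]; rewrite Rabs_R1; lra).
    pose proof (Rabs_pos u). pose proof (Rabs_pos s). pose proof (Rabs_pos (sin b)). pose proof (Rabs_pos (1 + a)).
    pose proof (Rabs_pos a). pose proof (Rabs_pos b).
    assert (Rabs u <= e * m)%R by nra. assert (Rabs s <= e * m)%R by nra.
    assert (Rabs a * Rabs b <= e * m)%R by (apply Rmult_le_compat; lra). nra. }
  assert (0 <= m)%R by apply Cmod_ge_0. nra.
Qed.

Lemma Cder_Cexp x : Cder Cexp x (Cexp x).
Proof.
  apply Cder_ext_near with (fun y => Cexp x * Cexp (y - x)).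
  - exists 1%R. split; [lra|]. intros y _. rewrite <- Cexp_plus. f_equal. ring.
  - apply Cder_eq with (Cexp x * (1 * (1 - 0))); [|ring]. apply Cder_scal.
    apply (Cder_comp Cexp (fun y => y - x)).
    + replace (x - x) with (RtoC 0) by ring. apply Cder_Cexp_0.
    + apply Cder_minus; [apply Cder_id|apply Cder_const].
Qed.

(** * Derivatives of the Eisenstein series *)

Lemma Cmod_nome_lt_1 tau : upper_half_plane tau -> (Cmod (nome tau) < 1)%R.
Proof.
  intros H. unfold nome. rewrite Cmod_Cexp, <- exp_0. apply exp_increasing.
  destruct tau as [a b]. unfold upper_half_plane in H. simpl in *. pose proof PI_RGT_0. nra.
Qed.

Lemma Cder_nome tau : Cder nome tau (2 * PI * Ci * nome tau).
Proof.
  unfold nome. apply Cder_eq with (Cexp (2 * PI * Ci * tau) * (2 * PI * Ci * 1)); [|ring].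
  apply (Cder_comp Cexp (fun t => 2 * PI * Ci * t)); [apply Cder_Cexp|]. apply Cder_scal, Cder_id.
Qed.

Lemma Copen_upper_half_plane : Copen upper_half_plane.
Proof.
  apply Copen_near. intros x Hx. exists (Im x). split; [exact Hx|]. intros y Hy.
  unfold upper_half_plane. pose proof (im_le_Cmod (y - x)) as H. rewrite Im_minus in H.
  apply Rabs_le_between in H. lra.
Qed.

Lemma Cder_eisenstein (c : C) (k : nat) tau : upper_half_plane tau ->
  Cder (fun t => 1 + c * lambert k (nome t)) tau
    (2 * PI * Ci * (c * PS (fun n => natC n * sigma k n) (nome tau))).
Proof.
  intros H. pose proof (Cmod_nome_lt_1 tau H) as Hq.
  apply Cder_ext_near with (fun t => 1 + c * PS (sigma k) (nome t)).
  - apply near_imp with (2 := proj1 (Copen_near _) Copen_upper_half_plane tau H).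
    intros y Hy. rewrite lambert_PS; [reflexivity|]. apply Cmod_nome_lt_1, Hy.
  - change (fun n => natC n * sigma k n) with (fun n => INR n * sigma k n).
    rewrite <- PS_theta; [|apply unit_radius_sigma|exact Hq].
    apply Cder_eq with (0 + c * (PS (dcoef (sigma k)) (nome tau) * (2 * PI * Ci * nome tau))); [|ring].
    apply Cder_plus; [apply Cder_const|]. apply Cder_scal.
    apply Cder_comp; [|apply Cder_nome]. apply Cder_PS; [apply unit_radius_sigma|exact Hq].
Qed.

Ltac PS_expand :=
  repeat (rewrite PS_plus || rewrite PS_scal);
  repeat (apply unit_radius_plus || apply unit_radius_scal || apply unit_radius_sigma
    || apply (unit_radius_INR (sigma _)) || assumption).

(** After multiplying out, the only nonlinear term is the product of the series of [sigma 1] and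
    [sigma 3], with factor [5760 = 24 * 240]; [convolution_sigma_1_3] makes it linear and supplies
    the derivative. *)
Lemma PS_theta_sigma_3 q : (Cmod q < 1)%R ->
  240 * PS (fun n => natC n * sigma 3 n) q
  = ((1 - 24 * PS (sigma 1) q) * (1 + 240 * PS (sigma 3) q) - (1 - 504 * PS (sigma 5) q)) / 3.
Proof.
  intros Hq.
  assert (E : PS (sigma 1) q * PS (sigma 3) q =
     21 / 240 * PS (sigma 5) q + (10 / 240 * PS (sigma 3) q + (- (30) / 240 * PS (fun n => natC n * sigma 3 n) q
       + - (1) / 240 * PS (sigma 1) q))).
  { rewrite <- PS_mult; try apply unit_radius_sigma; [|exact Hq].
    transitivity (PS (fun n => 21 / 240 * sigma 5 n + (10 / 240 * sigma 3 n + (- (30) / 240 * (natC n * sigma 3 n)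
       + - (1) / 240 * sigma 1 n))) q).
    - apply PS_ext. intros n. pose proof (convolution_sigma_1_3 n) as H.
      replace (convolution (sigma 1) (sigma 3) n) with (240 * convolution (sigma 1) (sigma 3) n / 240) by field.
      rewrite H. field.
    - PS_expand. reflexivity. }
  replace ((1 - 24 * PS (sigma 1) q) * (1 + 240 * PS (sigma 3) q))
    with (1 - 24 * PS (sigma 1) q + 240 * PS (sigma 3) q - 5760 * (PS (sigma 1) q * PS (sigma 3) q)) by ring.
  rewrite E. field.
Qed.

Lemma PS_theta_sigma_5 q : (Cmod q < 1)%R ->
  - (504) * PS (fun n => natC n * sigma 5 n) q
  = ((1 - 24 * PS (sigma 1) q) * (1 - 504 * PS (sigma 5) q) - (1 + 240 * PS (sigma 3) q) ^ 2) / 2.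
Proof.
  intros Hq.
  assert (E : PS (sigma 1) q * PS (sigma 5) q =
     20 / 504 * PS (sigma 7) q + (21 / 504 * PS (sigma 5) q + (- (42) / 504 * PS (fun n => natC n * sigma 5 n) q
       + 1 / 504 * PS (sigma 1) q))).
  { rewrite <- PS_mult; try apply unit_radius_sigma; [|exact Hq].
    transitivity (PS (fun n => 20 / 504 * sigma 7 n + (21 / 504 * sigma 5 n + (- (42) / 504 * (natC n * sigma 5 n)
       + 1 / 504 * sigma 1 n))) q).
    - apply PS_ext. intros n. pose proof (convolution_sigma_1_5 n) as H.
      replace (convolution (sigma 1) (sigma 5) n) with (504 * convolution (sigma 1) (sigma 5) n / 504) by field.
      rewrite H. field.
    - PS_expand. reflexivity. }
  assert (E' : PS (sigma 3) q * PS (sigma 3) q = 1 / 120 * PS (sigma 7) q + - (1) / 120 * PS (sigma 3) q).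
  { rewrite <- PS_mult; try apply unit_radius_sigma; [|exact Hq].
    transitivity (PS (fun n => 1 / 120 * sigma 7 n + - (1) / 120 * sigma 3 n) q).
    - apply PS_ext. intros n. pose proof (convolution_sigma_3_3 n) as H.
      replace (convolution (sigma 3) (sigma 3) n) with (120 * convolution (sigma 3) (sigma 3) n / 120) by field.
      rewrite H. field.
    - PS_expand. reflexivity. }
  (* The series of [sigma 7] drops out, since [12096 * 20 / 504 = 57600 / 120 = 480]. *)
  replace ((1 - 24 * PS (sigma 1) q) * (1 - 504 * PS (sigma 5) q) - (1 + 240 * PS (sigma 3) q) ^ 2)
    with (- (24) * PS (sigma 1) q - 504 * PS (sigma 5) q + 12096 * (PS (sigma 1) q * PS (sigma 5) q)
      - 480 * PS (sigma 3) q - 57600 * (PS (sigma 3) q * PS (sigma 3) q)) by ring.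
  rewrite E, E'. field.
Qed.

Lemma Cder_E4 tau : upper_half_plane tau ->
  Cder E4 tau (2 * PI * Ci * ((E2 tau * E4 tau - E6 tau) / 3)).
Proof.
  intros H. pose proof (Cmod_nome_lt_1 tau H) as Hq.
  eapply Cder_eq; [exact (Cder_eisenstein 240 3 tau H)|].
  rewrite PS_theta_sigma_3 by exact Hq. unfold E2, E4, E6. rewrite !lambert_PS by exact Hq. reflexivity.
Qed.

Lemma Cder_E6 tau : upper_half_plane tau ->
  Cder E6 tau (2 * PI * Ci * ((E2 tau * E6 tau - E4 tau ^ 2) / 2)).
Proof.
  intros H. pose proof (Cmod_nome_lt_1 tau H) as Hq.
  apply Cder_ext_near with (fun t => 1 + - (504) * lambert 5 (nome t)).
  { exists 1%R. split; [lra|]. intros y _. unfold E6. ring. }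
  eapply Cder_eq; [exact (Cder_eisenstein (- (504)) 5 tau H)|].
  rewrite PS_theta_sigma_5 by exact Hq. unfold E2, E4, E6. rewrite !lambert_PS by exact Hq. reflexivity.
Qed.

(** * Third-order operators and coordinates *)

(** The derivatives are carried as explicit functions, correct on [V], so that chain rules become
    polynomial identities instead of statements about nested [C_derive]. *)
Definition derivatives3 (V : C -> Prop) (f f1 f2 f3 : C -> C) : Prop :=
  forall x, V x -> Cder f x (f1 x) /\ Cder f1 x (f2 x) /\ Cder f2 x (f3 x).

Lemma ball_center (x : C) (r : R) : (0 < r)%R -> (Cmod (x - x) < r)%R.
Proof. replace (x - x) with (RtoC 0) by ring. rewrite Cmod_0. tauto. Qed.

Lemma Cder_ext_on (V : C -> Prop) f g x l : Copen V -> V x -> (forall y, V y -> f y = g y) ->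
  Cder f x l -> Cder g x l.
Proof.
  intros HV Hx E. apply Cder_ext_near. apply near_imp with (P := V); [exact E|].
  apply Copen_near; assumption.
Qed.

Lemma derivatives3_thrice_derivable V f f1 f2 f3 : Copen V -> derivatives3 V f f1 f2 f3 -> thrice_derivable_on V f.
Proof.
  intros HV H.
  assert (E1 : forall x, V x -> f1 x = C_derive f x).
  { intros x Hx. symmetry. apply Cder_unique, H, Hx. }
  assert (D1 : forall x, V x -> Cder (C_derive f) x (f2 x)).
  { intros x Hx. apply (Cder_ext_on V f1); try assumption. apply H, Hx. }
  assert (E2 : forall x, V x -> f2 x = C_derive (C_derive f) x).
  { intros x Hx. symmetry. apply Cder_unique, D1, Hx. }
  assert (D2 : forall x, V x -> Cder (C_derive (C_derive f)) x (f3 x)).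
  { intros x Hx. apply (Cder_ext_on V f2); try assumption. apply H, Hx. }
  split; [|split]; intros x Hx.
  - exact (Cder_ex _ _ _ (proj1 (H x Hx))).
  - exact (Cder_ex _ _ _ (D1 x Hx)).
  - exact (Cder_ex _ _ _ (D2 x Hx)).
Qed.

Lemma derivatives3_C_derive V f : thrice_derivable_on V f ->
  derivatives3 V f (C_derive f) (C_derive (C_derive f)) (C_derive (C_derive (C_derive f))).
Proof.
  intros [H1 [H2 H3]] x Hx. split; [|split]; apply Cder_correct; [apply H1|apply H2|apply H3]; exact Hx.
Qed.

Lemma derivatives3_ext V f g f1 f2 f3 : Copen V -> (forall x, V x -> f x = g x) -> derivatives3 V f f1 f2 f3 -> derivatives3 V g f1 f2 f3.
Proof.
  intros HV E H x Hx. destruct (H x Hx) as [H1 H2]. split; [|exact H2]. apply (Cder_ext_on V f); assumption.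
Qed.

Lemma derivatives3_subset (V W : C -> Prop) f f1 f2 f3 : (forall x, W x -> V x) -> derivatives3 V f f1 f2 f3 -> derivatives3 W f f1 f2 f3.
Proof. intros S H x Hx. apply H, S, Hx. Qed.

Lemma derivatives3_comp (V U : C -> Prop) f f1 f2 f3 p p1 p2 p3 :
  derivatives3 U f f1 f2 f3 -> derivatives3 V p p1 p2 p3 -> (forall x, V x -> U (p x)) ->
  derivatives3 V (fun x => f (p x)) (fun x => f1 (p x) * p1 x) (fun x => f2 (p x) * p1 x ^ 2 + f1 (p x) * p2 x)
    (fun x => f3 (p x) * p1 x ^ 3 + 3 * (f2 (p x) * (p1 x * p2 x)) + f1 (p x) * p3 x).
Proof.
  intros Hf Hp HVU x Hx. destruct (Hf (p x) (HVU x Hx)) as [F0 [F1 F2]]. destruct (Hp x Hx) as [P0 [P1 P2]].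
  split; [|split].
  - apply Cder_comp; assumption.
  - apply Cder_eq with ((f2 (p x) * p1 x) * p1 x + f1 (p x) * p2 x); [|ring].
    apply (Cder_mult (fun x => f1 (p x))); [apply Cder_comp|]; assumption.
  - eapply Cder_eq.
    + apply Cder_plus.
      * apply (Cder_mult (fun x => f2 (p x)) (fun x => p1 x ^ 2)); [apply Cder_comp; eassumption|].
        apply Cder_pow. eassumption.
      * apply (Cder_mult (fun x => f1 (p x)) p2); [apply Cder_comp; eassumption|eassumption].
    + cbn [pred INR]. rewrite RtoC_plus. ring.
Qed.

Lemma derivatives3_inverse (V U : C -> Prop) p p1 p2 p3 q :
  derivatives3 V p p1 p2 p3 -> (forall x, V x -> p1 x <> 0) -> (forall y, U y -> V (q y)) ->
  (forall y, U y -> Cder q y (/ p1 (q y))) ->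
  exists q1 q2 q3, derivatives3 U q q1 q2 q3.
Proof.
  intros Hp H0 HUV Hq.
  exists (fun y => / p1 (q y)), (fun y => - p2 (q y) * (/ p1 (q y)) ^ 3),
    (fun y => - (p3 (q y) * / p1 (q y)) * (/ p1 (q y)) ^ 3
       + - p2 (q y) * (3 * (/ p1 (q y)) ^ 2 * (- p2 (q y) * (/ p1 (q y)) ^ 3))).
  intros y Hy. destruct (Hp (q y) (HUV y Hy)) as [P0 [P1 P2]]. pose proof (H0 (q y) (HUV y Hy)) as Hnz.
  assert (Q1 : Cder (fun y => / p1 (q y)) y (- p2 (q y) * (/ p1 (q y)) ^ 3)).
  { eapply Cder_eq; [apply Cder_inv; [exact Hnz|]; apply (Cder_comp p1 q); [exact P1|apply Hq, Hy]|]. cbv beta. field. exact Hnz. }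
  split; [apply Hq, Hy|split; [exact Q1|]].
  eapply Cder_eq.
  - apply (Cder_mult (fun y => - p2 (q y)) (fun y => (/ p1 (q y)) ^ 3)).
    + apply Cder_opp. apply (Cder_comp p2 q); [exact P2|apply Hq, Hy].
    + apply (Cder_pow (fun y => / p1 (q y))). exact Q1.
  - cbn [pred INR]. rewrite !RtoC_plus. ring.
Qed.

(* On [S], and on functions with three derivatives, the operator [L] is
   [a3 d^3 + a2 d^2 + a1 d + a0]. *)
Definition third_order (S : C -> Prop) (L : (C -> C) -> C -> C) (a3 a2 a1 a0 : C -> C) : Prop :=
  forall V f f1 f2 f3, Copen V -> (forall x, V x -> S x) -> derivatives3 V f f1 f2 f3 ->
  forall x, V x -> L f x = a3 x * f3 x + a2 x * f2 x + a1 x * f1 x + a0 x * f x.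

Lemma solves_iff_derivatives3 S L a3 a2 a1 a0 V f f1 f2 f3 : third_order S L a3 a2 a1 a0 -> Copen V -> (forall x, V x -> S x) ->
  derivatives3 V f f1 f2 f3 ->
  (solves L V f <-> forall x, V x -> a3 x * f3 x + a2 x * f2 x + a1 x * f1 x + a0 x * f x = 0).
Proof.
  intros HL HV HS HD. split.
  - intros [_ H] x Hx. rewrite <- (HL V f f1 f2 f3) by assumption. apply H, Hx.
  - intros H. split; [eapply derivatives3_thrice_derivable; eassumption|].
    intros x Hx. rewrite (HL V f f1 f2 f3) by assumption. apply H, Hx.
Qed.

Lemma solves_ext S L a3 a2 a1 a0 V f g : third_order S L a3 a2 a1 a0 -> Copen V -> (forall x, V x -> S x) ->
  (forall x, V x -> f x = g x) -> solves L V f -> solves L V g.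
Proof.
  intros HL HV HS E Hf. pose proof (derivatives3_C_derive V f (proj1 Hf)) as HD.
  apply (solves_iff_derivatives3 S L a3 a2 a1 a0 V g _ _ _ HL HV HS (derivatives3_ext V f g _ _ _ HV E HD)).
  intros x Hx. rewrite <- E by exact Hx. revert x Hx.
  apply (solves_iff_derivatives3 S L a3 a2 a1 a0 V f _ _ _ HL HV HS HD). exact Hf.
Qed.

Lemma solves_local S L a3 a2 a1 a0 (V : C -> Prop) f : third_order S L a3 a2 a1 a0 ->
  (forall x, V x -> exists W : C -> Prop, W x /\ solves L W f) -> solves L V f.
Proof.
  intros HL H. split; [split; [|split]|]; intros x Hx; destruct (H x Hx) as [W [HWx [[A [B D]] E]]];
    [apply A|apply B|apply D|apply E]; exact HWx.
Qed.

Section Coordinate.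

Context (S : C -> Prop) (p p1 p2 p3 : C -> C) (HD : derivatives3 S p p1 p2 p3) (Hp1 : forall x, S x -> p1 x <> 0).

Lemma chart (W : C -> Prop) (x0 : C) : Copen W -> W x0 -> (forall x, W x -> S x) ->
  exists (V : C -> Prop) (rho : R) (q q1 q2 q3 : C -> C),
    let U := fun y => (Cmod (y - p x0) < rho)%R in
    (0 < rho)%R /\ Copen V /\ V x0 /\ (forall x, V x -> W x) /\
    (forall x, V x -> U (p x) /\ q (p x) = x) /\ (forall y, U y -> V (q y) /\ p (q y) = y) /\
    derivatives3 U q q1 q2 q3.
Proof.
  intros HW Hx0 HWS. destruct (proj1 (Copen_near W) HW x0 Hx0) as [r0 [Hr0 HB]].
  assert (HS : forall x, (Cmod (x - x0) < r0)%R -> S x) by (intros; apply HWS, HB; assumption).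
  destruct (local_inverse p p1 x0 r0 Hr0) as [r [rho [q [Hr [Hrho [Hq [Hqp Hnz]]]]]]].
  - intros x Hx. apply HD, HS, Hx.
  - apply (Cder_cont p1 x0 (p2 x0)). apply HD, HWS, Hx0.
  - apply Hp1, HWS, Hx0.
  (* Intersecting with the preimage of the target ball makes [p] a bijection from [V] onto the whole
     ball, with inverse [q]. *)
  - set (V := fun x => (Cmod (x - x0) < r)%R /\ (Cmod (p x - p x0) < rho)%R).
    assert (HVS : forall x, V x -> S x) by (intros x [Hx _]; apply HS; lra).
    destruct (derivatives3_inverse V (fun y => (Cmod (y - p x0) < rho)%R) p p1 p2 p3 q) as [q1 [q2 [q3 HDq]]].
    + apply (derivatives3_subset S); assumption.
    + intros x Hx. apply Hp1, HVS, Hx.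
    + intros y Hy. destruct (Hq y Hy) as [A [B _]]. split; [exact A|]. rewrite B. exact Hy.
    + intros y Hy. apply Hq, Hy.
    + exists V, rho, q, q1, q2, q3. cbv zeta. split; [exact Hrho|]. split; [|split; [|split; [|split; [|split]]]].
      * apply Copen_near. intros x [Hx1 Hx2]. apply near_and; [apply near_ball; exact Hx1|].
        apply (Ccont_near p x (fun y => (Cmod (y - p x0) < rho)%R)); [|apply near_ball; exact Hx2].
        apply (Cder_cont p x (p1 x)). apply HD, HS. lra.
      * split; apply ball_center; lra.
      * intros x [Hx _]. apply HB. lra.
      * intros x [Hx1 Hx2]. split; [exact Hx2|apply Hqp; assumption].
      * intros y Hy. destruct (Hq y Hy) as [A [B _]]. split; [|exact B]. split; [exact A|]. rewrite B. exact Hy.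
      * exact HDq.
Qed.

Context (L M : (C -> C) -> C -> C) (a3 a2 a1 a0 b3 b2 b1 b0 k : C -> C) (T : C -> Prop).
Context (HL : third_order S L a3 a2 a1 a0) (HM : third_order T M b3 b2 b1 b0).
Context (Hk : forall x, S x -> k x <> 0).
Context (Hcoef : forall x, S x ->
  a3 x * p1 x ^ 3 = k x * b3 (p x) /\
  3 * (a3 x * (p1 x * p2 x)) + a2 x * p1 x ^ 2 = k x * b2 (p x) /\
  a3 x * p3 x + a2 x * p2 x + a1 x * p1 x = k x * b1 (p x) /\
  a0 x = k x * b0 (p x)).

(** [Hcoef] is the chain rule sorted by the order of the derivative of the outer function: [L]
    applied to a pullback is [k] times the pullback of [M]. *)
Lemma pullback_coefficients x (y0 y1 y2 y3 : C) : S x ->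
  a3 x * (y3 * p1 x ^ 3 + 3 * (y2 * (p1 x * p2 x)) + y1 * p3 x)
  + a2 x * (y2 * p1 x ^ 2 + y1 * p2 x) + a1 x * (y1 * p1 x) + a0 x * y0
  = k x * (b3 (p x) * y3 + b2 (p x) * y2 + b1 (p x) * y1 + b0 (p x) * y0).
Proof.
  intros Hx. destruct (Hcoef x Hx) as [c3 [c2 [c1 c0]]].
  transitivity ((a3 x * p1 x ^ 3) * y3 + (3 * (a3 x * (p1 x * p2 x)) + a2 x * p1 x ^ 2) * y2
    + (a3 x * p3 x + a2 x * p2 x + a1 x * p1 x) * y1 + a0 x * y0); [ring|].
  rewrite c3, c2, c1, c0. ring.
Qed.

Lemma pullback_solves (V U : C -> Prop) f : Copen V -> Copen U -> (forall x, V x -> S x) ->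
  (forall y, U y -> T y) -> (forall x, V x -> U (p x)) -> solves M U f -> solves L V (fun x => f (p x)).
Proof.
  intros HV HU HVS HUT HVU Hf. pose proof (derivatives3_C_derive U f (proj1 Hf)) as Df.
  pose proof (proj1 (solves_iff_derivatives3 T M b3 b2 b1 b0 U f _ _ _ HM HU HUT Df) Hf) as E.
  apply (solves_iff_derivatives3 S L a3 a2 a1 a0 V _ _ _ _ HL HV HVS
    (derivatives3_comp V U f _ _ _ p p1 p2 p3 Df (derivatives3_subset S V _ _ _ _ HVS HD) HVU)).
  intros x Hx. rewrite pullback_coefficients by (apply HVS, Hx). rewrite E by (apply HVU, Hx). ring.
Qed.

(** Nothing is known about the smoothness of [f] itself. Near each point of [U] it is recovered as
    the differentiable pullback composed with a local inverse of [p]; then [k] can be divided out of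
    the equation. *)
Lemma pushforward_solves (V U : C -> Prop) f : Copen V -> Copen U -> (forall x, V x -> S x) ->
  (forall y, U y -> T y) -> maps_onto p V U -> solves L V (fun x => f (p x)) -> solves M U f.
Proof.
  intros HV HU HVS HUT [HVU Hon] Hf.
  assert (Loc : forall y, U y -> exists W f1 f2 f3, W y /\ Copen W /\ (forall z, W z -> U z) /\ derivatives3 W f f1 f2 f3).
  { intros y Hy. destruct (Hon y Hy) as [x [Hx <-]].
    destruct (chart V x HV Hx HVS) as [V' [rho [q [q1 [q2 [q3 [Hrho [HV' [Hx' [HV'V [Hpq [Hqp Dq]]]]]]]]]]]].
    eexists. eexists. eexists. eexists.
    split; [|split; [|split]].
    4:{ eapply derivatives3_ext.
        3:{ eapply derivatives3_comp; [apply (derivatives3_C_derive V _ (proj1 Hf))|exact Dq|].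
            intros z Hz. apply HV'V, Hqp, Hz. }
        - apply Copen_ball.
        - intros z Hz. cbv beta. f_equal. apply Hqp, Hz. }
    - apply ball_center. exact Hrho.
    - apply Copen_ball.
    - intros z Hz. cbv beta in Hz. rewrite <- (proj2 (Hqp z Hz)). apply HVU, HV'V, Hqp, Hz. }
  assert (Df : thrice_derivable_on U f).
  { split; [|split]; intros y Hy; destruct (Loc y Hy) as [W [f1 [f2 [f3 [HWy [HW [HWU HDW]]]]]]];
      apply (derivatives3_thrice_derivable W f f1 f2 f3 HW HDW); exact HWy. }
  split; [exact Df|]. apply derivatives3_C_derive in Df. intros y Hy.
  rewrite (HM U f _ _ _ HU HUT Df y Hy). destruct (Hon y Hy) as [x [Hx <-]].
  pose proof (proj1 (solves_iff_derivatives3 S L a3 a2 a1 a0 V _ _ _ _ HL HV HVS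
    (derivatives3_comp V U f _ _ _ p p1 p2 p3 Df (derivatives3_subset S V _ _ _ _ HVS HD) HVU)) Hf x Hx) as E.
  cbv beta in E. rewrite pullback_coefficients in E by (apply HVS, Hx).
  pose proof (Hk x (HVS x Hx)) as Hkx.
  match type of E with _ * ?e = _ => replace e with (/ k x * (k x * e)) by (field; exact Hkx) end.
  rewrite E. ring.
Qed.

(** Continuity of [q] is recorded because a branch of the logarithm is later transported along [q]
    together with the solutions. *)
Lemma chart_solves (HT : forall x, S x -> T (p x)) (W : C -> Prop) (x0 : C) :
  Copen W -> W x0 -> (forall x, W x -> S x) ->
  exists (V : C -> Prop) (rho : R) (q : C -> C),
    let U := fun y => (Cmod (y - p x0) < rho)%R in
    (0 < rho)%R /\ Copen V /\ V x0 /\ (forall x, V x -> W x) /\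
    (forall x, V x -> U (p x) /\ q (p x) = x) /\
    (forall y, U y -> V (q y) /\ p (q y) = y /\ Ccont q y) /\
    (forall chi, solves L V chi -> solves M U (fun y => chi (q y))).
Proof.
  intros HW Hx0 HWS.
  destruct (chart W x0 HW Hx0 HWS) as [V [rho [q [q1 [q2 [q3 [Hrho [HV [Hx [HVW [Hpq [Hqp Dq]]]]]]]]]]]].
  exists V, rho, q. cbv zeta. do 5 (split; [assumption|]). split.
  - intros y Hy. destruct (Hqp y Hy). split; [assumption|split; [assumption|]].
    apply (Cder_cont q y (q1 y)). apply Dq. exact Hy.
  - intros chi Hchi. apply (pushforward_solves V).
    + exact HV.
    + apply Copen_ball.
    + intros x Hxx. apply HWS, HVW, Hxx.
    + intros y Hy. rewrite <- (proj2 (Hqp y Hy)). apply HT, HWS, HVW, Hqp, Hy.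
    + split; [intros x Hxx; apply Hpq, Hxx|]. intros y Hy. exists (q y). apply Hqp, Hy.
    + apply (solves_ext S L a3 a2 a1 a0 V chi); try assumption.
      * intros x Hxx. apply HWS, HVW, Hxx.
      * intros x Hxx. rewrite (proj2 (Hpq x Hxx)). reflexivity.
Qed.

Lemma reads_in_coordinate_of_coefficients (HT : forall y, T y) : reads_in_coordinate S p L M.
Proof.
  split.
  - intros V U HV HU HVS Hmap f. split.
    + apply pullback_solves; try assumption; [intros; apply HT|apply Hmap].
    + apply pushforward_solves; try assumption. intros; apply HT.
  - intros W x0 HW Hx0 HWS.
    destruct (chart_solves (fun x _ => HT (p x)) W x0 HW Hx0 HWS) as [V [rho [q [Hrho [HV [Hx [HVW [Hpq [Hqp Hs]]]]]]]]].
    exists V, (fun y => (Cmod (y - p x0) < rho)%R).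
    split; [exact HV|]. split; [apply Copen_ball|]. split; [exact Hx|]. split; [exact HVW|].
    split; [|split].
    + split; [intros x Hxx; apply Hpq, Hxx|]. intros y Hy. exists (q y). destruct (Hqp y Hy) as [A [B _]]. split; assumption.
    + intros x y Hxx Hyy E. rewrite <- (proj2 (Hpq x Hxx)), <- (proj2 (Hpq y Hyy)), E. reflexivity.
    + intros chi Hchi. exists (fun y => chi (q y)). split; [apply Hs; exact Hchi|].
      intros x Hxx. rewrite (proj2 (Hpq x Hxx)). reflexivity.
Qed.

End Coordinate.

(** * The equation in the coordinates z and w *)

Lemma Cinv_0 : / (0 : C) = 0.
Proof. unfold Cinv, RtoC. simpl. f_equal; unfold Rdiv; ring. Qed.

(* As [/ 0 = 0], the condition [J tau <> 0] excludes [Delta tau = 0] as well. *)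
Lemma non_elliptic_nonzero tau : non_elliptic tau ->
  E4 tau <> 0 /\ E6 tau <> 0 /\ E4 tau ^ 3 - E6 tau ^ 2 <> 0.
Proof.
  intros [_ [HJ HJ']]. unfold J, Delta in *.
  assert (HD : E4 tau ^ 3 - E6 tau ^ 2 <> 0).
  { intros E. apply HJ. rewrite E. unfold Cdiv. rewrite Cmult_0_l, Cinv_0. ring. }
  split; [|split; [|exact HD]]; intros E; rewrite E in *.
  - apply HJ. unfold Cdiv. ring.
  - apply HJ'. field. replace (E4 tau ^ 3 - 0 ^ 2) with (E4 tau ^ 3) in HD by ring.
    intros E'. apply HD. rewrite E'. ring.
Qed.

Lemma zcoord_eisenstein tau : E4 tau ^ 3 - E6 tau ^ 2 <> 0 ->
  zcoord tau = E4 tau ^ 3 / (E4 tau ^ 3 - E6 tau ^ 2).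
Proof. intros H. unfold zcoord, J, Delta. field. exact H. Qed.

Lemma wcoord_eisenstein tau : E4 tau <> 0 -> E4 tau ^ 3 - E6 tau ^ 2 <> 0 ->
  wcoord tau = (E4 tau ^ 3 - E6 tau ^ 2) / E4 tau ^ 3.
Proof. intros H H'. unfold wcoord, J, Delta. field. split; assumption. Qed.

Definition two_pi_i : C := 2 * PI * Ci.

Lemma two_pi_i_neq_0 : two_pi_i <> 0.
Proof.
  apply Cmult_neq_0; [apply Cmult_neq_0|apply Ci_nz]; apply Cmod_gt_0; rewrite Cmod_R, Rabs_pos_eq;
    pose proof PI_RGT_0; lra.
Qed.

(** The derivative of [E2] stays a symbol. In the coefficient of the first derivative it occurs once
    from the Serre derivatives and once from the third derivative of the coordinate, with opposite
    signs. *)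
Lemma Cder_E2 tau : upper_half_plane tau -> Cder E2 tau (C_derive E2 tau).
Proof.
  intros H.
  assert (D : exists l, Cder E2 tau l).
  { eexists. eapply Cder_ext_near; [|exact (Cder_eisenstein (- (24)) 1 tau H)].
    exists 1%R. split; [lra|]. intros y _. unfold E2. ring. }
  destruct D as [l Hl]. rewrite (Cder_unique _ _ _ Hl). exact Hl.
Qed.

Lemma serre_Cder k f tau l : Cder f tau l -> serre k f tau = l / two_pi_i - k / 12 * E2 tau * f tau.
Proof. intros H. unfold serre. rewrite (Cder_unique _ _ _ H). reflexivity. Qed.

(** With [d = q d/dq], the expansion of [(d - E2/3) (d - E2/6) d] is
    [d^3 - E2/2 d^2 + (E2^2/18 - (d E2)/6) d], and each [d] carries a factor [/ two_pi_i]. *)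
Lemma third_order_mlde mu1 mu2 : third_order upper_half_plane (mlde mu1 mu2)
  (fun _ => / two_pi_i ^ 3) (fun t => - (E2 t / 2) / two_pi_i ^ 2)
  (fun t => - (C_derive E2 t / 6) / two_pi_i ^ 2 + E2 t ^ 2 / 18 / two_pi_i + mu1 * E4 t / two_pi_i)
  (fun t => mu2 * E6 t).
Proof.
  intros V f f1 f2 f3 HV HS HD x Hx.
  pose proof two_pi_i_neq_0 as HK.
  assert (S0 : forall y, V y -> serre 0 f y = / two_pi_i * f1 y).
  { intros y Hy. rewrite (serre_Cder 0 f y (f1 y)) by apply (HD y Hy). field. exact HK. }
  assert (D0 : forall y, V y -> Cder (serre 0 f) y (/ two_pi_i * f2 y)).
  { intros y Hy. apply (Cder_ext_on V (fun y => / two_pi_i * f1 y)); try assumption.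
    - intros z Hz. symmetry. apply S0, Hz.
    - apply Cder_scal, HD, Hy. }
  assert (S2 : forall y, V y -> serre 2 (serre 0 f) y = / two_pi_i * (/ two_pi_i * f2 y) - / 6 * (/ two_pi_i * (E2 y * f1 y))).
  { intros y Hy. rewrite (serre_Cder 2 _ y _ (D0 y Hy)), S0 by exact Hy. field. exact HK. }
  assert (D2 : Cder (serre 2 (serre 0 f)) x (/ two_pi_i * (/ two_pi_i * f3 x) - / 6 * (/ two_pi_i * (C_derive E2 x * f1 x + E2 x * f2 x)))).
  { apply (Cder_ext_on V (fun y => / two_pi_i * (/ two_pi_i * f2 y) - / 6 * (/ two_pi_i * (E2 y * f1 y)))); try assumption.
    - intros z Hz. symmetry. apply S2, Hz.
    - apply Cder_minus; repeat apply Cder_scal; [apply HD, Hx|].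
      apply Cder_mult; [apply Cder_E2, HS, Hx|apply HD, Hx]. }
  unfold mlde. rewrite (serre_Cder 4 _ x _ D2), S2, S0 by exact Hx. field. exact HK.
Qed.

Lemma third_order_ode3 p2 p1 p0 T : third_order T (ode3 p2 p1 p0) (fun _ => 1) p2 p1 p0.
Proof.
  intros V f f1 f2 f3 HV _ HD x Hx.
  assert (E1 : forall y, V y -> C_derive f y = f1 y) by (intros y Hy; apply Cder_unique, HD, Hy).
  assert (D1 : forall y, V y -> Cder (C_derive f) y (f2 y)).
  { intros y Hy. apply (Cder_ext_on V f1); try assumption; [intros z Hz; symmetry; apply E1, Hz|apply HD, Hy]. }
  assert (D2 : forall y, V y -> Cder (C_derive (C_derive f)) y (f3 y)).
  { intros y Hy. apply (Cder_ext_on V f2); try assumption; [|apply HD, Hy].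
    intros z Hz. symmetry. apply Cder_unique, D1, Hz. }
  unfold ode3. rewrite (Cder_unique _ _ _ (D2 x Hx)), (Cder_unique _ _ _ (D1 x Hx)), (E1 x Hx). ring.
Qed.

(** * The hypergeometric operator in ordinary derivatives *)

Lemma theta_Cder c f w l : Cder f w l -> theta c f w = w * l + c * f w.
Proof. intros H. unfold theta. rewrite (Cder_unique _ _ _ H). reflexivity. Qed.

Lemma Cder_theta_ext V c f f1 f2 : Copen V -> (forall x, V x -> Cder f x (f1 x)) ->
  (forall x, V x -> Cder f1 x (f2 x)) ->
  forall x, V x -> Cder (theta c f) x (x * f2 x + f1 x + c * f1 x).
Proof.
  intros HV H1 H2 x Hx. apply (Cder_ext_on V (fun y => y * f1 y + c * f y)); try assumption.
  - intros y Hy. symmetry. apply theta_Cder, H1, Hy.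
  - apply Cder_eq with (1 * f1 x + x * f2 x + c * f1 x); [|ring].
    apply Cder_plus; [|apply Cder_scal, H1, Hx]. apply Cder_mult; [apply Cder_id|apply H2, Hx].
Qed.

Lemma theta3 V f f1 f2 f3 a b c x : Copen V -> derivatives3 V f f1 f2 f3 -> V x ->
  theta a (theta b (theta c f)) x = x ^ 3 * f3 x + (3 + a + b + c) * x ^ 2 * f2 x
    + (1 + a + b + c + a * b + b * c + c * a) * x * f1 x + a * b * c * f x.
Proof.
  intros HV HD Hx.
  assert (D1 : forall y, V y -> Cder (theta c f) y (y * f2 y + f1 y + c * f1 y)).
  { apply (Cder_theta_ext V); try assumption; intros y Hy; apply HD, Hy. }
  assert (D1' : forall y, V y -> Cder (fun y => y * f2 y + f1 y + c * f1 y) y (f2 y + y * f3 y + f2 y + c * f2 y)).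
  { intros y Hy. destruct (HD y Hy) as [h0 [h1 h2]].
    apply Cder_eq with (1 * f2 y + y * f3 y + f2 y + c * f2 y); [|ring].
    apply Cder_plus; [|apply Cder_scal; exact h1]. apply Cder_plus; [|exact h1].
    apply Cder_mult; [apply Cder_id|exact h2]. }
  pose proof (Cder_theta_ext V b (theta c f) _ _ HV D1 D1' x Hx) as D2. cbv beta in D2.
  rewrite (theta_Cder a _ x _ D2), (theta_Cder b _ x _ (D1 x Hx)), (theta_Cder c f x (f1 x)) by apply (HD x Hx).
  ring.
Qed.

(** The constants come from [theta3] with shifts [0, 1/3, 2/3]: [4 = 3 + 1/3 + 2/3] and
    [20/9 = 1 + 1/3 + 2/3 + 2/9]. *)
Lemma third_order_hyper_ode a0 a1 a2 T : third_order T (hyper_ode a0 a1 a2)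
  (fun w => w ^ 3 * (w - 1)) (fun w => (4 * w - (3 - a0 - a1 - a2)) * w ^ 2)
  (fun w => (20 / 9 * w - (1 - a0 - a1 - a2 + a0 * a1 + a1 * a2 + a2 * a0)) * w)
  (fun w => a0 * a1 * a2).
Proof.
  intros V f f1 f2 f3 HV _ HD x Hx. unfold hyper_ode.
  rewrite !(theta3 V f f1 f2 f3) by assumption. field.
Qed.

Ltac Cder_auto :=
  lazymatch goal with
  | |- Cder (fun y => y) _ _ => apply Cder_id
  | |- Cder E2 _ _ => apply Cder_E2; assumption
  | |- Cder E4 _ _ => apply Cder_E4; assumption
  | |- Cder E6 _ _ => apply Cder_E6; assumption
  | |- Cder (fun t => E2 t) _ _ => apply Cder_E2; assumption
  | |- Cder (fun t => E4 t) _ _ => apply Cder_E4; assumption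
  | |- Cder (fun t => E6 t) _ _ => apply Cder_E6; assumption
  | |- Cder (fun y => @?f y + @?g y) _ _ => apply (Cder_plus f g); Cder_auto
  | |- Cder (fun y => @?f y - @?g y) _ _ => apply (Cder_minus f g); Cder_auto
  | |- Cder (fun y => - @?f y) _ _ => apply (Cder_opp f); Cder_auto
  | |- Cder (fun y => @?f y / @?g y) _ _ => apply (Cder_div f g); [cbv beta|Cder_auto|Cder_auto]
  | |- Cder (fun y => @?f y * @?g y) _ _ => apply (Cder_mult f g); Cder_auto
  | |- Cder (fun y => @?f y ^ ?n) _ _ => apply (Cder_pow f); Cder_auto
  | |- Cder (fun y => ?c) _ _ => apply Cder_const
  end.

Lemma near_neq_0 (f : C -> C) x l : Cder f x l -> f x <> 0 -> near x (fun y => f y <> 0).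
Proof.
  intros H H0. pose proof (Cder_cont f x l H (Cmod (f x))) as Hc.
  assert (Hp : (0 < Cmod (f x))%R) by (apply Cmod_gt_0; exact H0).
  apply near_imp with (2 := Hc Hp). intros y Hy E. rewrite E in Hy.
  replace (0 - f x) with (- f x) in Hy by ring. rewrite Cmod_opp in Hy. lra.
Qed.

Lemma near_eisenstein_nonzero tau : non_elliptic tau ->
  near tau (fun t => E4 t <> 0 /\ E4 t ^ 3 - E6 t ^ 2 <> 0).
Proof.
  intros H. destruct (non_elliptic_nonzero tau H) as [HA [HB HD]].
  assert (HH : upper_half_plane tau) by apply H.
  apply near_and.
  - eapply near_neq_0; [apply Cder_E4; exact HH|exact HA].
  - eapply (near_neq_0 (fun t => E4 t ^ 3 - E6 t ^ 2)); [Cder_auto|exact HD].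
Qed.

(* [w_g = D w = w E6 / E4], [w_g2 = D_2 w_g = w E4 (5/6 - 4/3 w)] and
   [w_g3 = D_4 w_g2], with [w] replaced by [(E4^3 - E6^2) / E4^3]; similarly for
   [z], where [D z = - z E6 / E4]. *)
Definition w_g t := (E4 t ^ 3 - E6 t ^ 2) * E6 t / E4 t ^ 4.
Definition w_g2 t := (E4 t ^ 3 - E6 t ^ 2) / E4 t ^ 2 * (5 / 6 - 4 / 3 * ((E4 t ^ 3 - E6 t ^ 2) / E4 t ^ 3)).
Definition w_g3 t := E6 t * ((E4 t ^ 3 - E6 t ^ 2) / E4 t ^ 3) * (5 / 9 - 20 / 9 * ((E4 t ^ 3 - E6 t ^ 2) / E4 t ^ 3)).

Definition z_g t := - (E4 t ^ 2 * E6 t / (E4 t ^ 3 - E6 t ^ 2)).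
Definition z_g2 t := E4 t * (7 / 6 * (E4 t ^ 3 / (E4 t ^ 3 - E6 t ^ 2)) - 2 / 3).
Definition z_g3 t := E6 t * (2 / 9 - 14 / 9 * (E4 t ^ 3 / (E4 t ^ 3 - E6 t ^ 2))).

(* The derivatives in [tau] of a weight-zero [p] with [D p = g], [D_2 g = g2] and
   [D_4 g2 = g3]. *)
Definition d1_of (g : C -> C) t := two_pi_i * g t.
Definition d2_of (g g2 : C -> C) t := two_pi_i * (two_pi_i * (g2 t + E2 t * g t / 6)).
Definition d3_of (g g2 g3 : C -> C) t :=
  two_pi_i * (two_pi_i * (two_pi_i * (g3 t + E2 t * g2 t / 3) + (C_derive E2 t * g t + E2 t * (two_pi_i * (g2 t + E2 t * g t / 6))) / 6)).

Lemma derivatives3_weight_zero (S : C -> Prop) p g g2 g3 : (forall t, S t -> upper_half_plane t) ->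
  (forall t, S t -> Cder p t (two_pi_i * g t)) ->
  (forall t, S t -> Cder g t (two_pi_i * (g2 t + E2 t * g t / 6))) ->
  (forall t, S t -> Cder g2 t (two_pi_i * (g3 t + E2 t * g2 t / 3))) ->
  derivatives3 S p (d1_of g) (d2_of g g2) (d3_of g g2 g3).
Proof.
  intros HS H1 H2 H3 t Ht. unfold d1_of, d2_of, d3_of.
  split; [apply H1, Ht|]. split; [apply Cder_scal, H2, Ht|].
  apply Cder_scal, Cder_scal. apply Cder_plus; [apply H3, Ht|].
  apply Cder_ext_near with (fun t => / 6 * (E2 t * g t)).
  { exists 1%R. split; [lra|]. intros y _. field. }
  eapply Cder_eq; [apply Cder_scal, Cder_mult; [apply Cder_E2, HS, Ht|apply H2, Ht]|]. cbv beta. field.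
Qed.

Lemma derivatives3_wcoord : derivatives3 non_elliptic wcoord (d1_of w_g) (d2_of w_g w_g2) (d3_of w_g w_g2 w_g3).
Proof.
  apply derivatives3_weight_zero; [intros t Ht; apply Ht| | |];
    intros t Ht; destruct (non_elliptic_nonzero t Ht) as [HA [HB HD]];
    assert (HH : upper_half_plane t) by apply Ht.
  - apply Cder_ext_near with (fun t => (E4 t ^ 3 - E6 t ^ 2) / E4 t ^ 3).
    { apply near_imp with (2 := near_eisenstein_nonzero t Ht). intros y [Hy Hy'].
      symmetry. apply wcoord_eisenstein; assumption. }
    eapply Cder_eq; [Cder_auto; try (apply Cpow_nz; exact HA)|].
    unfold w_g. fold two_pi_i. cbn [pred INR]. rewrite !RtoC_plus. field. exact HA.
  - unfold w_g. eapply Cder_eq; [Cder_auto; try (apply Cpow_nz; exact HA)|].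
    unfold w_g2. fold two_pi_i. cbn [pred INR]. rewrite !RtoC_plus. field. exact HA.
  - unfold w_g2. eapply Cder_eq; [Cder_auto; try (apply Cpow_nz; exact HA); apply Cmod_gt_0; rewrite Cmod_R, Rabs_pos_eq; lra|].
    unfold w_g3. fold two_pi_i. cbn [pred INR]. rewrite !RtoC_plus. field. exact HA.
Qed.

Lemma derivatives3_zcoord : derivatives3 non_elliptic zcoord (d1_of z_g) (d2_of z_g z_g2) (d3_of z_g z_g2 z_g3).
Proof.
  apply derivatives3_weight_zero; [intros t Ht; apply Ht| | |];
    intros t Ht; destruct (non_elliptic_nonzero t Ht) as [HA [HB HD]];
    assert (HH : upper_half_plane t) by apply Ht.
  - apply Cder_ext_near with (fun t => E4 t ^ 3 / (E4 t ^ 3 - E6 t ^ 2)).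
    { apply near_imp with (2 := near_eisenstein_nonzero t Ht). intros y [Hy Hy'].
      symmetry. apply zcoord_eisenstein; assumption. }
    eapply Cder_eq; [Cder_auto; exact HD|].
    unfold z_g. fold two_pi_i. cbn [pred INR]. rewrite !RtoC_plus. field. exact HD.
  - unfold z_g. eapply Cder_eq; [Cder_auto; exact HD|].
    unfold z_g2. fold two_pi_i. cbn [pred INR]. rewrite !RtoC_plus. field. exact HD.
  - unfold z_g2. eapply Cder_eq; [Cder_auto; try exact HD; apply Cmod_gt_0; rewrite Cmod_R, Rabs_pos_eq; lra|].
    unfold z_g3. fold two_pi_i. cbn [pred INR]. rewrite !RtoC_plus. field. exact HD.
Qed.

Lemma d1_w_neq_0 t : non_elliptic t -> d1_of w_g t <> 0.
Proof.
  intros H. destruct (non_elliptic_nonzero t H) as [HA [HB HD]]. unfold d1_of, w_g, Cdiv.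
  apply Cmult_neq_0; [apply two_pi_i_neq_0|]. apply Cmult_neq_0; [apply Cmult_neq_0; assumption|].
  intros E. apply (Cpow_nz (E4 t) 4 HA). replace (E4 t ^ 4) with (E4 t ^ 4 * (E4 t ^ 4 * / E4 t ^ 4)).
  - rewrite E. ring.
  - field. exact HA.
Qed.

Lemma d1_z_neq_0 t : non_elliptic t -> d1_of z_g t <> 0.
Proof.
  intros H. destruct (non_elliptic_nonzero t H) as [HA [HB HD]]. unfold d1_of, z_g.
  apply Cmult_neq_0; [apply two_pi_i_neq_0|]. intros E.
  apply (Cmult_neq_0 (E4 t ^ 2) (E6 t)); [apply Cpow_nz; exact HA|exact HB|].
  replace (E4 t ^ 2 * E6 t) with (- (E4 t ^ 3 - E6 t ^ 2) * - (E4 t ^ 2 * E6 t / (E4 t ^ 3 - E6 t ^ 2))) by (field; exact HD).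
  rewrite E. ring.
Qed.

Lemma third_order_subset (S S' : C -> Prop) L a3 a2 a1 a0 : (forall x, S' x -> S x) ->
  third_order S L a3 a2 a1 a0 -> third_order S' L a3 a2 a1 a0.
Proof. intros HS H V f f1 f2 f3 HV HVS. apply H; [exact HV|]. intros x Hx. apply HS, HVS, Hx. Qed.

(** * Comparison of coefficients in the two coordinates *)

Section Exponents.

Context (mu1 mu2 alpha0 alpha1 alpha2 : C).
Context (Hsum : alpha0 + alpha1 + alpha2 = 1 / 2).
Context (Hmu1 : mu1 = alpha0 * alpha1 + alpha1 * alpha2 + alpha0 * alpha2 - 1 / 18).
Context (Hmu2 : mu2 = - (alpha0 * alpha1 * alpha2)).

Lemma w_coefficients t : non_elliptic t ->
  let b3 := fun w => w ^ 3 * (w - 1) in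
  let b2 := fun w => (4 * w - (3 - alpha0 - alpha1 - alpha2)) * w ^ 2 in
  let b1 := fun w => (20 / 9 * w - (1 - alpha0 - alpha1 - alpha2 + alpha0 * alpha1 + alpha1 * alpha2 + alpha2 * alpha0)) * w in
  let b0 := fun w : C => alpha0 * alpha1 * alpha2 in
  let p1 := d1_of w_g in let p2 := d2_of w_g w_g2 in let p3 := d3_of w_g w_g2 w_g3 in
  let k := fun t => - E6 t in
  / two_pi_i ^ 3 * p1 t ^ 3 = k t * b3 (wcoord t) /\
  3 * (/ two_pi_i ^ 3 * (p1 t * p2 t)) + - (E2 t / 2) / two_pi_i ^ 2 * p1 t ^ 2 = k t * b2 (wcoord t) /\
  / two_pi_i ^ 3 * p3 t + - (E2 t / 2) / two_pi_i ^ 2 * p2 t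
    + (- (C_derive E2 t / 6) / two_pi_i ^ 2 + E2 t ^ 2 / 18 / two_pi_i + mu1 * E4 t / two_pi_i) * p1 t = k t * b1 (wcoord t) /\
  mu2 * E6 t = k t * b0 (wcoord t).
Proof.
  intros Ht. destruct (non_elliptic_nonzero t Ht) as [HA [HB HD]]. pose proof two_pi_i_neq_0 as HK. cbv zeta.
  rewrite (wcoord_eisenstein t HA HD).
  (* The second symmetric function of the exponents becomes [mu1 + 1/18]. Once [alpha2] is
     eliminated too, rational identities in free variables are left for the first three
     coefficients. *)
  replace (alpha1 * alpha2) with (mu1 + 1 / 18 - alpha0 * alpha1 - alpha2 * alpha0) by (rewrite Hmu1; ring).
  replace alpha2 with (1 / 2 - alpha0 - alpha1) by (rewrite <- Hsum; ring).
  unfold d1_of, d2_of, d3_of, w_g, w_g2, w_g3.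
  split; [|split; [|split]]; try (field; repeat split; assumption).
  rewrite Hmu2. replace (alpha0 * alpha1 * alpha2) with (alpha0 * alpha1 * (1 / 2 - alpha0 - alpha1)); [ring|].
  rewrite <- Hsum. ring.
Qed.

Lemma z_coefficients t : non_elliptic t ->
  let p1 := d1_of z_g in let p2 := d2_of z_g z_g2 in let p3 := d3_of z_g z_g2 z_g3 in
  let k := fun t => z_g t ^ 3 in
  / two_pi_i ^ 3 * p1 t ^ 3 = k t * 1 /\
  3 * (/ two_pi_i ^ 3 * (p1 t * p2 t)) + - (E2 t / 2) / two_pi_i ^ 2 * p1 t ^ 2 = k t * zp2 (zcoord t) /\
  / two_pi_i ^ 3 * p3 t + - (E2 t / 2) / two_pi_i ^ 2 * p2 t
    + (- (C_derive E2 t / 6) / two_pi_i ^ 2 + E2 t ^ 2 / 18 / two_pi_i + mu1 * E4 t / two_pi_i) * p1 t = k t * zp1 mu1 (zcoord t) /\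
  mu2 * E6 t = k t * zp0 mu2 (zcoord t).
Proof.
  intros Ht. destruct (non_elliptic_nonzero t Ht) as [HA [HB HD]]. pose proof two_pi_i_neq_0 as HK. cbv zeta.
  unfold zp2, zp1, zp0. rewrite (zcoord_eisenstein t HD).
  unfold d1_of, d2_of, d3_of, z_g, z_g2, z_g3.
  assert (HB' : E4 t ^ 3 - (E4 t ^ 3 - E6 t ^ 2) <> 0).
  { replace (E4 t ^ 3 - (E4 t ^ 3 - E6 t ^ 2)) with (E6 t ^ 2) by ring. apply Cpow_nz, HB. }
  split; [|split; [|split]]; try (field; repeat split; assumption).
Qed.

Lemma reads_in_zcoord : reads_in_coordinate non_elliptic zcoord (mlde mu1 mu2) (mlde_z mu1 mu2).
Proof.
  refine (reads_in_coordinate_of_coefficients _ _ _ _ _ derivatives3_zcoord d1_z_neq_0 _ _ _ _ _ _ _ _ _ _ _ (fun _ => True)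
    (third_order_subset _ _ _ _ _ _ _ (fun x Hx => proj1 Hx) (third_order_mlde mu1 mu2))
    (third_order_ode3 zp2 (zp1 mu1) (zp0 mu2) _) _ z_coefficients (fun _ => I)).
  intros t Ht E. apply (d1_z_neq_0 t Ht). unfold d1_of.
  destruct (Req_dec (Cmod (z_g t)) 0) as [E0|E0].
  - rewrite (Cmod_eq_0 _ E0). ring.
  - exfalso. apply (Cpow_nz (z_g t) 3); [|exact E]. intros E1. rewrite E1, Cmod_0 in E0. lra.
Qed.

Lemma E6_opp_neq_0 t : non_elliptic t -> - E6 t <> 0.
Proof.
  intros Ht E. apply (proj1 (proj2 (non_elliptic_nonzero t Ht))). replace (E6 t) with (- - E6 t) by ring. rewrite E. ring.
Qed.

Lemma reads_in_wcoord : reads_in_coordinate non_elliptic wcoord (mlde mu1 mu2) (hyper_ode alpha0 alpha1 alpha2).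
Proof.
  exact (reads_in_coordinate_of_coefficients _ _ _ _ _ derivatives3_wcoord d1_w_neq_0 _ _ _ _ _ _ _ _ _ _ _ (fun _ => True)
    (third_order_subset _ _ _ _ _ _ _ (fun x Hx => proj1 Hx) (third_order_mlde mu1 mu2))
    (third_order_hyper_ode alpha0 alpha1 alpha2 _) E6_opp_neq_0 w_coefficients (fun _ => I)).
Qed.

End Exponents.

(** * The local exponents at w = 0 *)

(** The limits in [exponents_at_w0] are only asserted to exist; here they are identified through a
    continuous extension [g], by evaluating both at one small positive real point. *)
Lemma C_limit_unique (f g : C -> C) (c l : C) :
  filterlim f (locally' (0 : C)) (locally c) -> Ccont g 0 -> g 0 = l ->
  (forall w : C, w <> 0 -> (Cmod w < 1)%R -> f w = g w) -> c = l.
Proof.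
  intros Hf Hg <- E.
  apply Ceq_minus, Cmod_eq_0. apply Rle_antisym; [|apply Cmod_ge_0]. apply le_epsilon. intros eps He.
  assert (Hn : @locally C_UniformSpace c (fun y => (Cmod (y - c) < eps / 2)%R)).
  { apply near_locally. exists (eps / 2)%R. split; [lra|]. intros y Hy. exact Hy. }
  pose proof (Hf _ Hn) as Hf'. unfold filtermap, locally', within in Hf'.
  apply (proj2 (near_locally 0 _)) in Hf'.
  destruct (near_and _ _ _ Hf' (Hg (eps / 2)%R ltac:(lra))) as [d [Hd H]].
  set (r := (Rmin d 1 / 2)%R).
  assert (Hr : (0 < r < d /\ r < 1)%R).
  { pose proof (Rmin_l d 1). pose proof (Rmin_r d 1). assert (0 < Rmin d 1)%R by (apply Rmin_pos; lra). unfold r. lra. }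
  assert (Er : Cmod (RtoC r) = r) by (rewrite Cmod_R, Rabs_pos_eq; lra).
  assert (Hr0 : RtoC r <> 0) by (apply Cmod_gt_0; lra).
  destruct (H (RtoC r)) as [H1 H2]; [replace (r - 0) with (RtoC r) by ring; lra|].
  specialize (H1 Hr0). rewrite (E r Hr0 ltac:(lra)) in H1.
  replace (c - g 0) with ((g r - g 0) - (g r - c)) by ring. unfold Cminus at 1.
  eapply Rle_trans; [apply Cmod_triangle|]. rewrite Cmod_opp. lra.
Qed.

Lemma one_minus_neq_0 (w : C) : (Cmod w < 1)%R -> 1 - w <> 0.
Proof.
  intros H. apply Cmod_gt_0. pose proof (Cmod_triangle_rev 1 w) as T. rewrite Cmod_1 in T. lra.
Qed.

Lemma exponents_relations mu1 mu2 a0 a1 a2 : exponents_at_w0 zp2 (zp1 mu1) (zp0 mu2) a0 a1 a2 ->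
  a0 + a1 + a2 = 1 / 2 /\ mu1 = a0 * a1 + a1 * a2 + a0 * a2 - 1 / 18 /\ mu2 = - (a0 * a1 * a2).
Proof.
  intros [c2 [c1 [c0 [H2 [H1 [H0 Hp]]]]]].
  assert (N1 : 1 - 0 <> 0) by (apply one_minus_neq_0; rewrite Cmod_0; lra).
  assert (N2 : forall x : R, (0 < x)%R -> RtoC x <> 0).
  { intros x Hx. apply Cmod_gt_0. rewrite Cmod_R, Rabs_pos_eq; lra. }
  assert (M : forall w : C, (Cmod w < 1)%R -> 1 - w <> 0) by apply one_minus_neq_0.
  assert (E2 : c2 = 7 / 2).
  { apply (C_limit_unique _ (fun w => 2 + 3 / (2 * (1 - w))) _ _ H2).
    - eapply Cder_cont. Cder_auto. apply Cmult_neq_0; [apply N2; lra|exact N1].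
    - field.
    - intros w Hw Hw1. unfold zp2. specialize (M w Hw1). field. split; assumption. }
  assert (E1 : c1 = 14 / 9 + mu1).
  { apply (C_limit_unique _ (fun w => 2 / 9 + (4 / 3 + mu1) / (1 - w)) _ _ H1).
    - eapply Cder_cont. Cder_auto; try (apply N2; lra). exact N1.
    - field.
    - intros w Hw Hw1. unfold zp1. specialize (M w Hw1). field. split; assumption. }
  assert (E0 : c0 = - mu2).
  { apply (C_limit_unique _ (fun w => - (mu2 / (1 - w))) _ _ H0).
    - eapply Cder_cont. Cder_auto. exact N1.
    - field.
    - intros w Hw Hw1. unfold zp0. specialize (M w Hw1). field. split; assumption. }
  subst c2 c1 c0.
  (* Both sides are monic cubics in [r], so three values determine the coefficients: 0 gives the
     product of the exponents, and the sum and difference of the values at 1 and -1 give the other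
     two symmetric functions. *)
  pose proof (Hp 0) as P0. pose proof (Hp 1) as P1. pose proof (Hp (- (1))) as P2.
  assert (F2 : mu2 = - (a0 * a1 * a2)).
  { replace mu2 with (0 * (0 + 1) * (0 + 2) - 7 / 2 * (0 * (0 + 1)) + (14 / 9 + mu1) * 0 - - mu2) by ring.
    rewrite P0. ring. }
  assert (F0 : a0 + a1 + a2 = 1 / 2).
  { replace (a0 + a1 + a2) with (- (((1 - a0) * (1 - a1) * (1 - a2) + (- (1) - a0) * (- (1) - a1) * (- (1) - a2)) / 2
      + a0 * a1 * a2)) by field.
    rewrite <- P1, <- P2, F2. field. }
  split; [exact F0|]. split; [|exact F2].
  replace (a0 * a1 + a1 * a2 + a0 * a2) with
    (((1 - a0) * (1 - a1) * (1 - a2) - (- (1) - a0) * (- (1) - a1) * (- (1) - a2)) / 2 - 1) by field.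
  rewrite <- P1, <- P2. field.
Qed.

(** * The hypergeometric solutions *)

Lemma non_integer_plus_nat (a : C) n : non_integer a -> a + 1 + INR n <> 0.
Proof.
  intros H E. apply (H (- (1 + Z.of_nat n))%Z). rewrite opp_IZR, plus_IZR, <- INR_IZR_INZ.
  rewrite RtoC_opp, RtoC_plus. replace a with (a + 1 + INR n - (1 + INR n)) by ring. rewrite E. ring.
Qed.

Lemma non_integer_neq_0 (a b : C) : non_integer (a - b) -> a - b <> 0.
Proof. intros H. exact (H 0%Z). Qed.

Lemma non_integer_opp (a b : C) : non_integer (a - b) -> non_integer (b - a).
Proof.
  intros H k E. apply (H (- k)%Z). rewrite opp_IZR, RtoC_opp, <- E. ring.
Qed.

(** Here [b] and [c] are the other two exponents themselves; the lower parameters are [1 + a - b]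
    and [1 + a - c]. *)
Definition G_coef (a b c : C) (n : nat) : C :=
  pochhammer a n * pochhammer (a + 1 / 3) n * pochhammer (a + 2 / 3) n
  / (pochhammer (a - (b - 1)) n * pochhammer (a - (c - 1)) n) / INR (fact n).

Lemma G_PS l a b c w : G l a (b - 1) (c - 1) w = Cexp (a * l) * PS (G_coef a b c) w.
Proof.
  unfold G, F32, PS. f_equal. apply CSeries_ext. intros n. unfold G_coef, Cdiv. ring.
Qed.

Section Frobenius.

Context (a b c : C) (Hab : non_integer (a - b)) (Hac : non_integer (a - c)).

Lemma pochhammer_neq_0 (x : C) n : non_integer (a - x) -> pochhammer (a - (x - 1)) n <> 0.
Proof.
  intros H. induction n; cbn [pochhammer]; [apply C1_nz|]. apply Cmult_neq_0; [exact IHn|].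
  replace (a - (x - 1) + INR n) with (a - x + 1 + INR n) by ring. apply non_integer_plus_nat, H.
Qed.

Lemma INR_fact_C n : RtoC (INR (fact n)) <> 0.
Proof. apply Cmod_gt_0. rewrite Cmod_R. apply Rabs_pos_lt, INR_fact_neq_0. Qed.

Lemma G_coef_0 : G_coef a b c 0 = 1.
Proof. unfold G_coef. simpl. field. Qed.

(** The Frobenius recurrence: the left factor is [(x - a) (x - b) (x - c)] at [x = n + 1 + a], the
    right one [x (x + 1/3) (x + 2/3)] at [x = n + a]. *)
Lemma G_coef_S n :
  G_coef a b c (S n) * ((INR n + 1) * (INR n + 1 + a - b) * (INR n + 1 + a - c))
  = G_coef a b c n * ((INR n + a) * (INR n + a + 1 / 3) * (INR n + a + 2 / 3)).
Proof.
  unfold G_coef. cbn [pochhammer].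
  pose proof (pochhammer_neq_0 b n Hab). pose proof (pochhammer_neq_0 c n Hac).
  pose proof (non_integer_plus_nat _ n Hab) as N1. pose proof (non_integer_plus_nat _ n Hac) as N2.
  pose proof (INR_fact_C n). 
  assert (N3 : RtoC (INR n) + 1 <> 0).
  { change (natC n + 1 <> 0). rewrite <- natC_S. apply Cmod_gt_0. rewrite Cmod_natC. apply lt_0_INR. lia. }
  rewrite fact_simpl, mult_INR, RtoC_mult, S_INR, RtoC_plus.
  replace (a - (b - 1) + INR n) with (a - b + 1 + INR n) by ring.
  replace (a - (c - 1) + INR n) with (a - c + 1 + INR n) by ring.
  field. repeat split; try assumption.
Qed.

Lemma unit_radius_G_coef : unit_radius (G_coef a b c).
Proof.
  apply unit_radius_ratio. intros r Hr.
  (* A substitute for the cube root of [r]: by the inequality of means for [1, 1, r], [r <= s^3].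
     Each of the three factors of the ratio then takes one [s], because [s (n + M) <= n - M] for
     large [n]. *)
  set (s := ((2 + r) / 3)%R). assert (Hs : (0 < s < 1)%R) by (unfold s; lra).
  assert (Hrs : (r <= s ^ 3)%R).
  { apply Rminus_le_0. replace (s ^ 3 - r)%R with ((1 - r) ^ 2 * (8 + r) / 27)%R by (unfold s; field).
    apply Rdiv_le_0_compat; [|lra]. apply Rmult_le_pos; [apply pow2_ge_0|lra]. }
  set (M := (Cmod a + Cmod b + Cmod c + 2)%R).
  pose proof (Cmod_ge_0 a). pose proof (Cmod_ge_0 b). pose proof (Cmod_ge_0 c).
  destruct (INR_unbounded (2 * M / (1 - s))) as [N HN]. exists (S N). intros n Hn.
  assert (HnM : (2 * M < INR n * (1 - s))%R).
  { assert (INR N < INR n)%R by (apply lt_INR; lia).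
    assert (2 * M / (1 - s) < INR n)%R by lra. apply Rlt_div_l in H3; lra. }
  assert (HM : (2 <= M)%R) by (unfold M; lra).
  pose proof (f_equal Cmod (G_coef_S n)) as E. rewrite !Cmod_mult in E.
  assert (U : forall x : C, (Cmod x <= M)%R -> (Cmod (INR n + x) <= INR n + M)%R).
  { intros x Hx. eapply Rle_trans; [apply Cmod_triangle|]. rewrite Cmod_R, Rabs_pos_eq by apply pos_INR. lra. }
  assert (Lw : forall x : C, (Cmod x <= M)%R -> (INR n - M <= Cmod (INR n + x))%R).
  { intros x Hx. pose proof (Cmod_triangle_rev (RtoC (INR n)) (- x)) as T.
    rewrite Cmod_opp, Cmod_R, Rabs_pos_eq in T by apply pos_INR.
    replace (INR n - - x) with (INR n + x) in T by ring. lra. }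
  assert (Q : forall x : R, (0 <= x <= 1)%R -> (Cmod (a + x) <= M)%R).
  { intros x Hx. eapply Rle_trans; [apply Cmod_triangle|]. rewrite Cmod_R, Rabs_pos_eq by lra. unfold M. lra. }
  assert (Q' : forall y, (Cmod y <= Cmod b + Cmod c)%R -> (Cmod (1 + a - y) <= M)%R).
  { intros y Hy. unfold Cminus. eapply Rle_trans; [apply Cmod_triangle|]. rewrite Cmod_opp.
    eapply Rle_trans; [apply Rplus_le_compat_r, Cmod_triangle|]. rewrite Cmod_1. unfold M. lra. }
  assert (A0 : (Cmod (INR n + a) <= INR n + M)%R) by (apply U; unfold M; lra).
  assert (A1 : (Cmod (INR n + a + 1 / 3) <= INR n + M)%R).
  { rewrite <- Cplus_assoc. apply U. rewrite <- RtoC_div by lra. apply Q. lra. }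
  assert (A2 : (Cmod (INR n + a + 2 / 3) <= INR n + M)%R).
  { rewrite <- Cplus_assoc. apply U. rewrite <- RtoC_div by lra. apply Q. lra. }
  assert (B0 : (INR n - M <= Cmod (INR n + 1))%R) by (apply Lw; rewrite Cmod_1; lra).
  assert (B1 : (INR n - M <= Cmod (INR n + 1 + a - b))%R).
  { replace (INR n + 1 + a - b) with (INR n + (1 + a - b)) by ring. apply Lw, Q'. lra. }
  assert (B2 : (INR n - M <= Cmod (INR n + 1 + a - c))%R).
  { replace (INR n + 1 + a - c) with (INR n + (1 + a - c)) by ring. apply Lw, Q'. lra. }
  set (x0 := Cmod (INR n + a)) in *. set (x1 := Cmod (INR n + a + 1 / 3)) in *. set (x2 := Cmod (INR n + a + 2 / 3)) in *.
  set (z0 := Cmod (INR n + 1)) in *. set (z1 := Cmod (INR n + 1 + a - b)) in *. set (z2 := Cmod (INR n + 1 + a - c)) in *.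
  assert (HsM : (s * (INR n + M) <= INR n - M)%R) by nra.
  assert (P0 : (0 < INR n - M)%R) by nra.
  assert (Y0 : (0 <= x0)%R) by apply Cmod_ge_0. assert (Y1 : (0 <= x1)%R) by apply Cmod_ge_0. assert (Y2 : (0 <= x2)%R) by apply Cmod_ge_0.
  assert (F : (r * (x0 * x1 * x2) <= z0 * z1 * z2)%R).
  { apply Rle_trans with ((s * x0) * (s * x1) * (s * x2))%R.
    - replace ((s * x0) * (s * x1) * (s * x2))%R with (s ^ 3 * (x0 * x1 * x2))%R by ring.
      apply Rmult_le_compat_r; [repeat apply Rmult_le_pos; assumption|exact Hrs].
    - assert (W : forall x z, (0 <= x -> x <= INR n + M -> INR n - M <= z -> 0 <= s * x <= z)%R) by (intros; split; nra).
      destruct (W x0 z0 Y0 A0 B0). destruct (W x1 z1 Y1 A1 B1). destruct (W x2 z2 Y2 A2 B2).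
      repeat apply Rmult_le_compat; try assumption. apply Rmult_le_pos; assumption. }
  assert (Z : (0 < z0 * z1 * z2)%R) by (repeat apply Rmult_lt_0_compat; lra).
  apply Rmult_le_reg_r with (z0 * z1 * z2)%R; [exact Z|].
  replace (Cmod (G_coef a b c (S n)) * r * (z0 * z1 * z2))%R with (r * (Cmod (G_coef a b c (S n)) * (z0 * z1 * z2)))%R by ring.
  rewrite E. pose proof (Cmod_ge_0 (G_coef a b c n)).
  replace (r * (Cmod (G_coef a b c n) * (x0 * x1 * x2)))%R with (Cmod (G_coef a b c n) * (r * (x0 * x1 * x2)))%R by ring.
  apply Rmult_le_compat_l; assumption.
Qed.

(* [w^a G_theta k w] is [D^k] applied to [w^a] times the hypergeometric series. *)
Definition G_theta (k : nat) (w : C) : C := PS (fun n => (INR n + a) ^ k * G_coef a b c n) w.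

Lemma unit_radius_G_theta k : unit_radius (fun n => (INR n + a) ^ k * G_coef a b c n).
Proof.
  induction k.
  - apply unit_radius_ext with (G_coef a b c); [intros n; simpl; ring|apply unit_radius_G_coef].
  - apply unit_radius_ext with (fun n => (INR n + a) * ((INR n + a) ^ k * G_coef a b c n)); [intros n; simpl; ring|].
    apply unit_radius_INR_plus, IHk.
Qed.

(** [D (w^a g) = w^a (D + a) g]. The relation is left multiplied by [w], so it makes sense at the
    centre of the disc. *)
Lemma Cder_G_theta k w : (Cmod w < 1)%R -> exists l, Cder (G_theta k) w l /\
  w * l = G_theta (S k) w - a * G_theta k w.
Proof.
  intros Hw. exists (PS (dcoef (fun n => (INR n + a) ^ k * G_coef a b c n)) w). split.
  - apply Cder_PS; [apply unit_radius_G_theta|exact Hw].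
  - rewrite PS_theta by (apply unit_radius_G_theta || exact Hw).
    unfold G_theta. replace (PS (fun n => (INR n + a) ^ S k * G_coef a b c n) w) with
      (PS (fun n => INR n * ((INR n + a) ^ k * G_coef a b c n)) w + PS (fun n => a * ((INR n + a) ^ k * G_coef a b c n)) w).
    + rewrite PS_scal by (apply unit_radius_G_theta || exact Hw). ring.
    + rewrite <- PS_plus; [|apply unit_radius_INR, unit_radius_G_theta|apply unit_radius_scal, unit_radius_G_theta|exact Hw].
      apply PS_ext. intros n. simpl. ring.
Qed.

Lemma G_theta_0 k : G_theta k 0 = a ^ k.
Proof. unfold G_theta. rewrite PS_at_0, G_coef_0. simpl INR. replace (0 + a) with a by ring. ring. Qed.

(** The equation with [w^a] divided out, where [D (D + 1/3) (D + 2/3) = D^3 + D^2 + 2/9 D]. The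
    coefficient of [w^(n+1)] is [G_coef_S]; the constant one vanishes because [a] is a root of the
    indicial polynomial. *)
Lemma G_theta_ode w : (Cmod w < 1)%R ->
  w * (G_theta 3 w + G_theta 2 w + 2 / 9 * G_theta 1 w)
  = G_theta 3 w - (a + b + c) * G_theta 2 w + (a * b + b * c + c * a) * G_theta 1 w - a * b * c * G_theta 0 w.
Proof.
  intros Hw. pose proof unit_radius_G_theta as U.
  replace (G_theta 3 w + G_theta 2 w + 2 / 9 * G_theta 1 w) with
    (PS (fun n => (INR n + a) ^ 3 * G_coef a b c n + (INR n + a) ^ 2 * G_coef a b c n
       + 2 / 9 * ((INR n + a) ^ 1 * G_coef a b c n)) w).
  2:{ rewrite !PS_plus, PS_scal; try assumption; try reflexivity;
      repeat (apply unit_radius_plus || apply unit_radius_scal || apply U). }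
  rewrite <- PS_shift; [|repeat (apply unit_radius_plus || apply unit_radius_scal || apply U)|exact Hw].
  transitivity (PS (fun n => (INR n + a) ^ 3 * G_coef a b c n + (- (a + b + c)) * ((INR n + a) ^ 2 * G_coef a b c n)
       + (a * b + b * c + c * a) * ((INR n + a) ^ 1 * G_coef a b c n) + (- (a * b * c)) * ((INR n + a) ^ 0 * G_coef a b c n)) w).
  - apply PS_ext. intros [|n]; cbn [shift].
    + simpl. ring.
    + pose proof (G_coef_S n) as E. rewrite S_INR, RtoC_plus.
      transitivity (G_coef a b c n * ((INR n + a) * (INR n + a + 1 / 3) * (INR n + a + 2 / 3))); [field|].
      rewrite <- E. ring.
  - rewrite !PS_plus, !PS_scal; try assumption; try (unfold G_theta; ring);
      repeat (apply unit_radius_plus || apply unit_radius_scal || apply U).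
Qed.

Context (U : C -> Prop) (l : C -> C) (HU : Copen U).
Context (Hdisc : forall w, U w -> w <> 0 /\ (Cmod w < 1)%R).
Context (Hl : forall w, U w -> Cder l w (/ w)).

Definition G_branch (k : nat) (w : C) : C := Cexp (a * l w) * G_theta k w.

Lemma Cder_G_branch k w : U w -> Cder (G_branch k) w (G_branch (S k) w / w).
Proof.
  intros Hw. destruct (Hdisc w Hw) as [Hw0 Hw1]. destruct (Cder_G_theta k w Hw1) as [d [Hd E]].
  apply Cder_eq with ((Cexp (a * l w) * (a * / w)) * G_theta k w + Cexp (a * l w) * d).
  - apply (Cder_mult (fun w => Cexp (a * l w))); [|exact Hd].
    apply (Cder_comp Cexp (fun w => a * l w)); [apply Cder_Cexp|]. apply Cder_scal, Hl, Hw.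
  - unfold G_branch. replace (G_theta (S k) w) with (w * d + a * G_theta k w) by (rewrite E; ring).
    field. exact Hw0.
Qed.

Definition G_d1 w := G_branch 1 w / w.
Definition G_d2 w := (G_branch 2 w - G_branch 1 w) / w ^ 2.
Definition G_d3 w := (G_branch 3 w - 3 * G_branch 2 w + 2 * G_branch 1 w) / w ^ 3.

Lemma derivatives3_G_branch : derivatives3 U (G_branch 0) G_d1 G_d2 G_d3.
Proof.
  intros w Hw. destruct (Hdisc w Hw) as [Hw0 Hw1].
  pose proof (Cder_G_branch 0 w Hw) as D0. pose proof (Cder_G_branch 1 w Hw) as D1. pose proof (Cder_G_branch 2 w Hw) as D2.
  split; [exact D0|split].
  - eapply Cder_eq; [apply (Cder_div (G_branch 1) (fun w => w)); [exact Hw0|exact D1|apply Cder_id]|].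
    unfold G_d2. field. exact Hw0.
  - eapply Cder_eq; [apply (Cder_div (fun w => G_branch 2 w - G_branch 1 w) (fun w => w ^ 2));
      [apply Cpow_nz; exact Hw0|apply Cder_minus; eassumption|apply Cder_pow, Cder_id]|].
    unfold G_d3. cbn [pred INR]. rewrite RtoC_plus. field. exact Hw0.
Qed.

Lemma G_branch_solves : solves (hyper_ode a b c) U (G_branch 0).
Proof.
  apply (proj2 (solves_iff_derivatives3 (fun _ => True) _ _ _ _ _ U _ _ _ _ (third_order_hyper_ode a b c _) HU (fun _ _ => I) derivatives3_G_branch)).
  intros w Hw. destruct (Hdisc w Hw) as [Hw0 Hw1]. pose proof (G_theta_ode w Hw1) as E.
  unfold G_d1, G_d2, G_d3, G_branch.
  transitivity (Cexp (a * l w) * (w * (G_theta 3 w + G_theta 2 w + 2 / 9 * G_theta 1 w)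
     - (G_theta 3 w - (a + b + c) * G_theta 2 w + (a * b + b * c + c * a) * G_theta 1 w - a * b * c * G_theta 0 w))).
  - field. exact Hw0.
  - rewrite E. ring.
Qed.

End Frobenius.

(** * The Wronskian and the local basis *)

Lemma continuous_Ccont f x : @continuous C_UniformSpace C_UniformSpace f x -> Ccont f x.
Proof.
  intros H eps He. apply near_locally. apply (H (fun y => (Cmod (y - f x) < eps)%R)).
  apply near_locally. exists eps. split; [exact He|]. intros y Hy. exact Hy.
Qed.

(** A branch of the logarithm is only assumed continuous. Being a right inverse of a function with
    nonzero derivative makes it differentiable: the expansion of [p] at [q y] first bounds
    [q z - q y] by a multiple of [z - y], and then gives the derivative. *)
Lemma Cder_right_inverse (p q : C -> C) (y m : C) : Ccont q y -> near y (fun z => p (q z) = z) ->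
  Cder p (q y) m -> m <> 0 -> Cder q y (/ m).
Proof.
  intros Hc Hpq HD Hm. apply Cder_eps. intros eps He.
  assert (Hm' : (0 < Cmod m)%R) by (apply Cmod_gt_0; exact Hm).
  set (eta := Rmin (Cmod m / 2) (eps * Cmod m * Cmod m / 2)).
  assert (Heta : (0 < eta)%R).
  { apply Rmin_pos; [lra|]. assert (0 < eps * Cmod m * Cmod m)%R by (repeat apply Rmult_lt_0_compat; lra). lra. }
  assert (He1 : (eta <= Cmod m / 2)%R) by apply Rmin_l.
  assert (He2 : (eta <= eps * Cmod m * Cmod m / 2)%R) by apply Rmin_r.
  apply Cder_eps with (eps := eta) in HD; [|exact Heta].
  pose proof (near_self _ _ Hpq) as Ey. cbv beta in Ey.
  apply near_imp with (2 := near_and _ _ _ Hpq (Ccont_near q y _ Hc HD)).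
  intros z [Ez H]. rewrite Ez, Ey in H.
  set (d := q z - q y) in *.
  pose proof (Cmod_triangle (- (z - y - m * d)) (z - y)) as T.
  replace (- (z - y - m * d) + (z - y)) with (m * d) in T by ring.
  rewrite Cmod_opp, Cmod_mult in T.
  pose proof (Cmod_ge_0 d).
  assert (T' : (Cmod m / 2 * Cmod d <= Cmod (z - y))%R) by nra.
  replace (d - / m * (z - y)) with (- (z - y - m * d) / m) by (field; exact Hm).
  rewrite Cmod_div, Cmod_opp by exact Hm. apply Rle_div_l; [exact Hm'|].
  eapply Rle_trans; [exact H|].
  apply Rle_trans with (eps * Cmod m * (Cmod m / 2 * Cmod d))%R.
  - replace (eps * Cmod m * (Cmod m / 2 * Cmod d))%R with (eps * Cmod m * Cmod m / 2 * Cmod d)%R by field.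
    apply Rmult_le_compat_r; assumption.
  - assert (0 < eps * Cmod m)%R by nra. nra.
Qed.

Definition log_on (U : C -> Prop) (l : C -> C) : Prop :=
  forall w, U w -> Ccont l w /\ Cexp (l w) = w / 1728.

Lemma RtoC_pos_neq_0 (x : R) : (0 < x)%R -> RtoC x <> 0.
Proof. intros H. apply Cmod_gt_0. rewrite Cmod_R, Rabs_pos_eq; lra. Qed.

Lemma Cder_log U l : Copen U -> (forall w, U w -> w <> 0) -> log_on U l -> forall w, U w -> Cder l w (/ w).
Proof.
  intros HU H0 Hl w Hw. destruct (Hl w Hw) as [Hc E].
  assert (N : RtoC 1728 <> 0) by (apply RtoC_pos_neq_0; lra).
  apply (Cder_right_inverse (fun x => 1728 * Cexp x)).
  - exact Hc.
  - apply near_imp with (2 := proj1 (Copen_near U) HU w Hw). intros z Hz.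
    rewrite (proj2 (Hl z Hz)). field.
  - apply Cder_eq with (1728 * Cexp (l w)); [apply Cder_scal, Cder_Cexp|]. rewrite E. field.
  - apply H0, Hw.
Qed.

Definition det_3 (x0 x1 x2 y0 y1 y2 z0 z1 z2 : C) : C :=
  x0 * (y1 * z2 - y2 * z1) - x1 * (y0 * z2 - y2 * z0) + x2 * (y0 * z1 - y1 * z0).

Lemma det_3_solve x0 x1 x2 y0 y1 y2 z0 z1 z2 u v w : det_3 x0 x1 x2 y0 y1 y2 z0 z1 z2 <> 0 ->
  exists c0 c1 c2, c0 * x0 + c1 * x1 + c2 * x2 = u /\ c0 * y0 + c1 * y1 + c2 * y2 = v /\
    c0 * z0 + c1 * z1 + c2 * z2 = w.
Proof.
  intros H. pose proof H as H'. unfold det_3 in H'.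
  exists (det_3 u x1 x2 v y1 y2 w z1 z2 / det_3 x0 x1 x2 y0 y1 y2 z0 z1 z2),
    (det_3 x0 u x2 y0 v y2 z0 w z2 / det_3 x0 x1 x2 y0 y1 y2 z0 z1 z2),
    (det_3 x0 x1 u y0 y1 v z0 z1 w / det_3 x0 x1 x2 y0 y1 y2 z0 z1 z2).
  unfold det_3. split; [|split]; field; exact H'.
Qed.

Lemma det_3_kernel x0 x1 x2 y0 y1 y2 z0 z1 z2 c0 c1 c2 : det_3 x0 x1 x2 y0 y1 y2 z0 z1 z2 <> 0 ->
  c0 * x0 + c1 * x1 + c2 * x2 = 0 -> c0 * y0 + c1 * y1 + c2 * y2 = 0 -> c0 * z0 + c1 * z1 + c2 * z2 = 0 ->
  c0 = 0 /\ c1 = 0 /\ c2 = 0.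
Proof.
  intros H Ex Ey Ez. set (d := det_3 x0 x1 x2 y0 y1 y2 z0 z1 z2) in *.
  assert (Z : forall e : C, e * d = 0 -> e = 0).
  { intros e He. replace e with (e * d / d) by (field; exact H). rewrite He. field. exact H. }
  split; [|split]; apply Z.
  - transitivity ((c0 * x0 + c1 * x1 + c2 * x2) * (y1 * z2 - y2 * z1) + (c0 * y0 + c1 * y1 + c2 * y2) * (x2 * z1 - x1 * z2)
      + (c0 * z0 + c1 * z1 + c2 * z2) * (x1 * y2 - x2 * y1)); [unfold d, det_3; ring|]. rewrite Ex, Ey, Ez. ring.
  - transitivity ((c0 * x0 + c1 * x1 + c2 * x2) * (y2 * z0 - y0 * z2) + (c0 * y0 + c1 * y1 + c2 * y2) * (x0 * z2 - x2 * z0)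
      + (c0 * z0 + c1 * z1 + c2 * z2) * (x2 * y0 - x0 * y2)); [unfold d, det_3; ring|]. rewrite Ex, Ey, Ez. ring.
  - transitivity ((c0 * x0 + c1 * x1 + c2 * x2) * (y0 * z1 - y1 * z0) + (c0 * y0 + c1 * y1 + c2 * y2) * (x1 * z0 - x0 * z1)
      + (c0 * z0 + c1 * z1 + c2 * z2) * (x0 * y1 - x1 * y0)); [unfold d, det_3; ring|]. rewrite Ex, Ey, Ez. ring.
Qed.

Definition comb (c0 c1 c2 : C) (f0 f1 f2 : C -> C) (w : C) : C := c0 * f0 w + c1 * f1 w + c2 * f2 w.

Section Basis.

Context (a0 a1 a2 : C) (H01 : non_integer (a0 - a1)) (H02 : non_integer (a0 - a2)) (H12 : non_integer (a1 - a2)).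
Context (Hsum : a0 + a1 + a2 = 1 / 2).

Let H10 := non_integer_opp _ _ H01.
Let H20 := non_integer_opp _ _ H02.
Let H21 := non_integer_opp _ _ H12.

Let P0 := G_theta a0 a1 a2.
Let P1 := G_theta a1 a0 a2.
Let P2 := G_theta a2 a0 a1.

(* [w^(1/2)] times [reduced_wronskian] is the Wronskian, with respect to [D], of
   the three solutions. *)
Definition reduced_wronskian (w : C) : C :=
  det_3 (P0 0%nat w) (P1 0%nat w) (P2 0%nat w) (P0 1%nat w) (P1 1%nat w) (P2 1%nat w) (P0 2%nat w) (P1 2%nat w) (P2 2%nat w).

(** Abel's formula. Differentiating a row gives the next row minus the column factors [a0, a1, a2].
    The factors contribute [- 1/2] of the determinant; only the third row survives otherwise, and
    the equation gives it the factor [(w + 1/2) / (1 - w)]. The total is [(3/2) w / (1 - w)]. *)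
Lemma Cder_reduced_wronskian w : (Cmod w < 1)%R -> exists d, Cder reduced_wronskian w d /\
  (1 - w) * (w * d) = 3 / 2 * (w * reduced_wronskian w).
Proof.
  intros Hw.
  destruct (Cder_G_theta a0 a1 a2 H01 H02 0 w Hw) as [l00 [D00 E00]].
  destruct (Cder_G_theta a0 a1 a2 H01 H02 1 w Hw) as [l01 [D01 E01]].
  destruct (Cder_G_theta a0 a1 a2 H01 H02 2 w Hw) as [l02 [D02 E02]].
  destruct (Cder_G_theta a1 a0 a2 H10 H12 0 w Hw) as [l10 [D10 E10]].
  destruct (Cder_G_theta a1 a0 a2 H10 H12 1 w Hw) as [l11 [D11 E11]].
  destruct (Cder_G_theta a1 a0 a2 H10 H12 2 w Hw) as [l12 [D12 E12]].
  destruct (Cder_G_theta a2 a0 a1 H20 H21 0 w Hw) as [l20 [D20 E20]].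
  destruct (Cder_G_theta a2 a0 a1 H20 H21 1 w Hw) as [l21 [D21 E21]].
  destruct (Cder_G_theta a2 a0 a1 H20 H21 2 w Hw) as [l22 [D22 E22]].
  pose proof (G_theta_ode a0 a1 a2 H01 H02 w Hw) as O0.
  pose proof (G_theta_ode a1 a0 a2 H10 H12 w Hw) as O1.
  pose proof (G_theta_ode a2 a0 a1 H20 H21 w Hw) as O2.
  change (G_theta a0 a1 a2) with P0 in D00, D01, D02, E00, E01, E02, O0.
  change (G_theta a1 a0 a2) with P1 in D10, D11, D12, E10, E11, E12, O1.
  change (G_theta a2 a0 a1) with P2 in D20, D21, D22, E20, E21, E22, O2.
  exists (det_3 l00 l10 l20 (P0 1%nat w) (P1 1%nat w) (P2 1%nat w) (P0 2%nat w) (P1 2%nat w) (P2 2%nat w)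
    + det_3 (P0 0%nat w) (P1 0%nat w) (P2 0%nat w) l01 l11 l21 (P0 2%nat w) (P1 2%nat w) (P2 2%nat w)
    + det_3 (P0 0%nat w) (P1 0%nat w) (P2 0%nat w) (P0 1%nat w) (P1 1%nat w) (P2 1%nat w) l02 l12 l22).
  split.
  - unfold reduced_wronskian, det_3.
    eapply Cder_eq.
    + refine (Cder_plus _ _ _ _ _ (Cder_minus _ _ _ _ _ (Cder_mult _ _ _ _ _ D00 _) (Cder_mult _ _ _ _ _ D10 _))
        (Cder_mult _ _ _ _ _ D20 _)).
      * exact (Cder_minus _ _ _ _ _ (Cder_mult _ _ _ _ _ D11 D22) (Cder_mult _ _ _ _ _ D21 D12)).
      * exact (Cder_minus _ _ _ _ _ (Cder_mult _ _ _ _ _ D01 D22) (Cder_mult _ _ _ _ _ D21 D02)).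
      * exact (Cder_minus _ _ _ _ _ (Cder_mult _ _ _ _ _ D01 D12) (Cder_mult _ _ _ _ _ D11 D02)).
    + cbv beta. ring.
  - set (x0 := P0 0%nat w) in *. set (x1 := P1 0%nat w) in *. set (x2 := P2 0%nat w) in *.
    set (y0 := P0 1%nat w) in *. set (y1 := P1 1%nat w) in *. set (y2 := P2 1%nat w) in *.
    set (z0 := P0 2%nat w) in *. set (z1 := P1 2%nat w) in *. set (z2 := P2 2%nat w) in *.
    set (t0 := P0 3%nat w) in *. set (t1 := P1 3%nat w) in *. set (t2 := P2 3%nat w) in *.
    unfold reduced_wronskian. fold x0 x1 x2 y0 y1 y2 z0 z1 z2.
    transitivity ((1 - w) * (det_3 (w * l00) (w * l10) (w * l20) y0 y1 y2 z0 z1 z2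
      + det_3 x0 x1 x2 (w * l01) (w * l11) (w * l21) z0 z1 z2
      + det_3 x0 x1 x2 y0 y1 y2 (w * l02) (w * l12) (w * l22))); [unfold det_3; ring|].
    rewrite E00, E01, E02, E10, E11, E12, E20, E21, E22.
    transitivity (det_3 x0 x1 x2 y0 y1 y2 ((1 - w) * t0) ((1 - w) * t1) ((1 - w) * t2)
      - (1 - w) * ((a0 + a1 + a2) * det_3 x0 x1 x2 y0 y1 y2 z0 z1 z2)); [unfold det_3; ring|].
    set (e2 := a0 * a1 + a1 * a2 + a2 * a0).
    replace ((1 - w) * t0) with ((w + 1 / 2) * z0 + (2 / 9 * w - e2) * y0 + a0 * a1 * a2 * x0).
    2:{ replace ((1 - w) * t0) with (t0 - (w * (t0 + z0 + 2 / 9 * y0)) + w * z0 + 2 / 9 * w * y0) by ring.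
        rewrite O0, <- Hsum. unfold e2. ring. }
    replace ((1 - w) * t1) with ((w + 1 / 2) * z1 + (2 / 9 * w - e2) * y1 + a0 * a1 * a2 * x1).
    2:{ replace ((1 - w) * t1) with (t1 - (w * (t1 + z1 + 2 / 9 * y1)) + w * z1 + 2 / 9 * w * y1) by ring.
        rewrite O1, <- Hsum. unfold e2. ring. }
    replace ((1 - w) * t2) with ((w + 1 / 2) * z2 + (2 / 9 * w - e2) * y2 + a0 * a1 * a2 * x2).
    2:{ replace ((1 - w) * t2) with (t2 - (w * (t2 + z2 + 2 / 9 * y2)) + w * z2 + 2 / 9 * w * y2) by ring.
        rewrite O2, <- Hsum. unfold e2. ring. }
    rewrite Hsum. unfold det_3. field.
Qed.

Lemma reduced_wronskian_0 : reduced_wronskian 0 <> 0.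
Proof.
  unfold reduced_wronskian, P0, P1, P2. rewrite !G_theta_0.
  replace (det_3 _ _ _ _ _ _ _ _ _) with ((a1 - a0) * (a2 - a0) * (a2 - a1)) by (unfold det_3; ring).
  repeat apply Cmult_neq_0; apply non_integer_neq_0; assumption.
Qed.

Lemma reduced_wronskian_neq_0 w : (Cmod w < 1)%R -> w <> 0 -> reduced_wronskian w <> 0.
Proof.
  intros Hw Hw0 E. apply reduced_wronskian_0.
  assert (Hs : forall t : R, (0 <= t <= 1)%R -> (Cmod (w + t * (0 - w)) <= Cmod w)%R).
  { intros t Ht. replace (w + t * (0 - w)) with (RtoC (1 - t) * w) by (rewrite RtoC_minus; ring).
    rewrite Cmod_mult, Cmod_R, Rabs_pos_eq by lra. pose proof (Cmod_ge_0 w). nra. }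
  assert (Cz : forall x, Ccont (fun _ => 0) x).
  { intros x. eapply Cder_cont. exact (Cder_const 0 x). }
  (* The scalar equation is padded with two zero components. A zero at [w] would be carried to the
     centre; on the open segment [z] is nonzero and can be cancelled from the relation for the
     derivative. *)
  apply (gronwall_segment reduced_wronskian (fun _ => 0) (fun _ => 0) (C_derive reduced_wronskian) (fun _ => 0) (fun _ => 0)
    w 0 (3 / 2 / (1 - Cmod w))); try reflexivity; try exact E.
  - intros t Ht. split; [|split; exact (Cder_const 0 _)].
    destruct (Cder_reduced_wronskian (w + t * (0 - w))) as [d [Hd _]]; [specialize (Hs t ltac:(lra)); lra|].
    rewrite (Cder_unique _ _ _ Hd). exact Hd.
  - intros t Ht. specialize (Hs t ltac:(lra)).
    assert (Hz : w + t * (0 - w) <> 0).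
    { replace (w + t * (0 - w)) with (RtoC (1 - t) * w) by (rewrite RtoC_minus; ring).
      apply Cmult_neq_0; [apply RtoC_pos_neq_0; lra|exact Hw0]. }
    set (z := w + t * (0 - w)) in *.
    destruct (Cder_reduced_wronskian z) as [d [Hd Ed]]; [lra|]. rewrite (Cder_unique _ _ _ Hd).
    rewrite Cmod_0, !Rplus_0_r.
    assert (B : (0 <= 3 / 2 / (1 - Cmod w) * Cmod (reduced_wronskian z))%R).
    { apply Rmult_le_pos; [|apply Cmod_ge_0]. apply Rdiv_le_0_compat; lra. }
    split; [|split; exact B].
    assert (E' : (1 - z) * d = 3 / 2 * reduced_wronskian z).
    { replace ((1 - z) * d) with (/ z * ((1 - z) * (z * d))) by (field; exact Hz). rewrite Ed. field. exact Hz. }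
    apply (f_equal Cmod) in E'. rewrite !Cmod_mult, Cmod_div, !Cmod_R in E' by (apply RtoC_pos_neq_0; lra).
    rewrite !Rabs_pos_eq in E' by lra.
    pose proof (Cmod_triangle_rev 1 z) as T. rewrite Cmod_1 in T. pose proof (Cmod_ge_0 d).
    replace (3 / 2 / (1 - Cmod w) * Cmod (reduced_wronskian z))%R with (3 / 2 * Cmod (reduced_wronskian z) / (1 - Cmod w))%R by (field; lra).
    apply Rle_div_r; [lra|]. rewrite <- E', Rmult_comm. apply Rmult_le_compat_r; lra.
  - intros t Ht. split; [|split; apply Cz].
    destruct (Cder_reduced_wronskian (w + t * (0 - w))) as [d [Hd _]]; [specialize (Hs t ltac:(lra)); lra|].
    eapply Cder_cont. exact Hd.
Qed.

Section OnU.

Context (U : C -> Prop) (l : C -> C) (HU : Copen U).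
Context (Hdisc : forall w, U w -> w <> 0 /\ (Cmod w < 1)%R) (Hl : log_on U l).

Let HlD : forall w, U w -> Cder l w (/ w) := Cder_log U l HU (fun w Hw => proj1 (Hdisc w Hw)) Hl.

Let B0 := G_branch a0 a1 a2 l.
Let B1 := G_branch a1 a0 a2 l.
Let B2 := G_branch a2 a0 a1 l.

Let D0 := derivatives3_G_branch a0 a1 a2 H01 H02 U l Hdisc HlD.
Let D1 := derivatives3_G_branch a1 a0 a2 H10 H12 U l Hdisc HlD.
Let D2 := derivatives3_G_branch a2 a0 a1 H20 H21 U l Hdisc HlD.

(** The second and third series arise by exchanging exponents. In terms of ordinary derivatives the
    coefficients depend only on the symmetric functions of the exponents. *)
Lemma hyper_ode_sym b0 b1 b2 f : b0 + b1 + b2 = a0 + a1 + a2 ->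
  b0 * b1 + b1 * b2 + b2 * b0 = a0 * a1 + a1 * a2 + a2 * a0 -> b0 * b1 * b2 = a0 * a1 * a2 ->
  solves (hyper_ode b0 b1 b2) U f -> solves (hyper_ode a0 a1 a2) U f.
Proof.
  intros E1 E2 E3 H. pose proof (derivatives3_C_derive U f (proj1 H)) as D.
  apply (solves_iff_derivatives3 (fun _ => True) _ _ _ _ _ U f _ _ _
      (third_order_hyper_ode a0 a1 a2 _) HU (fun _ _ => I) D).
  pose proof (proj1 (solves_iff_derivatives3 (fun _ => True) _ _ _ _ _ U f _ _ _
      (third_order_hyper_ode b0 b1 b2 _) HU (fun _ _ => I) D) H) as H'.
  intros w Hw. rewrite <- (H' w Hw). cbv beta.
  replace (1 - b0 - b1 - b2 + b0 * b1 + b1 * b2 + b2 * b0) with (1 - (b0 + b1 + b2) + (b0 * b1 + b1 * b2 + b2 * b0)) by ring.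
  replace (3 - b0 - b1 - b2) with (3 - (b0 + b1 + b2)) by ring.
  rewrite E1, E2, E3. ring.
Qed.

Lemma G_branches_solve : solves (hyper_ode a0 a1 a2) U (B0 0%nat) /\ solves (hyper_ode a0 a1 a2) U (B1 0%nat)
  /\ solves (hyper_ode a0 a1 a2) U (B2 0%nat).
Proof.
  split; [|split].
  - apply G_branch_solves; assumption.
  - apply (hyper_ode_sym a1 a0 a2); try ring. apply G_branch_solves; assumption.
  - apply (hyper_ode_sym a2 a0 a1); try ring. apply G_branch_solves; assumption.
Qed.

Lemma G_branch_det_neq_0 w : U w -> det_3 (B0 0%nat w) (B1 0%nat w) (B2 0%nat w) (B0 1%nat w) (B1 1%nat w) (B2 1%nat w)
   (B0 2%nat w) (B1 2%nat w) (B2 2%nat w) <> 0.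
Proof.
  intros Hw. replace (det_3 _ _ _ _ _ _ _ _ _) with
    (Cexp (a0 * l w) * Cexp (a1 * l w) * Cexp (a2 * l w) * reduced_wronskian w).
  - repeat apply Cmult_neq_0; try apply Cexp_neq_0. apply reduced_wronskian_neq_0; apply Hdisc, Hw.
  - unfold det_3, reduced_wronskian, B0, B1, B2, P0, P1, P2, G_branch, det_3. ring.
Qed.

Lemma derivatives3_comb c0 c1 c2 :
  derivatives3 U (comb c0 c1 c2 (B0 0%nat) (B1 0%nat) (B2 0%nat))
   (comb c0 c1 c2 (G_d1 a0 a1 a2 l) (G_d1 a1 a0 a2 l) (G_d1 a2 a0 a1 l))
   (comb c0 c1 c2 (G_d2 a0 a1 a2 l) (G_d2 a1 a0 a2 l) (G_d2 a2 a0 a1 l))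
   (comb c0 c1 c2 (G_d3 a0 a1 a2 l) (G_d3 a1 a0 a2 l) (G_d3 a2 a0 a1 l)).
Proof.
  intros w Hw. destruct (D0 w Hw) as [h00 [h01 h02]]. destruct (D1 w Hw) as [h10 [h11 h12]]. destruct (D2 w Hw) as [h20 [h21 h22]].
  split; [|split]; (apply Cder_plus; [apply Cder_plus|]); apply Cder_scal; assumption.
Qed.

Lemma comb_independent c0 c1 c2 : (exists w, U w) ->
  (forall w, U w -> comb c0 c1 c2 (B0 0%nat) (B1 0%nat) (B2 0%nat) w = 0) -> c0 = 0 /\ c1 = 0 /\ c2 = 0.
Proof.
  intros [w Hw] Hz. pose proof (derivatives3_comb c0 c1 c2) as D.
  set (f := comb c0 c1 c2 (B0 0%nat) (B1 0%nat) (B2 0%nat)) in *.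
  set (f1 := comb c0 c1 c2 (G_d1 a0 a1 a2 l) _ _) in *. set (f2 := comb c0 c1 c2 (G_d2 a0 a1 a2 l) _ _) in *.
  set (f3 := comb c0 c1 c2 (G_d3 a0 a1 a2 l) _ _) in *.
  assert (Zd : forall g g' : C -> C, (forall x, U x -> Cder g x (g' x)) -> (forall x, U x -> g x = 0) -> forall x, U x -> g' x = 0).
  { intros g g' Hg Hg0 x Hx. rewrite <- (Cder_unique _ _ _ (Hg x Hx)). apply Cder_unique.
    apply (Cder_ext_on U (fun _ => 0)); try assumption; [intros y Hy; symmetry; apply Hg0, Hy|]. exact (Cder_const 0 x). }
  assert (Z1 : forall x, U x -> f1 x = 0) by (apply (Zd f f1 (fun x Hx => proj1 (D x Hx)) Hz)).
  assert (Z2 : forall x, U x -> f2 x = 0) by (apply (Zd f1 f2 (fun x Hx => proj1 (proj2 (D x Hx))) Z1)).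
  destruct (Hdisc w Hw) as [Hw0 Hw1].
  apply (det_3_kernel _ _ _ _ _ _ _ _ _ c0 c1 c2 (G_branch_det_neq_0 w Hw)).
  - exact (Hz w Hw).
  - transitivity (w * f1 w); [|rewrite (Z1 w Hw); ring]. unfold f1, comb, G_d1. fold B0 B1 B2. field. exact Hw0.
  - transitivity (w ^ 2 * f2 w + w * f1 w); [|rewrite (Z1 w Hw), (Z2 w Hw); ring].
    unfold f1, f2, comb, G_d1, G_d2. fold B0 B1 B2. field. exact Hw0.
Qed.

(** Uniqueness for the initial value problem, as a first-order system for [g, g1, g2]. Solving for
    [g3] divides by [z^3 (z - 1)], which [d1^3 d2] bounds from below along the segment from [w0] to
    [y]. *)
Lemma hyper_ode_zero_data (w0 : C) (rho : R) (g g1 g2 g3 : C -> C) :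
  (0 < rho)%R -> (forall w, (Cmod (w - w0) < rho)%R -> U w) -> derivatives3 U g g1 g2 g3 ->
  solves (hyper_ode a0 a1 a2) U g -> g w0 = 0 -> g1 w0 = 0 -> g2 w0 = 0 ->
  forall y, (Cmod (y - w0) < rho)%R -> g y = 0.
Proof.
  intros Hrho HB D Hg Z0 Z1 Z2 y Hy.
  assert (Hw0 : U w0) by (apply HB, ball_center, Hrho).
  (* The ball lies in [U], hence avoids 0; this gives the distance [d1] of the segment from the
     singular point. *)
  assert (Hm0 : (rho <= Cmod w0)%R).
  { apply Rnot_lt_le. intros Hlt. apply (Hdisc 0); [|reflexivity]. apply HB.
    replace (0 - w0) with (- w0) by ring. rewrite Cmod_opp. exact Hlt. }
  set (q2 := 3 - a0 - a1 - a2). set (q1 := 1 - a0 - a1 - a2 + a0 * a1 + a1 * a2 + a2 * a0). set (q0 := a0 * a1 * a2).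
  set (M := (7 + Cmod q2 + Cmod q1 + Cmod q0)%R).
  set (d1 := (rho - Cmod (y - w0))%R). set (d2 := (1 - Rmax (Cmod w0) (Cmod y))%R).
  assert (Hd1 : (0 < d1)%R) by (unfold d1; lra).
  assert (Hd2 : (0 < d2)%R).
  { unfold d2. assert (Rmax (Cmod w0) (Cmod y) < 1)%R; [|lra]. apply Rmax_lub_lt; apply Hdisc; [exact Hw0|apply HB, Hy]. }
  assert (Hm : (0 < d1 ^ 3 * d2)%R) by (apply Rmult_lt_0_compat; [apply pow_lt|]; assumption).
  pose proof (Cmod_ge_0 q2). pose proof (Cmod_ge_0 q1). pose proof (Cmod_ge_0 q0).
  set (Kb := (1 + M / (d1 ^ 3 * d2))%R).
  assert (HM : (0 < M / (d1 ^ 3 * d2))%R) by (apply Rdiv_lt_0_compat; [unfold M; lra|exact Hm]).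
  assert (Hs : forall t : R, (0 <= t <= 1)%R -> (Cmod (w0 + t * (y - w0) - w0) < rho)%R).
  { intros t Ht. apply ball_segment; [exact Ht|apply ball_center; exact Hrho|exact Hy]. }
  pose proof (proj1 (solves_iff_derivatives3 (fun _ => True) _ _ _ _ _ U g _ _ _
      (third_order_hyper_ode a0 a1 a2 _) HU (fun _ _ => I) D) Hg) as O.
  cbv beta in O.
  apply (gronwall_segment g g1 g2 g1 g2 g3 w0 y Kb); try assumption.
  - intros t Ht. apply D, HB, Hs. lra.
  - intros t Ht. specialize (Hs t ltac:(lra)).
    assert (Hz1 : (d1 <= Cmod (w0 + t * (y - w0)))%R).
    { pose proof (Cmod_triangle (w0 + t * (y - w0)) (- (t * (y - w0)))) as T.
      replace (w0 + t * (y - w0) + - (t * (y - w0))) with w0 in T by ring.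
      rewrite Cmod_opp, Cmod_mult, Cmod_R, Rabs_pos_eq in T by lra.
      pose proof (Cmod_ge_0 (y - w0)). unfold d1. nra. }
    assert (Hz2 : (d2 <= Cmod (w0 + t * (y - w0) - 1))%R).
    { pose proof (Cmod_triangle_rev 1 (w0 + t * (y - w0))) as T. rewrite Cmod_1, Cmod_sub_sym in T.
      pose proof (Cmod_triangle (RtoC (1 - t) * w0) (t * y)) as T'.
      replace (RtoC (1 - t) * w0 + t * y) with (w0 + t * (y - w0)) in T' by (rewrite RtoC_minus; ring).
      rewrite !Cmod_mult, !Cmod_R, !Rabs_pos_eq in T' by lra.
      pose proof (Rmax_l (Cmod w0) (Cmod y)). pose proof (Rmax_r (Cmod w0) (Cmod y)). unfold d2. nra. }
    set (z := w0 + t * (y - w0)) in *. specialize (O z (HB z Hs)). destruct (Hdisc z (HB z Hs)) as [Hz0 Hzlt].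
    fold q2 q1 q0 in O.
    pose proof (Cmod_ge_0 (g z)) as G0. pose proof (Cmod_ge_0 (g1 z)) as G1. pose proof (Cmod_ge_0 (g2 z)) as G2.
    set (N := (Cmod (g z) + Cmod (g1 z) + Cmod (g2 z))%R) in *.
    assert (HN : (0 <= N)%R) by (unfold N; lra).
    assert (HKN : (N <= Kb * N)%R) by (unfold Kb; nra).
    split; [unfold N in *; lra|]. split; [unfold N in *; lra|].
    assert (E : z ^ 3 * (z - 1) * g3 z = - ((4 * z - q2) * z ^ 2 * g2 z + (20 / 9 * z - q1) * z * g1 z + q0 * g z)).
    { apply Ceq_minus. rewrite <- O. ring. }
    apply (f_equal Cmod) in E. rewrite !Cmod_mult, Cmod_pow, Cmod_opp in E.
    assert (R1 : (Cmod ((4 * z - q2) * z ^ 2 * g2 z + (20 / 9 * z - q1) * z * g1 z + q0 * g z) <= M * N)%R).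
    { pose proof (Cmod_ge_0 z).
      assert (S2 : (Cmod ((4 * z - q2) * z ^ 2) <= M)%R).
      { rewrite Cmod_mult, Cmod_pow.
        assert (Cmod (4 * z - q2) <= M)%R.
        { unfold Cminus. eapply Rle_trans; [apply Cmod_triangle|].
          rewrite Cmod_opp, Cmod_mult, Cmod_R, Rabs_pos_eq by lra. unfold M. lra. }
        assert (Cmod z ^ 2 <= 1)%R by (change 1%R with (Cmod z ^ 0)%R; apply pow_le_antitone; [lra|lia]).
        pose proof (Cmod_ge_0 (4 * z - q2)). pose proof (pow2_ge_0 (Cmod z)). nra. }
      assert (S1 : (Cmod ((20 / 9 * z - q1) * z) <= M)%R).
      { rewrite Cmod_mult.
        assert (Cmod (20 / 9 * z - q1) <= M)%R.
        { unfold Cminus. eapply Rle_trans; [apply Cmod_triangle|].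
          rewrite <- RtoC_div by lra. rewrite Cmod_opp, Cmod_mult, Cmod_R, Rabs_pos_eq by lra. unfold M. lra. }
        pose proof (Cmod_ge_0 (20 / 9 * z - q1)). nra. }
      assert (S0 : (Cmod q0 <= M)%R) by (unfold M; lra).
      eapply Rle_trans; [apply Cmod_triangle|]. eapply Rle_trans; [apply Rplus_le_compat_r, Cmod_triangle|].
      rewrite (Cmod_mult _ (g2 z)), (Cmod_mult _ (g1 z)), (Cmod_mult _ (g z)). unfold N. nra. }
    rewrite <- E in R1.
    assert (R2 : (d1 ^ 3 * d2 * Cmod (g3 z) <= M * N)%R).
    { eapply Rle_trans; [|exact R1]. apply Rmult_le_compat_r; [apply Cmod_ge_0|].
      apply Rmult_le_compat; [apply pow_le; lra|lra|apply pow_incr; lra|exact Hz2]. }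
    apply Rle_trans with (M / (d1 ^ 3 * d2) * N)%R; [|unfold Kb; lra].
    replace (M / (d1 ^ 3 * d2) * N)%R with (M * N / (d1 ^ 3 * d2))%R by (field; split; [lra|apply Rgt_not_eq; lra]).
    apply Rle_div_r; [exact Hm|]. lra.
  - intros t Ht. destruct (D (w0 + t * (y - w0)) (HB _ (Hs t Ht))) as [h0 [h1 h2]].
    split; [|split]; eapply Cder_cont; eassumption.
Qed.

Lemma comb_generates (w0 : C) (rho : R) f : (0 < rho)%R -> (forall w, U w <-> (Cmod (w - w0) < rho)%R) ->
  solves (hyper_ode a0 a1 a2) U f ->
  exists c0 c1 c2, forall w, U w -> f w = comb c0 c1 c2 (B0 0%nat) (B1 0%nat) (B2 0%nat) w.
Proof.
  intros Hrho HB Hf. pose proof (derivatives3_C_derive U f (proj1 Hf)) as D.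
  assert (Hw0 : U w0) by (apply HB, ball_center, Hrho).
  destruct (Hdisc w0 Hw0) as [Hnz _].
  (* The right-hand sides are [f], [D f] and [D^2 f] at the centre, because the rows of the
     determinant are the values of the three solutions under [1, D, D^2]. *)
  destruct (det_3_solve _ _ _ _ _ _ _ _ _ (f w0) (w0 * C_derive f w0)
     (w0 ^ 2 * C_derive (C_derive f) w0 + w0 * C_derive f w0) (G_branch_det_neq_0 w0 Hw0)) as [c0 [c1 [c2 [E0 [E1 E2]]]]].
  exists c0, c1, c2. pose proof (derivatives3_comb c0 c1 c2) as Dc.
  set (h := comb c0 c1 c2 (B0 0%nat) (B1 0%nat) (B2 0%nat)) in *.
  set (h1 := comb c0 c1 c2 (G_d1 a0 a1 a2 l) _ _) in *. set (h2 := comb c0 c1 c2 (G_d2 a0 a1 a2 l) _ _) in *.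
  set (h3 := comb c0 c1 c2 (G_d3 a0 a1 a2 l) _ _) in *.
  set (f1 := C_derive f) in *. set (f2 := C_derive f1) in *. set (f3 := C_derive f2) in *.
  assert (Dg : derivatives3 U (fun w => f w - h w) (fun w => f1 w - h1 w) (fun w => f2 w - h2 w) (fun w => f3 w - h3 w)).
  { intros w Hw. destruct (D w Hw) as [x0 [x1 x2]]. destruct (Dc w Hw) as [y0 [y1 y2]].
    split; [|split]; apply Cder_minus; assumption. }
  assert (F1 : h1 w0 = f1 w0).
  { transitivity (/ w0 * (w0 * f1 w0)); [|field; exact Hnz]. rewrite <- E1. unfold h1, comb, G_d1. fold B0 B1 B2. field. exact Hnz. }
  assert (F2 : h2 w0 = f2 w0).
  { transitivity (/ w0 ^ 2 * ((w0 ^ 2 * f2 w0 + w0 * f1 w0) - w0 * f1 w0)); [|field; exact Hnz].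
    rewrite <- E2, <- E1. unfold h2, comb, G_d2. fold B0 B1 B2. field. exact Hnz. }
  intros w Hw. apply Ceq_minus.
  apply (hyper_ode_zero_data w0 rho (fun w => f w - h w) (fun w => f1 w - h1 w) (fun w => f2 w - h2 w) (fun w => f3 w - h3 w)).
  - exact Hrho.
  - intros z Hz. apply HB, Hz.
  - exact Dg.
  - apply (solves_iff_derivatives3 (fun _ => True) _ _ _ _ _ U _ _ _ _
      (third_order_hyper_ode a0 a1 a2 _) HU (fun _ _ => I) Dg).
    pose proof (proj1 (solves_iff_derivatives3 (fun _ => True) _ _ _ _ _ U _ _ _ _
      (third_order_hyper_ode a0 a1 a2 _) HU (fun _ _ => I) D) Hf) as Of.
    destruct G_branches_solve as [S0 [S1 S2]].
    pose proof (proj1 (solves_iff_derivatives3 (fun _ => True) _ _ _ _ _ U _ _ _ _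
      (third_order_hyper_ode a0 a1 a2 _) HU (fun _ _ => I) D0) S0) as O0.
    pose proof (proj1 (solves_iff_derivatives3 (fun _ => True) _ _ _ _ _ U _ _ _ _
      (third_order_hyper_ode a0 a1 a2 _) HU (fun _ _ => I) D1) S1) as O1.
    pose proof (proj1 (solves_iff_derivatives3 (fun _ => True) _ _ _ _ _ U _ _ _ _
      (third_order_hyper_ode a0 a1 a2 _) HU (fun _ _ => I) D2) S2) as O2.
    intros z Hz. specialize (Of z Hz). specialize (O0 z Hz). specialize (O1 z Hz). specialize (O2 z Hz).
    cbv beta in *.
    match type of Of with ?A = _ => match type of O0 with ?A0 = _ => match type of O1 with ?A1 = _ => match type of O2 with ?A2 = _ =>
      transitivity (A - (c0 * A0 + c1 * A1 + c2 * A2)) end end end end.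
    + unfold h, h1, h2, h3, comb, f3, f2, f1. fold B0 B1 B2. ring.
    + rewrite Of, O0, O1, O2. ring.
  - unfold h, comb. rewrite E0. ring.
  - rewrite F1. ring.
  - rewrite F2. ring.
  - apply HB, Hw.
Qed.

End OnU.

End Basis.

(** * Global bases *)

Lemma near_near x (P : C -> Prop) : near x P -> near x (fun y => near y P).
Proof.
  intros [d [Hd H]]. exists d. split; [exact Hd|]. intros y Hy.
  apply near_imp with (2 := near_ball x y d Hy). exact H.
Qed.

Lemma Copen_and (A B : C -> Prop) : Copen A -> Copen B -> Copen (fun x => A x /\ B x).
Proof.
  rewrite !Copen_near. intros HA HB x [Ax Bx]. apply near_and; auto.
Qed.

Lemma solution_basis_of_local L V f0 f1 f2 : domain V ->
  solves L V f0 -> solves L V f1 -> solves L V f2 ->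
  (forall x, V x -> exists W : C -> Prop, Copen W /\ W x /\ (forall y, W y -> V y) /\
     forall f, solves L W f -> exists c0 c1 c2, forall y, W y -> f y = comb c0 c1 c2 f0 f1 f2 y) ->
  (forall (W : C -> Prop) c0 c1 c2, Copen W -> (forall y, W y -> V y) -> (exists x, W x) ->
     (forall y, W y -> comb c0 c1 c2 f0 f1 f2 y = 0) -> c0 = 0 /\ c1 = 0 /\ c2 = 0) ->
  solution_basis L V f0 f1 f2.
Proof.
  intros [HV [Hconn [x0 Hx0]]] S0 S1 S2 Hgen Hind.
  split; [exact S0|]. split; [exact S1|]. split; [exact S2|].
  intros f Hf.
  assert (Uniq : forall (W : C -> Prop) c0 c1 c2 d0 d1 d2, Copen W -> (forall y, W y -> V y) -> (exists x, W x) ->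
     (forall y, W y -> comb c0 c1 c2 f0 f1 f2 y = comb d0 d1 d2 f0 f1 f2 y) -> c0 = d0 /\ c1 = d1 /\ c2 = d2).
  { intros W c0 c1 c2 d0 d1 d2 HW HWV Hne E.
    destruct (Hind W (c0 - d0) (c1 - d1) (c2 - d2) HW HWV Hne) as [A [B D]].
    - intros y Hy. transitivity (comb c0 c1 c2 f0 f1 f2 y - comb d0 d1 d2 f0 f1 f2 y); [unfold comb; ring|].
      rewrite (E y Hy). ring.
    - split; [|split]; apply Ceq_minus; assumption. }
  assert (Res : forall W : C -> Prop, (forall y, W y -> V y) -> solves L W f).
  { intros W HWV. destruct Hf as [[A [B D]] E]. split; [split; [|split]|]; intros y Hy; auto. }
  destruct (Hgen x0 Hx0) as [W0 [HW0 [Wx0 [WV0 G0]]]].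
  destruct (G0 f (Res W0 WV0)) as [c0 [c1 [c2 E0]]].
  set (P := fun y => f y = comb c0 c1 c2 f0 f1 f2 y).
  (* [V] is covered by the points near which [f] is the chosen combination and the points where this
     fails. The second set is open too: near such a point [f] is some other combination, and
     agreement on a smaller open set would force the coefficients to coincide. *)
  assert (HA : forall x, V x -> near x P).
  { intros x Hx. apply NNPP. intros Hn.
    destruct (Hconn (fun y => near y P) (fun y => V y /\ ~ near y P)) as [z [_ [Az [_ Bz]]]].
    - apply Copen_near. intros y. apply near_near.
    - apply Copen_near. intros y [Vy Ny].
      destruct (Hgen y Vy) as [W [HW [Wy [WV GW]]]]. destruct (GW f (Res W WV)) as [d0 [d1 [d2 E]]].
      apply near_imp with (2 := proj1 (Copen_near W) HW y Wy). intros z Wz. split; [apply WV, Wz|].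
      intros Nz. apply Ny. apply near_near in Nz.
      destruct (Uniq (fun t => W t /\ near t P) c0 c1 c2 d0 d1 d2) as [-> [-> ->]].
      + apply Copen_and; [exact HW|]. apply Copen_near. intros t. apply near_near.
      + intros t [Wt _]. apply WV, Wt.
      + exists z. split; [exact Wz|exact (near_self _ _ Nz)].
      + intros t [Wt Nt]. rewrite <- (E t Wt). symmetry. exact (near_self _ _ Nt).
      + apply near_imp with (2 := proj1 (Copen_near W) HW y Wy). exact E.
    - intros y Vy. destruct (classic (near y P)); [left|right]; auto.
    - exists x0. split; [exact Hx0|]. apply near_imp with (2 := proj1 (Copen_near W0) HW0 x0 Wx0). exact E0.
    - exists x. auto.
    - exact (Bz Az). }
  exists (c0, c1, c2). split.
  - intros x Hx. exact (near_self _ _ (HA x Hx)).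
  - intros [[d0 d1] d2] E. simpl in E.
    destruct (Uniq V c0 c1 c2 d0 d1 d2) as [-> [-> ->]]; try reflexivity; auto.
    + exists x0. exact Hx0.
    + intros y Hy. rewrite <- (near_self _ _ (HA y Hy)). apply E, Hy.
Qed.

Lemma log_branch_log_on U l : log_branch U (fun w => w / 1728) l -> log_on U l.
Proof. intros H w Hw. destruct (H w Hw). split; [apply continuous_Ccont|]; assumption. Qed.

Lemma G_G_branch a b c l w : G (l w) a (b - 1) (c - 1) w = G_branch a b c l 0 w.
Proof.
  rewrite G_PS. unfold G_branch, G_theta. f_equal. apply PS_ext. intros n. simpl. ring.
Qed.

Lemma log_on_subset (U W : C -> Prop) l : (forall w, W w -> U w) -> log_on U l -> log_on W l.
Proof. intros HW H w Hw. apply H, HW, Hw. Qed.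

(** * The bases in w and in tau *)

Section Solutions.

Context (mu1 mu2 a0 a1 a2 : C).
Context (H01 : non_integer (a0 - a1)) (H02 : non_integer (a0 - a2)) (H12 : non_integer (a1 - a2)).
Context (Hsum : a0 + a1 + a2 = 1 / 2).
Context (Hmu1 : mu1 = a0 * a1 + a1 * a2 + a0 * a2 - 1 / 18) (Hmu2 : mu2 = - (a0 * a1 * a2)).

Lemma hyper_ode_basis (U : C -> Prop) (l : C -> C) : domain U ->
  (forall w, U w -> w <> 0 /\ (Cmod w < 1)%R) -> log_on U l ->
  solution_basis (hyper_ode a0 a1 a2) U (G_branch a0 a1 a2 l 0) (G_branch a1 a0 a2 l 0) (G_branch a2 a0 a1 l 0).
Proof.
  intros HU Hdisc Hl. assert (HUo : Copen U) by apply HU.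
  destruct (G_branches_solve a0 a1 a2 H01 H02 H12 U l HUo Hdisc Hl) as [S0 [S1 S2]].
  apply solution_basis_of_local; try assumption.
  - intros x Hx. destruct (proj1 (Copen_near U) HUo x Hx) as [r [Hr HB]].
    exists (fun y => (Cmod (y - x) < r)%R). split; [apply Copen_ball|]. split; [apply ball_center, Hr|].
    split; [exact HB|]. intros f Hf.
    apply (comb_generates a0 a1 a2 H01 H02 H12 Hsum (fun y => (Cmod (y - x) < r)%R) l (Copen_ball x r)
      (fun w Hw => Hdisc w (HB w Hw)) (log_on_subset U _ l HB Hl) x r f Hr); [intros; reflexivity|exact Hf].
  - intros W c0 c1 c2 HW HWU Hne E.
    apply (comb_independent a0 a1 a2 H01 H02 H12 Hsum W l HW (fun w Hw => Hdisc w (HWU w Hw)) (log_on_subset U W l HWU Hl));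
      assumption.
Qed.

Lemma w_chart (W : C -> Prop) (t0 : C) : Copen W -> W t0 -> (forall x, W x -> non_elliptic x) ->
  exists (V : C -> Prop) (rho : R) (q : C -> C),
    let U := fun y => (Cmod (y - wcoord t0) < rho)%R in
    (0 < rho)%R /\ Copen V /\ V t0 /\ (forall x, V x -> W x) /\
    (forall x, V x -> U (wcoord x) /\ q (wcoord x) = x) /\
    (forall y, U y -> V (q y) /\ wcoord (q y) = y /\ Ccont q y) /\
    (forall chi, solves (mlde mu1 mu2) V chi -> solves (hyper_ode a0 a1 a2) U (fun y => chi (q y))).
Proof.
  exact (chart_solves _ _ _ _ _ derivatives3_wcoord d1_w_neq_0 _ _ _ _ _ _ _ _ _ _ _ (fun _ => True)
    (third_order_subset _ _ _ _ _ _ _ (fun x Hx => proj1 Hx) (third_order_mlde mu1 mu2))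
    (third_order_hyper_ode a0 a1 a2 _) E6_opp_neq_0 (w_coefficients mu1 mu2 a0 a1 a2 Hsum Hmu1 Hmu2) (fun _ _ => I) W t0).
Qed.

(** By the convention [/ 0 = 0], a point with [J t = 0] has [wcoord t = 0], so [wcoord t <> 0]
    excludes it; [J t = 1728] gives [wcoord t = 1], on the boundary of the disc. *)
Lemma punctured_disc_non_elliptic t : upper_half_plane t -> wcoord t <> 0 -> (Cmod (wcoord t) < 1)%R -> non_elliptic t.
Proof.
  intros H Hw Hw1. unfold wcoord in *. split; [exact H|]. split; intros E; rewrite E in *.
  - apply Hw. unfold Cdiv. rewrite Cinv_0. ring.
  - replace (1728 / 1728) with (RtoC 1) in Hw1 by field. rewrite Cmod_1 in Hw1. lra.
Qed.

Lemma Ccont_comp f g x : Ccont f (g x) -> Ccont g x -> Ccont (fun y => f (g y)) x.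
Proof. intros Hf Hg eps He. apply (Ccont_near g x _ Hg (Hf eps He)). Qed.

Context (V : C -> Prop) (l : C -> C).
Context (Hdisc : forall t, V t -> upper_half_plane t /\ wcoord t <> 0 /\ (Cmod (wcoord t) < 1)%R).
Context (Hl : forall t, V t -> Ccont l t /\ Cexp (l t) = wcoord t / 1728).

(** The logarithm is a function of [t], not of [wcoord t]: two points of [V] with the same
    coordinate may carry different branches. It is therefore passed as a constant function. *)
Definition tau_branch (a b c : C) (t : C) : C := G_branch a b c (fun _ => l t) 0 (wcoord t).

Lemma tau_branch_chart a b c q t : q (wcoord t) = t -> tau_branch a b c t = G_branch a b c (fun y => l (q y)) 0 (wcoord t).
Proof. intros E. unfold tau_branch, G_branch. rewrite E. reflexivity. Qed.

Lemma tau_chart (W : C -> Prop) (t0 : C) : Copen W -> W t0 -> (forall x, W x -> V x) ->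
  exists (N : C -> Prop) (rho : R) (q : C -> C),
    let U := fun y => (Cmod (y - wcoord t0) < rho)%R in
    (0 < rho)%R /\ Copen N /\ N t0 /\ (forall x, N x -> W x) /\
    (forall x, N x -> U (wcoord x) /\ q (wcoord x) = x) /\
    (forall y, U y -> N (q y) /\ wcoord (q y) = y) /\
    (forall y, U y -> y <> 0 /\ (Cmod y < 1)%R) /\ log_on U (fun y => l (q y)) /\
    (forall chi, solves (mlde mu1 mu2) N chi -> solves (hyper_ode a0 a1 a2) U (fun y => chi (q y))).
Proof.
  intros HW Ht HWV.
  assert (HS : forall x, W x -> non_elliptic x).
  { intros x Hx. destruct (Hdisc x (HWV x Hx)) as [A [B D]]. apply punctured_disc_non_elliptic; assumption. }
  destruct (w_chart W t0 HW Ht HS) as [N [rho [q [Hrho [HN [Nt [HNW [Hpq [Hqp Hs]]]]]]]]].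
  exists N, rho, q. cbv zeta. do 5 (split; [assumption|]). split; [|split; [|split; [|exact Hs]]].
  - intros y Hy. destruct (Hqp y Hy) as [A [B _]]. split; assumption.
  - intros y Hy. destruct (Hqp y Hy) as [A [B _]]. rewrite <- B. apply (Hdisc (q y)), HWV, HNW, A.
  - intros y Hy. destruct (Hqp y Hy) as [A [B Hc]]. destruct (Hl (q y) (HWV _ (HNW _ A))) as [Lc Le]. split.
    + apply Ccont_comp; assumption.
    + rewrite Le, B. reflexivity.
Qed.

Lemma tau_branch_solves (HV : Copen V) : solves (mlde mu1 mu2) V (tau_branch a0 a1 a2) /\
  solves (mlde mu1 mu2) V (tau_branch a1 a0 a2) /\ solves (mlde mu1 mu2) V (tau_branch a2 a0 a1).
Proof.
  pose proof (third_order_subset _ non_elliptic _ _ _ _ _ (fun x Hx => proj1 Hx) (third_order_mlde mu1 mu2)) as TO.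
  assert (Loc : forall t, V t -> exists N, N t /\ solves (mlde mu1 mu2) N (tau_branch a0 a1 a2) /\
     solves (mlde mu1 mu2) N (tau_branch a1 a0 a2) /\ solves (mlde mu1 mu2) N (tau_branch a2 a0 a1)).
  { intros t Ht. destruct (tau_chart V t HV Ht (fun _ H => H)) as [N [rho [q [Hrho [HN [Nt [HNV [Hpq [Hqp [Hd [Hlog _]]]]]]]]]]].
    exists N. split; [exact Nt|].
    assert (HS : forall x, N x -> non_elliptic x).
    { intros x Hx. destruct (Hdisc x (HNV x Hx)) as [A [B D]]. apply punctured_disc_non_elliptic; assumption. }
    assert (Pull : forall a b c, solves (hyper_ode a0 a1 a2) (fun y => (Cmod (y - wcoord t) < rho)%R) (G_branch a b c (fun y => l (q y)) 0) ->
       solves (mlde mu1 mu2) N (tau_branch a b c)).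
    { intros a b c H. apply (solves_ext _ _ _ _ _ _ N (fun x => G_branch a b c (fun y => l (q y)) 0 (wcoord x)) _ TO HN HS).
      - intros x Hx. symmetry. apply tau_branch_chart, Hpq, Hx.
      - refine (proj1 (proj1 (reads_in_wcoord mu1 mu2 a0 a1 a2 Hsum Hmu1 Hmu2) N (fun y => (Cmod (y - wcoord t) < rho)%R) HN (Copen_ball _ _) HS _ _) H).
        split; [intros x Hx; apply Hpq, Hx|]. intros y Hy. exists (q y). apply Hqp, Hy. }
    destruct (G_branches_solve a0 a1 a2 H01 H02 H12 _ _ (Copen_ball (wcoord t) rho) Hd Hlog) as [S0 [S1 S2]].
    split; [|split]; apply Pull; assumption. }
  split; [|split]; apply (solves_local _ _ _ _ _ _ V _ TO); intros t Ht;
    destruct (Loc t Ht) as [N [Nt [S0 [S1 S2]]]]; exists N; split; assumption.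
Qed.

Lemma mlde_basis : domain V ->
  solution_basis (mlde mu1 mu2) V (tau_branch a0 a1 a2) (tau_branch a1 a0 a2) (tau_branch a2 a0 a1).
Proof.
  intros HV. assert (HVo : Copen V) by apply HV.
  destruct (tau_branch_solves HVo) as [S0 [S1 S2]].
  apply solution_basis_of_local; try assumption.
  - intros t Ht. destruct (tau_chart V t HVo Ht (fun _ H => H)) as [N [rho [q [Hrho [HN [Nt [HNV [Hpq [Hqp [Hd [Hlog Hs]]]]]]]]]]].
    exists N. do 3 (split; [assumption|]). intros f Hf.
    destruct (comb_generates a0 a1 a2 H01 H02 H12 Hsum _ _ (Copen_ball (wcoord t) rho) Hd Hlog (wcoord t) rho _ Hrho
      (fun w => iff_refl _) (Hs f Hf)) as [c0 [c1 [c2 E]]].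
    exists c0, c1, c2. intros y Hy. destruct (Hpq y Hy) as [Uy Ey]. rewrite <- Ey at 1. rewrite (E _ Uy).
    unfold comb. rewrite <- !tau_branch_chart by exact Ey. reflexivity.
  - intros W c0 c1 c2 HW HWV [t Ht] E.
    destruct (tau_chart W t HW Ht HWV) as [N [rho [q [Hrho [HN [Nt [HNW [Hpq [Hqp [Hd [Hlog _]]]]]]]]]]].
    apply (comb_independent a0 a1 a2 H01 H02 H12 Hsum _ _ (Copen_ball (wcoord t) rho) Hd Hlog).
    + exists (wcoord t). apply ball_center, Hrho.
    + intros y Hy. destruct (Hqp y Hy) as [Ny Ey]. rewrite <- (E (q y) (HNW _ Ny)). unfold comb.
      rewrite !(tau_branch_chart _ _ _ q (q y)) by (rewrite Ey; reflexivity). rewrite Ey. reflexivity.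
Qed.

End Solutions.

Theorem proposition3p1 (mu1 mu2 alpha0 alpha1 alpha2 : C)
  (Halpha : exponents_at_w0 zp2 (zp1 mu1) (zp0 mu2) alpha0 alpha1 alpha2)
  (H01 : non_integer (alpha0 - alpha1))
  (H02 : non_integer (alpha0 - alpha2))
  (H12 : non_integer (alpha1 - alpha2)) :
  (* the equation in the coordinate z *)
  reads_in_coordinate non_elliptic zcoord (mlde mu1 mu2) (mlde_z mu1 mu2) /\
  (* the local exponents in terms of the parameters *)
  alpha0 + alpha1 + alpha2 = 1 / 2 /\
  mu1 = alpha0 * alpha1 + alpha1 * alpha2 + alpha0 * alpha2 - 1 / 18 /\
  mu2 = - (alpha0 * alpha1 * alpha2) /\
  (* the equation in the coordinate w is the hypergeometric one *)
  reads_in_coordinate non_elliptic wcoord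
    (mlde mu1 mu2) (hyper_ode alpha0 alpha1 alpha2) /\
  (* basis of solutions in w, near w = 0 *)
  (forall (U : C -> Prop) (l : C -> C),
     domain U ->
     (forall w, U w -> w <> 0 /\ (Cmod w < 1)%R) ->
     log_branch U (fun w => w / 1728) l ->
     solution_basis (hyper_ode alpha0 alpha1 alpha2) U
       (fun w => G (l w) alpha0 (alpha1 - 1) (alpha2 - 1) w)
       (fun w => G (l w) alpha1 (alpha0 - 1) (alpha2 - 1) w)
       (fun w => G (l w) alpha2 (alpha0 - 1) (alpha1 - 1) w)) /\
  (* the same basis as functions of tau *)
  (forall (V : C -> Prop) (l : C -> C),
     domain V ->
     (forall tau, V tau ->
        upper_half_plane tau /\ wcoord tau <> 0 /\ (Cmod (wcoord tau) < 1)%R) ->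
     log_branch V (fun tau => wcoord tau / 1728) l ->
     solution_basis (mlde mu1 mu2) V
       (fun tau => G (l tau) alpha0 (alpha1 - 1) (alpha2 - 1) (wcoord tau))
       (fun tau => G (l tau) alpha1 (alpha0 - 1) (alpha2 - 1) (wcoord tau))
       (fun tau => G (l tau) alpha2 (alpha0 - 1) (alpha1 - 1) (wcoord tau))).
Proof.
  destruct (exponents_relations _ _ _ _ _ Halpha) as [Hsum [Hmu1 Hmu2]].
  split; [apply reads_in_zcoord|].
  do 3 (split; [assumption|]).
  split; [apply reads_in_wcoord; assumption|].
  split.
  - intros U l HU Hdisc Hl.
    assert (E : forall a b c, (fun w => G (l w) a (b - 1) (c - 1) w) = G_branch a b c l 0).
    { intros a b c. apply functional_extensionality. intros w. apply G_G_branch. }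
    rewrite !E. apply hyper_ode_basis; try assumption. apply log_branch_log_on, Hl.
  - intros V l HV Hdisc Hl.
    assert (E : forall a b c, (fun tau => G (l tau) a (b - 1) (c - 1) (wcoord tau)) = tau_branch l a b c).
    { intros a b c. apply functional_extensionality. intros t.
      exact (G_G_branch a b c (fun _ => l t) (wcoord t)). }
    rewrite !E. apply mlde_basis; try assumption.
    intros t Ht. destruct (Hl t Ht) as [Lc Le]. split; [apply continuous_Ccont; exact Lc|exact Le].
Qed.
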